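(* Let $\Lambda\subset(0,\infty)$ be finite or countable. Any unitary representation $\rho$ of the group $\mathbb I_\Lambda$ extends by continuity (with respect to the weak operator topology) to a $*$-representation $\overline\rho$ of the semigroup $\Gamma_\Lambda$. Moreover, the weak closure $\overline{\rho(\mathbb I_\Lambda)}$ of the set of all operators $\rho(g)$, where $g$ ranges in $\mathbb I_\Lambda$, coincides with $\overline\rho(\Gamma_\Lambda)$.
   Context: An ultrametric space is a metric space with $d(x,z)\le\max(d(x,y),d(y,z))$; its spectrum is its set of nonzero distances. $\mathbb U=\mathbb U_\Lambda$ is the ultrametric Urysohn space: the unique (up to isometry) complete separable ultrametric space with spectrum $\Lambda$ such that for any finite ultrametric spaces $X\subset Y$ with spectra in $\Lambda$, each isometric embedding $X\to\mathbb U_\Lambda$ extends to an isometric embedding $Y\to\mathbb U_\Lambda$. $\mathbb I_\Lambda$ is the group of all bijective isometries of $\mathbb U_\Lambda$ with the topology of pointwise convergence. Unitary representations are continuous homomorphisms to the unitary group (strong operator topology) of a separable Hilbert space. The $\mathbb R$-tree $T(\mathbb U)$: its points are ideal balls, i.e. symbols $\beta(x,r)$ with $x\in\mathbb U$, $r\ge0$, where $\beta(x_1,r_1)=\beta(x_2,r_2)$ iff $r_1=r_2=r$ and $d(x_1,x_2)\le r$. The height of $\beta(x,r)$ is $r$. A point $\beta(y,r_2)$ is over $\beta(x,r_1)$ (and the latter is under the former) if $r_1<r_2$ and $d(x,y)\le r_2$. The distance between $\beta(x,r_1)$ and $\beta(x,r_2)$ is $|r_1-r_2|/2$; if $r:=d(x,y)>\max(r_1,r_2)$,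 the distance between $\beta(x,r_1)$ and $\beta(y,r_2)$ is $\frac12(r-r_1)+\frac12(r-r_2)$. Points of $\mathbb U$ are identified with points of height $0$; $T_{>0}(\mathbb U)$ is the set of points of positive height. For $\xi=\beta(x,r)$ the ascending path $L_\xi$ consists of the points $\beta(x,r+t)$, $t\ge0$; it is natural to add a point $\infty$ of infinite height, to which all ascending paths lead. All points whose height lies in $\Lambda$ are vertices of $T(\mathbb U)$ (they have infinite valence). For a vertex $v$, $\mathrm{germ}^\downarrow(v)$ is the set of germs at $v$ of geodesic segments going down from $v$; for $v=\beta(x,\lambda)$ they are enumerated by the open balls $\{z:d(z,y)<\lambda\}$ contained in $\{z:d(z,x)\le\lambda\}$. If $\xi$ is over $\eta$, the geodesic segment $[\xi,\eta]$ is naked if it contains no actual vertices (vertices of valence $\ge3$) except possibly $\xi$ and $\eta$; each naked segment lies in a unique maximal naked segment (whose upper end may be $\infty$, and whose lower end may have height $0$). Let $\mathrm{Isolated}(\mathbb U)$ be the set of isolated points of $\mathbb U$ (empty if $0$ is a limit point of $\Lambda$, and all of $\mathbb U$ otherwise). Let $\widetilde T(\mathbb U)$ be the disjoint union of $T_{>0}(\mathbb U)\cup\mathrm{Isolated}(\mathbb U)$ and of all sets $\mathrm{germ}^\downarrow(v)$, $v$ ranging over vertices. (So the first part is $T_{>0}(\mathbb U)$ if $0$ is a limit point of $\Lambda$ and $T(\mathbb U)$ otherwise.) A nonempty subset $\mathbf S\subset\widetilde T(\mathbb U)$ is a woolly subtree if: (1) if $\xi\in T_{>0}(\mathbb U)\cup\mathrm{Isolated}(\mathbb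 U)$ is in $\mathbf S$, then all points of $L_\xi$ are in $\mathbf S$, and for each vertex $v\in L_\xi$ the element of $\mathrm{germ}^\downarrow(v)$ directed to $\xi$ is in $\mathbf S$; (2) if $\gamma\in\mathrm{germ}^\downarrow(v)$ is in $\mathbf S$, then $v\in\mathbf S$; (3) let $[\xi,\eta]$ be a maximal naked segment with $\xi$ over $\eta$: if an interior point of $[\xi,\eta]$ is in $\mathbf S$, then $\eta\in\mathbf S$; if the height of $\xi$ is in $\Lambda$ and the unique element of $\mathrm{germ}^\downarrow(\xi)$ is in $\mathbf S$, then $\eta\in\mathbf S$. A partial bijection $\pi$ of a set $\Omega$ is a bijection of a subset $\mathrm{dom}\,\pi\subset\Omega$ onto a subset $\mathrm{im}\,\pi\subset\Omega$; partial bijections are multiplied by composing wherever defined, and $\pi^*$ is the inverse bijection $\mathrm{im}\,\pi\to\mathrm{dom}\,\pi$. $\Gamma_\Lambda$ is the semigroup, with involution $\pi\mapsto\pi^*$, of all partial bijections $\pi$ of $\widetilde T(\mathbb U_\Lambda)$ whose domain is a woolly subtree $J$ and which send $J$ isomorphically, with preservation of the height, to a woolly subtree. $\mathbb I_\Lambda$ is contained in $\Gamma_\Lambda$ via its natural action on $\widetilde T(\mathbb U_\Lambda)$. Topology: the set of all partial bijections of $\Omega=\widetilde T(\mathbb U_\Lambda)$ has the topology whose base consists of the sets determined by finitely many conditions, each of the form ''$\pi$ sends $\omega$ to $\omega'$'' or ''$\pi$ does not send $\omega$ to $\omega'$ (i.e. $\omega\notin\mathrm{dom}\,\pi$ or $\pi(\omega)\ne\omega'$)'',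 with $\omega,\omega'\in\Omega$; $\Gamma_\Lambda$ carries the induced topology. A $*$-representation of $\Gamma_\Lambda$ in a Hilbert space is a homomorphism $\overline\rho$ to the multiplicative semigroup of bounded operators with $\overline\rho(\pi^* )=\overline\rho(\pi)^*$. *)

(* Defs.v *)
From HB Require Import structures.
From mathcomp Require Import all_boot all_order all_algebra.
From mathcomp Require Import complex sesquilinear.
From mathcomp Require Import all_classical all_reals all_analysis.

Set Implicit Arguments.
Unset Strict Implicit.
Unset Printing Implicit Defensive.

Import Order.TTheory GRing.Theory Num.Theory.
Import numFieldNormedType.Exports.

Local Open Scope classical_set_scope.
Local Open Scope ring_scope.

Definition separable (T : topologicalType) : Prop :=
  exists2 D : set T, countable D & dense D.

Definition ultrametric (R : realType) (U : metricType R) : Prop :=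
  forall x y z : U, mdist x z <= Num.max (mdist x y) (mdist y z).

Definition spectrum (R : realType) (U : metricType R) : set R :=
  [set r | exists x y : U, x <> y /\ mdist x y = r].

Definition isometric (R : realType) (X Y : metricType R) (f : X -> Y) : Prop :=
  forall x y, mdist (f x) (f y) = mdist x y.

(* In [urysohn_ext] the finite space X is a subset of Y; X may be empty, so
   that the clause also makes U nonempty (this matters when Lambda is empty). *)
Record urysohn (R : realType) (Lambda : set R) (U : metricType R) : Prop := {
  urysohn_ultrametric : ultrametric U;
  urysohn_complete :
    forall F : set_system U, ProperFilter F -> cauchy F ->
      exists x : U, F --> x;
  urysohn_separable : separable U;
  urysohn_spectrum : spectrum U = Lambda;
  urysohn_ext : forall (Y : metricType R) (X : set Y) (f : X -> U),
    finite_set [set: Y] -> ultrametric Y -> spectrum Y `<=` Lambda ->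
    (forall a b : X, mdist (f a) (f b) = mdist (set_val a) (set_val b)) ->
    exists g : Y -> U, isometric g /\ forall a : X, g (set_val a) = f a }.

Section isometry_group.
Context {R : realType} (U : metricType R).

Definition isometries : set {ptws U -> U} :=
  [set g | isometric (g : U -> U) /\ bijective g].

Definition isom_fun (g : isometries) : U -> U := set_val g.

Lemma isom_isometric (g : isometries) : isometric (isom_fun g).
Proof. by have [] := set_valP g. Qed.

Lemma isom_bij (g : isometries) : bijective (isom_fun g).
Proof. by have [] := set_valP g. Qed.

Lemma isom_mul_subproof (g h : isometries) :
  isom_fun g \o isom_fun h \in isometries.
Proof.
apply/mem_set; split; last by apply: bij_comp; exact: isom_bij.
by move=> x y /=; rewrite !isom_isometric.
Qed.

Definition isom_mul (g h : isometries) : isometries :=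
  exist (fun f => f \in isometries) _ (isom_mul_subproof g h).

End isometry_group.
Arguments isometries {R} U.

Section tree.
Context {R : realType} {U : metricType R}.

Definition cball (x : U) (r : R) : set U := [set z | mdist x z <= r].

(* In an ultrametric space d(x1, x2) <= r iff the closed balls of radius r
   centred at x1 and x2 are the same set, so an ideal ball is a closed ball
   together with its radius; see [ibetaP] below. *)
Record iball := IBall {
  iball_set : set U;
  radius : {nonneg R};
  iball_ex : exists x, iball_set = cball x radius%:num }.

Definition ibeta (x : U) (r : {nonneg R}) : iball :=
  @IBall (cball x r%:num) r (ex_intro _ x erefl).

Lemma iball_eq (b c : iball) :
  iball_set b = iball_set c -> radius b = radius c -> b = c.
Proof.
case: b c => [B r bP] [C s cP] /= eBC ers; subst C s.
by congr IBall; exact: Prop_irrelevance.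
Qed.

Lemma ibetaP (x1 x2 : U) (r1 r2 : {nonneg R}) : ultrametric U ->
  ibeta x1 r1 = ibeta x2 r2 <-> r1 = r2 /\ mdist x1 x2 <= r1%:num.
Proof.
move=> um; split=> [[e <-]|[<- d12]].
  split=> //; have : cball x2 r2%:num x2 by rewrite /cball/= mdistxx.
  by rewrite -e.
apply: iball_eq => //=; apply/seteqP; split=> z /= h.
  by apply: le_trans (um _ x1 _) _; rewrite ge_max (metric_sym x2) d12.
by apply: le_trans (um _ x2 _) _; rewrite ge_max d12.
Qed.

(* [None] is the point at infinity, to which all ascending paths lead.  Having
   infinite height, it lies in [tilde_points] below, hence in every woolly
   subtree; when Lambda is unbounded a limit of isometries may be defined at no
   other point. *)
Definition tree : Type := option iball.

Definition beta (x : U) (r : {nonneg R}) : tree := Some (ibeta x r).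

Definition height (p : tree) : \bar R :=
  if p is Some b then (radius b)%:num%:E else +oo%E.

Definition over (q p : tree) : Prop :=
  match q, p with
  | Some c, Some b => exists x y, [/\ b = ibeta x (radius b),
      c = ibeta y (radius c), (radius b)%:num < (radius c)%:num
      & mdist x y <= (radius c)%:num]
  | None, Some _ => True
  | _, None => False
  end.

(* the path L_p, including its end at infinity *)
Definition ascending_path (p : tree) : set tree :=
  [set q | q = p \/ over q p].

Definition segment (xi eta : tree) : set tree :=
  [set z | ascending_path eta z /\ ascending_path z xi].

(* A segment going down from v is determined by its lower end; this is the set
   of lower ends of the segments having the same germ at v as [v, q]. *)
Definition germ_class (v q : tree) : set tree :=
  [set q' | over v q' /\ exists z,
     [/\ over v z, ascending_path q z & ascending_path q' z]].

End tree.
Arguments iball {R} U.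
Arguments tree {R} U.

Section wool.
Context {R : realType} (Lambda : set R) (U : metricType R).

Definition vertex (v : tree U) : Prop := exists2 l, Lambda l & height v = l%:E.

Record germ := Germ {
  germ_vertex : tree U;
  germ_dir : set (tree U);
  germ_vertexP : vertex germ_vertex;
  germ_dirP :
    exists2 q, over germ_vertex q & germ_dir = germ_class germ_vertex q }.

(* There is exactly one ascending germ at each point, so valence at least 3
   means at least two descending germs. *)
Definition actual_vertex (v : tree U) : Prop :=
  exists g1 g2 : germ, [/\ germ_vertex g1 = v, germ_vertex g2 = v & g1 <> g2].

Definition naked (xi eta : tree U) : Prop :=
  over xi eta /\ forall z, segment xi eta z -> z <> xi -> z <> eta ->
    ~ actual_vertex z.

Definition maximal_naked (xi eta : tree U) : Prop :=
  naked xi eta /\ forall xi' eta', naked xi' eta' ->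
    segment xi eta `<=` segment xi' eta' -> xi' = xi /\ eta' = eta.

Definition tilde_points : set (tree U) :=
  [set p | (0 < height p)%E] `|`
  [set beta x 0%:nng | x in isolated [set: U]].

Definition tilde_tree : Type := (tilde_points + germ)%type.

Definition has_point (S : set tilde_tree) (p : tree U) : Prop :=
  exists2 q : tilde_points, set_val q = p & S (inl q).

Record woolly (S : set tilde_tree) : Prop := {
  woolly_nonempty : S !=set0;
  woolly_ascending : forall xi : tilde_points, S (inl xi) ->
    (forall q, ascending_path (set_val xi) q -> has_point S q) /\
    (forall g : germ, ascending_path (set_val xi) (germ_vertex g) ->
       germ_dir g (set_val xi) -> S (inr g));
  woolly_germ : forall g : germ, S (inr g) -> has_point S (germ_vertex g);
  (* g is the germ of the segment [xi, eta] *)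
  woolly_naked : forall xi eta, maximal_naked xi eta ->
    (forall z, segment xi eta z -> z <> xi -> z <> eta ->
       has_point S z -> has_point S eta) /\
    (forall g : germ, germ_vertex g = xi -> germ_dir g eta -> S (inr g) ->
       has_point S eta) }.

End wool.
Arguments tilde_points {R} U.
Arguments woolly {R Lambda U} S.

Record partial_bij (Omega : Type) := PartialBij {
  sends : Omega -> Omega -> Prop;
  sends_fun : forall a b b', sends a b -> sends a b' -> b = b';
  sends_inj : forall a a' b, sends a b -> sends a' b -> a = a' }.

Section partial_bij.
Context {Omega : Type}.
Implicit Types p q : partial_bij Omega.

Definition pb_dom p : set Omega := [set a | exists b, sends p a b].
Definition pb_im p : set Omega := [set b | exists a, sends p a b].

(* [pb_mul p q] applies q first. *)
Definition pb_mul p q : partial_bij Omega.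
Proof.
exists (fun a c => exists2 b, sends q a b & sends p b c).
- move=> a c c' [b qab pbc] [b' qab' pbc'].
  by rewrite (sends_fun qab' qab) in pbc'; exact: sends_fun pbc pbc'.
- move=> a a' c [b qab pbc] [b' qab' pbc'].
  by rewrite (sends_inj pbc' pbc) in qab'; exact: sends_inj qab qab'.
Defined.

Definition pb_star p : partial_bij Omega :=
  @PartialBij _ (fun a b => sends p b a)
    (fun a b b' => @sends_inj _ p b b' a) (fun a a' b => @sends_fun _ p b a a').

Definition pb_subbase : set (set (partial_bij Omega)) :=
  [set A | exists a b, A = [set p | sends p a b] \/
                       A = [set p | ~ sends p a b]].

End partial_bij.

HB.instance Definition _ (Omega : Type) := gen_eqMixin (partial_bij Omega).
HB.instance Definition _ (Omega : Type) := gen_choiceMixin (partial_bij Omega).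
HB.instance Definition _ (Omega : Type) :=
  isSubBaseTopological.Build (partial_bij Omega) (@pb_subbase Omega) id.

Section Gamma.
Context {R : realType} (Lambda : set R) (U : metricType R).
Local Notation Omega := (tilde_tree Lambda U).

(* The distance of the tree is determined by the heights and by the relation
   [over], since an ascending path contains the points where it is joined by
   other ascending paths. *)
Record tree_isomorphism (p : partial_bij Omega) : Prop := {
  tiso_sort : forall a g, ~ sends p (inl a) (inr g) /\ ~ sends p (inr g) (inl a);
  tiso_height : forall a a', sends p (inl a) (inl a') ->
    height (set_val a') = height (set_val a);
  tiso_over : forall a a' b b',
    sends p (inl a) (inl a') -> sends p (inl b) (inl b') ->
    over (set_val a') (set_val b') <-> over (set_val a) (set_val b);
  tiso_vertex : forall g g' a a',
    sends p (inr g) (inr g') -> sends p (inl a) (inl a') ->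
    germ_vertex g' = set_val a' <-> germ_vertex g = set_val a;
  tiso_dir : forall g g' a a',
    sends p (inr g) (inr g') -> sends p (inl a) (inl a') ->
    germ_dir g' (set_val a') <-> germ_dir g (set_val a) }.

Definition Gamma : set (partial_bij Omega) :=
  [set p | [/\ woolly (pb_dom p), woolly (pb_im p) & tree_isomorphism p]].

End Gamma.
Arguments Gamma {R} Lambda U.

Section action.
Context {R : realType} {Lambda : set R} {U : metricType R}.
Implicit Type g : isometries U.

Lemma isom_cball g (x : U) (r : R) :
  isom_fun g @` cball x r = cball (isom_fun g x) r.
Proof.
have [h hg gh] := isom_bij g; apply/seteqP; split=> [_ [z zx <-]|z zx].
  by rewrite /cball/= isom_isometric.
by exists (h z) => //; move: zx; rewrite /cball/= -{1}(gh z) isom_isometric.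
Qed.

Lemma act_iball_subproof g (b : iball U) :
  exists x, isom_fun g @` iball_set b = cball x (radius b)%:num.
Proof.
by have [x ->] := iball_ex b; exists (isom_fun g x); exact: isom_cball.
Qed.

Definition act_iball g (b : iball U) : iball U :=
  IBall (act_iball_subproof g b).

Definition act_tree g : tree U -> tree U := omap (act_iball g).

Lemma act_ibeta g x r : act_iball g (ibeta x r) = ibeta (isom_fun g x) r.
Proof. by apply: iball_eq => //=; exact: isom_cball. Qed.

Lemma act_tree_bij g : bijective (act_tree g).
Proof.
have [h hg gh] := isom_bij g.
have hI : h \in isometries U.
  apply/mem_set; split; last by exists (isom_fun g).
  by move=> x y; rewrite -{2}(gh x) -{2}(gh y) isom_isometric.
exists (act_tree (exist (fun f => f \in isometries U) h hI)) => -[b|]//=; congr Some; apply: iball_eq => //=.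
  by rewrite image_comp (_ : _ \o _ = id) ?image_id//; apply/funext => x /=;
    exact: hg.
by rewrite image_comp (_ : _ \o _ = id) ?image_id//; apply/funext => x /=;
  exact: gh.
Qed.

Lemma act_over g (q p : tree U) : over (act_tree g q) (act_tree g p) <-> over q p.
Proof.
case: q p => [c|] [b|] //=; split=> -[x [y [bx cy lt dxy]]].
  have [h hg gh] := isom_bij g.
  exists (h x), (h y); split => //; last first.
  - by rewrite -(isom_isometric g) !gh.
  - apply/Some_inj/(bij_inj (act_tree_bij g)); rewrite /= act_ibeta gh.
    by congr Some.
  - apply/Some_inj/(bij_inj (act_tree_bij g)); rewrite /= act_ibeta gh.
    by congr Some.
exists (isom_fun g x), (isom_fun g y); split => //.
- by rewrite {1}bx act_ibeta.
- by rewrite {1}cy act_ibeta.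
- by rewrite isom_isometric.
Qed.

Lemma act_ascending g (q p : tree U) :
  ascending_path (act_tree g p) (act_tree g q) <-> ascending_path p q.
Proof.
split=> -[e|o].
- by left; exact: (bij_inj (act_tree_bij g)).
- by right; move/act_over: o.
- by left; rewrite e.
- by right; apply/act_over; exact: o.
Qed.

Lemma act_germ_class g (v q : tree U) :
  act_tree g @` germ_class v q = germ_class (act_tree g v) (act_tree g q).
Proof.
have [h hg gh] := act_tree_bij g; apply/seteqP; split.
  move=> _ [q' [vq' [z [vz qz q'z]]] <-]; split; first exact/act_over.
  by exists (act_tree g z); split; [exact/act_over|exact/act_ascending..].
move=> q'; rewrite -(gh q') => -[/act_over vq' [z]].
rewrite -(gh z) => -[/act_over vz /act_ascending qz /act_ascending q'z].
by exists (h q') => //; split=> //; exists (h z).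
Qed.

Lemma act_height g (p : tree U) : height (act_tree g p) = height p.
Proof. by case: p. Qed.

Lemma act_isolated g (x : U) :
  isolated [set: U] x -> isolated [set: U] (isom_fun g x).
Proof.
have [h hg gh] := isom_bij g.
move=> [_ [V /nbhs_ballP[e /= e0 xeV]]]; rewrite setIT => Vx.
split; first exact: in_setT.
exists (ball (isom_fun g x) e); first exact: nbhsx_ballx.
rewrite setIT; apply/seteqP; split=> y /=; last first.
  by move=> ->; exact: ballxx.
rewrite ballEmdist/= -(gh y) isom_isometric => xy; congr isom_fun.
suff : V (h y) by rewrite Vx.
by apply: xeV; rewrite ballEmdist.
Qed.

Lemma act_point_subproof g (p : tilde_points U) :
  act_tree g (set_val p) \in tilde_points U.
Proof.
apply/mem_set; have [p0|[x xi e]] := set_valP p.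
  by left; rewrite /= act_height.
right; exists (isom_fun g x); first exact: act_isolated.
by rewrite /beta -act_ibeta -[Some _]/(act_tree g (beta x _)) e.
Qed.

Definition act_point g (p : tilde_points U) : tilde_points U :=
  exist (fun q => q \in tilde_points U) _ (act_point_subproof g p).

Lemma act_germ_vertexP g (c : germ Lambda U) :
  vertex Lambda (act_tree g (germ_vertex c)).
Proof. by have [l Ll e] := germ_vertexP c; exists l; rewrite ?act_height. Qed.

Lemma act_germ_dirP g (c : germ Lambda U) :
  exists2 q, over (act_tree g (germ_vertex c)) q &
    act_tree g @` germ_dir c = germ_class (act_tree g (germ_vertex c)) q.
Proof.
have [q vq ->] := germ_dirP c; exists (act_tree g q); first exact/act_over.
exact: act_germ_class.
Qed.

Definition act_germ g (c : germ Lambda U) : germ Lambda U :=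
  Germ (act_germ_vertexP g c) (act_germ_dirP g c).

Definition act_tilde g (a : tilde_tree Lambda U) : tilde_tree Lambda U :=
  match a with inl p => inl (act_point g p) | inr c => inr (act_germ g c) end.

Lemma germ_eq (c d : germ Lambda U) :
  germ_vertex c = germ_vertex d -> germ_dir c = germ_dir d -> c = d.
Proof.
case: c d => [v D vP DP] [w E wP EP] /= evw eDE; subst w E.
by congr Germ; exact: Prop_irrelevance.
Qed.

Lemma act_tilde_inj g : injective (act_tilde g).
Proof.
have gI := bij_inj (act_tree_bij g).
move=> [p|c] [q|d] //= [].
  by move=> /gI /val_inj ->.
move=> /gI ev eD; congr inr; apply: germ_eq => //.
by apply/funext => x; have := image_inj gI (A := germ_dir c) (a := x); rewrite eD image_inj.
Qed.

Definition isom_pb g : partial_bij (tilde_tree Lambda U).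
Proof.
exists (fun a b => b = act_tilde g a) => [a b b' -> ->//|a a' b -> e].
exact: act_tilde_inj e.
Defined.

End action.

Section hilbert.
Context {R : realType} (H : completeNormedModType R[i]).
Variable dot : {dot H for @Num.conj R[i]}.

Definition hilbert_norm : Prop := forall u : H, `|u| ^+ 2 = dot u u.

Record bounded_op := BoundedOp {
  bop_fun :> {linear H -> H};
  bop_bounded : bounded_near bop_fun (nbhs (0 : H)) }.

HB.instance Definition _ := gen_eqMixin bounded_op.
HB.instance Definition _ := gen_choiceMixin bounded_op.

Definition strong_op : topologicalType :=
  initial_topology (fun T : bounded_op => (T : H -> H) : {ptws H -> H}).

Definition weak_op : topologicalType :=
  initial_topology (fun T : bounded_op =>
    (fun uv : H * H => dot (T uv.1) uv.2) : {ptws (H * H)%type -> (R[i] : numFieldType)}).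

Definition unitary (T : bounded_op) : Prop :=
  bijective T /\ forall u v, dot (T u) (T v) = dot u v.

Definition adjoint (T S : bounded_op) : Prop :=
  forall u v, dot (T u) v = dot u (S v).

Record unitary_representation (U : metricType R)
    (rho : isometries U -> bounded_op) : Prop := {
  rep_unitary : forall g, unitary (rho g);
  rep_mul : forall g h u, rho (isom_mul g h) u = rho g (rho h u);
  rep_continuous : continuous (rho : isometries U -> strong_op) }.

Definition star_representation (Omega : Type) (G : set (partial_bij Omega))
    (rho : partial_bij Omega -> bounded_op) : Prop :=
  (forall p q, G p -> G q ->
     forall u, rho (pb_mul p q) u = rho p (rho q u)) /\
  (forall p, G p -> adjoint (rho p) (rho (pb_star p))).

End hilbert.

(* Main.v *)
(** Only the traces of an element of Gamma on the balls matter: for every closed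
    ball or germ, which points lie below it and which points lie below its image.
    By homogeneity every such coherent system of relations is approximated by
    isometries, so it is the limit of a proper filter on the isometry group.

    Vectors fixed by the stabilizer of finitely many balls B(x_i, s), s > 0, are
    dense. For such u and v, the coefficient <rho(g) u, v> does not change if u is
    projected to the vectors fixed by the stabilizer of the balls B(x_i, t_i),
    where t_i >= s is the height at which the path from g x_i meets the subtree
    spanned by the B(x_j, s): a generic translate in the stabilizer makes the two
    subtrees independent over their intersection. When g and h are close to each
    other along the filter, h^-1 g stabilizes the balls B(x_i, max(t_i, t'_i)), so
    rho(g) and rho(h) agree on the corresponding fixed vectors; and the projections
    at the heights t_i and max(t_i, t'_i) are close, since a projection depends
    monotonically on each height and these projections commute. Hence the
    coefficients converge, which defines the extension.

    Conversely an operator of the weak closure is the limit of rho along an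
    ultrafilter on the isometry group, and the limit of the isometries along an
    ultrafilter is an element of Gamma. *)

Require Import Defs.
From HB Require Import structures.
From mathcomp Require Import all_boot all_order all_algebra.
From mathcomp Require Import complex sesquilinear.
From mathcomp Require Import all_classical all_reals all_analysis.
From mathcomp Require Import ring lra.

Set Implicit Arguments.
Unset Strict Implicit.
Unset Printing Implicit Defensive.

Import Order.TTheory GRing.Theory Num.Theory.
Import numFieldNormedType.Exports.

Local Open Scope classical_set_scope.
Local Open Scope ring_scope.

(** * Homogeneity of the Urysohn space *)

(** The heights [t_i] need not stabilize along the filter: when [Lambda] accumulates, the distances
    from [g x_i] may drift for ever. What the filter decides is on which side of each real number a
    height lies, and this suffices because the projections depend monotonically on the heights.

    The room for generic translates comes from the infinite valence at heights in [Lambda], where a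
    germ can be chosen to avoid finitely many points. At other heights nothing branches and nothing
    has to be avoided; hence the case distinctions on [Lambda (r l)]. One strengthened form of
    homogeneity, [generic_homogeneity], serves both the free translates and the density of the
    isometries.

    Different radii may cut [U] into the same balls, so relations are tested at proper levels only,
    one for each nontrivial partition.

    Limits in the Hilbert space are found without weak compactness: almost minimal vectors in
    midpoint hulls yield the projections as well as the weak limits. *)

Record metric_data (R : realType) (T : choiceType) := MetricData {
  md_dist :> T -> T -> R;
  md_xx : forall x, md_dist x x = 0;
  md_pos : forall x y, md_dist x y = 0 -> x = y;
  md_sym : forall x y, md_dist x y = md_dist y x;
  md_tri : forall y x z, md_dist x z <= md_dist x y + md_dist y z }.

(** The distance is a phantom parameter of the type, so that one finite carrier can be given any
    metric; the test spaces for [urysohn_ext] are built this way. *)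
Definition metric_of (R : realType) (T : choiceType) (d : metric_data R T)
  : Type := T.

HB.instance Definition _ (R : realType) (T : choiceType) (d : metric_data R T) :=
  Choice.on (metric_of d).
HB.instance Definition _ (R : realType) (T : choiceType) (d : metric_data R T) :=
  isMetric.Build R (metric_of d)
    (md_xx d) (@md_pos _ _ d) (md_sym d) (md_tri d).

Section urysohn.
Context {R : realType} {Lambda : set R} {U : metricType R}.
Hypothesis uryU : urysohn Lambda U.
Hypothesis Lpos : Lambda `<=` [set r | 0 < r].

Let um := urysohn_ultrametric uryU.

Lemma mdist_spectrum (x y : U) : x <> y -> Lambda (mdist x y).
Proof. by move=> xy; rewrite -(urysohn_spectrum uryU); exists x, y. Qed.

Lemma mdist_spectrum0 (x y : U) : mdist x y = 0 \/ Lambda (mdist x y).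
Proof.
have [->|/eqP xy] := eqVneq x y; first by left; rewrite mdistxx.
by right; exact: mdist_spectrum.
Qed.

(** The extension property is applied to the empty subspace of a one-point space. No distance
    occurs, so an empty [Lambda] is covered too. *)
Lemma urysohn_point : exists x : U, True.
Proof.
have d0 : metric_data R unit.
  by exists (fun _ _ => 0) => [|[] []||_ _ _] //; rewrite addr0.
pose Y : metricType R := metric_of d0.
pose f (x : (set0 : set Y)) : U := False_rect _ (set_mem (valP x)).
have Yfin : finite_set [set: Y] by exact: (@finite_finset unit).
have Yum : ultrametric Y by case=> -[] []; rewrite !mdistxx maxxx.
have Ysp : spectrum Y `<=` Lambda by move=> r [[] [[]]] [].
have fi (a b : (set0 : set Y)) : mdist (f a) (f b) = mdist (set_val a) (set_val b).
  by case: (set_mem (valP a)).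
by have [g _] := urysohn_ext uryU Yfin Yum Ysp fi; exists (g tt).
Qed.

Section one_point.
Variables (B : seq U) (b0 : U) (delta : R).
Hypothesis Ld : Lambda delta.

(** [None] stands for a point that branches off at height [delta] over [b0], in a germ containing no
    point of [B]: it has distance [delta] to the points of the closed ball of radius [delta] about
    [b0], and the distances of [b0] to the others. *)
Definition one_point_dist (x y : option (seq_sub B)) : R :=
  match x, y with
  | Some a, Some b => mdist (ssval a) (ssval b)
  | Some a, None | None, Some a => Num.max delta (mdist b0 (ssval a))
  | None, None => 0
  end.

Lemma one_point_ultra x y z :
  one_point_dist x z <= Num.max (one_point_dist x y) (one_point_dist y z).
Proof.
have d0 : 0 <= delta by exact/ltW/Lpos.
case: x y z => [x|] [y|] [z|] //=.
- have := um b0 (ssval y) (ssval x); rewrite ge_max !le_max lexx !orbT/=.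
  by rewrite (metric_sym (ssval y)) => /orP[->|->]; rewrite ?orbT.
- rewrite (le_trans (um _ b0 _))// ge_max !le_max (metric_sym (ssval x)) !lexx/=.
  by rewrite !orbT.
- by rewrite le_max lexx.
- have := um b0 (ssval y) (ssval z); rewrite ge_max !le_max lexx/=.
  by move=> /orP[->|->]; rewrite ?orbT.
- by rewrite !le_max d0.
- by rewrite le_max lexx orbT.
Qed.

Let one_point_ge0 x y : 0 <= one_point_dist x y.
Proof.
by case: x y => [x|] [y|] //=; rewrite ?le_max ?(ltW (Lpos Ld)) ?mdist_ge0.
Qed.

Let one_point_xx x : one_point_dist x x = 0.
Proof. by case: x => [x|]//=; rewrite mdistxx. Qed.

Let one_point_pos x y : one_point_dist x y = 0 -> x = y.
Proof.
have d0 : 0 < delta := Lpos Ld.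
case: x y => [x|] [y|] //=.
- by move=> /mdist_positivity/val_inj ->.
- by move=> /eqP; rewrite gt_eqF// lt_max d0.
- by move=> /eqP; rewrite gt_eqF// lt_max d0.
Qed.

Let one_point_sym x y : one_point_dist x y = one_point_dist y x.
Proof. by case: x y => [x|] [y|] //=; rewrite metric_sym. Qed.

Let one_point_tri y x z :
  one_point_dist x z <= one_point_dist x y + one_point_dist y z.
Proof.
rewrite (le_trans (one_point_ultra x y z))// ge_max.
by rewrite lerDl lerDr !one_point_ge0.
Qed.

Definition one_point_data : metric_data R (option (seq_sub B)) :=
  MetricData one_point_xx one_point_pos one_point_sym one_point_tri.

(* A vertex of height [delta] has infinitely many downward germs, so one of
   them avoids the finite set [B]. *)
Lemma generic_point : exists z : U, forall b, b \in B ->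
  mdist z b = Num.max delta (mdist b0 b).
Proof.
pose Y : metricType R := metric_of one_point_data.
pose f (x : [set Some b | b in [set: seq_sub B]] : set Y) : U :=
  if set_val x is Some b then ssval b else b0.
have Yfin : finite_set [set: Y] by exact: (@finite_finset (option (seq_sub B))).
have Yum : ultrametric Y.
  move=> x y z. exact (one_point_ultra x y z).
have Lmax (x : U) : Lambda (Num.max delta (mdist b0 x)).
  rewrite maxEle; case: ifP => // dx; case: (mdist_spectrum0 b0 x) => // e.
  by move: dx; rewrite e leNgt (Lpos Ld).
have Ysp : spectrum Y `<=` Lambda.
  move=> r [x [y [+ <-]]]; case: x y => [x|] [y|] //= xy; try exact: Lmax.
  by apply: mdist_spectrum => /val_inj exy; apply: xy; rewrite exy.
have fi (a b : [set Some b | b in [set: seq_sub B]] : set Y) :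
    mdist (f a) (f b) = mdist (set_val a) (set_val b).
  have vS (x : [set Some b | b in [set: seq_sub B]] : set Y) :
    exists c, set_val x = Some c by have [c _ e] := set_valP x; exists c; exact: esym e.
  by rewrite /f; have [[a' ->] [b' ->]] := (vS a, vS b).
have [g [gi gf]] := urysohn_ext uryU Yfin Yum Ysp fi.
exists (g None) => b bB.
have PX : (Some (SeqSub bB) : Y) \in [set Some b | b in [set: seq_sub B]].
  by apply/mem_set; exists (SeqSub bB).
have e : g (Some (SeqSub bB)) = b := gf (exist (fun x => x \in _) _ PX).
by rewrite -[in LHS]e gi.
Qed.

End one_point.
End urysohn.

Section homogeneity.
Context {R : realType} {Lambda : set R} {U : metricType R}.
Hypothesis uryU : urysohn Lambda U.
Hypothesis Lpos : Lambda `<=` [set r | 0 < r].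

Let um := urysohn_ultrametric uryU.

Definition partial_isometry (s : seq (U * U)) :=
  forall a b, a \in s -> b \in s -> mdist a.1 b.1 = mdist a.2 b.2.

Lemma ultra_eq (x y z : U) : mdist x y < mdist y z -> mdist x z = mdist y z.
Proof.
move=> xy; apply/eqP; rewrite eq_le; apply/andP; split.
  by rewrite (le_trans (um x y z))// ge_max lexx (ltW xy).
have := um y x z; rewrite le_max (metric_sym y x) => /orP[|//].
by rewrite leNgt xy.
Qed.

Lemma max_ultra (x a b : U) : mdist x a <= mdist x b ->
  Num.max (mdist x a) (mdist a b) = mdist x b.
Proof.
move=> xab; apply/eqP; rewrite eq_le um andbT ge_max xab/=.
by rewrite (le_trans (um a x b))// ge_max lexx metric_sym xab.
Qed.

(** The nearest point [a] decides all distances: [mdist x b.1] is the maximum of [mdist x a.1] and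
    [mdist a.1 b.1]. So a generic point at height [mdist x a.1] over [a.2] is a possible image, and
    it can avoid [ys] as well. *)
Lemma partial_isometry_extension (s : seq (U * U)) x (ys : seq U) a :
  partial_isometry s -> a \in s ->
  (forall b, b \in s -> mdist x a.1 <= mdist x b.1) ->
  exists2 y, partial_isometry ((x, y) :: s) &
    forall z, z \in ys -> mdist x a.1 <= mdist y z.
Proof.
move=> si sa amin.
suff [y yP yz] : exists2 y, (forall b, b \in s -> mdist x b.1 = mdist y b.2) &
    forall z, z \in ys -> mdist x a.1 <= mdist y z.
  exists y => // b c; rewrite !inE => /orP[/eqP->|bs] /orP[/eqP->|cs] /=.
  - by rewrite !mdistxx.
  - exact: yP.
  - by rewrite metric_sym yP// metric_sym.
  - exact: si.
have [xa|Lxa] := mdist_spectrum0 uryU x a.1.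
  exists a.2 => [b bs|z _]; last by rewrite xa mdist_ge0.
  by rewrite -(si a b)// (mdist_positivity _ _ xa).
have [y yP] :=
  generic_point uryU Lpos ([seq b.2 | b <- s] ++ ys) a.2 Lxa.
exists y => [b bs|z zys].
  rewrite yP ?mem_cat ?map_f ?orbT// -si// max_ultra//.
  exact: amin.
by rewrite yP ?mem_cat ?zys ?orbT// le_max lexx.
Qed.

Lemma seq_argmin (T : eqType) (f : T -> R) (s : seq T) : s != [::] ->
  exists2 a, a \in s & forall b, b \in s -> f a <= f b.
Proof.
elim: s => // c s ih _; have [->|s0] := eqVneq s [::].
  by exists c; rewrite ?inE ?eqxx// => b; rewrite inE => /eqP->.
have [a sa amin] := ih s0; have [fca|fac] := leP (f c) (f a).
  exists c; first by rewrite inE eqxx.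
  by move=> b; rewrite inE => /orP[/eqP->//|/amin]; apply: le_trans.
exists a; first by rewrite inE sa orbT.
by move=> b; rewrite inE => /orP[/eqP->|/amin//]; exact: ltW.
Qed.

Lemma partial_isometry_forth s x : partial_isometry s ->
  exists y, partial_isometry ((x, y) :: s).
Proof.
have [->|s0] := eqVneq s [::].
  by exists x => a b; rewrite !inE => /eqP-> /eqP->.
have [a sa amin] := seq_argmin (fun a => mdist x a.1) s0.
move=> si; have [y yi _] := partial_isometry_extension [::] si sa amin.
by exists y.
Qed.

Definition pswap (a : U * U) := (a.2, a.1).

Lemma partial_isometry_swap s :
  partial_isometry s -> partial_isometry [seq pswap a | a <- s].
Proof.
by move=> si _ _ /mapP[a sa ->] /mapP[b sb ->] /=; rewrite (si a b).
Qed.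

Lemma partial_isometry_back s y : partial_isometry s ->
  exists x, partial_isometry ((x, y) :: s).
Proof.
move=> /partial_isometry_swap/(@partial_isometry_forth _ y)[x /partial_isometry_swap].
rewrite /= -map_comp (eq_map (g := id)) ?map_id; first by exists x.
by case.
Qed.

Lemma back_and_forth_step s x : partial_isometry s -> exists t,
  [/\ partial_isometry t, {subset s <= t}, exists y, (x, y) \in t &
      exists y, (y, x) \in t].
Proof.
move=> /(@partial_isometry_forth _ x)[y /(@partial_isometry_back _ x)[z ti]].
exists [:: (z, x), (x, y) & s]; split => //.
- by move=> a sa; rewrite !inE sa !orbT.
- by exists y; rewrite !inE eqxx orbT.
- by exists z; rewrite !inE eqxx.
Qed.

Definition rel_closure (E : U -> U -> Prop) (x y : U) := forall e : R, 0 < e ->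
  exists a b, [/\ E a b, mdist x a < e & mdist y b < e].

Definition rel_isometric (E : U -> U -> Prop) := forall a b a' b',
  E a b -> E a' b' -> mdist a a' = mdist b b'.

Lemma rel_closure_isometric E : rel_isometric E -> rel_isometric (rel_closure E).
Proof.
move=> Ei.
suff le (E' : U -> U -> Prop) x y x' y' : rel_isometric E' -> rel_closure E' x y ->
    rel_closure E' x' y' -> mdist x x' <= mdist y y'.
  move=> x y x' y' xy x'y'; apply/eqP; rewrite eq_le (le E)//=.
  apply: (le (fun a b => E b a)).
  - by move=> a b a' b' ab ab'; rewrite (Ei _ _ _ _ ab ab').
  - by move=> e /xy[a [b [? ? ?]]]; exists b, a.
  - by move=> e /x'y'[a [b [? ? ?]]]; exists b, a.
move=> Ei' xy x'y'; apply/ler_addgt0Pr => e e0.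
have [a [b [ab xa yb]]] := xy _ e0; have [a' [b' [ab' xa' yb']]] := x'y' _ e0.
have y0 : 0 <= mdist y y' by exact: mdist_ge0.
rewrite (le_trans (um x a x'))// ge_max; apply/andP; split.
  by rewrite (le_trans (ltW xa))// lerDr.
rewrite (le_trans (um a a' x'))// ge_max; apply/andP; split; last first.
  by rewrite metric_sym (le_trans (ltW xa'))// lerDr.
rewrite (Ei' _ _ _ _ ab ab') (le_trans (um b y b'))// ge_max; apply/andP; split.
  by rewrite metric_sym (le_trans (ltW yb))// lerDr.
rewrite (le_trans (um y y' b'))// ge_max lerDl (ltW e0)/=.
by rewrite (le_trans (ltW yb'))// lerDr.
Qed.

(** The values of [E] at points tending to [x] generate a Cauchy filter, since [E] preserves
    distances; completeness supplies the image of [x]. *)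
Lemma rel_closure_total E : rel_isometric E ->
  (forall x (e : R), 0 < e -> exists a b, E a b /\ mdist x a < e) ->
  forall x, exists y, rel_closure E x y.
Proof.
move=> Ei Ed x.
pose F : set_system U := filter_from [set e : R | 0 < e]
  (fun e => [set b | exists2 a, E a b & mdist x a < e]).
have FF : ProperFilter F.
  apply: filter_from_proper; last first.
    by move=> e /= /(Ed x)[a [b [ab xa]]]; exists b, a.
  apply: filter_from_filter; first by exists 1 => /=.
  move=> e e' /= e0 e'0; exists (Num.min e e'); first by rewrite lt_min e0.
  by move=> b [a ab]; rewrite lt_min => /andP[? ?]; split; exists a.
have [|y Fy] := urysohn_complete uryU FF.
  apply: cauchy_exP => e e0; have [a [b [ab xa]]] := Ed x _ e0.
  exists b; exists e => //= b' [a' ab' xa'].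
  rewrite ballEmdist /= -(Ei _ _ _ _ ab ab') (le_lt_trans (um a x a'))//.
  by rewrite gt_max metric_sym xa.
exists y => e e0.
have /Fy[d /= d0 dsub] : nbhs y (ball y e) by exact: nbhsx_ballx.
have m0 : 0 < Num.min d e by rewrite lt_min d0.
have [a [b [ab]]] := Ed x _ m0.
rewrite lt_min => /andP[xad xae]; exists a, b; split=> //.
by have : ball y e b by [apply: dsub; exists a]; rewrite ballEmdist.
Qed.

Lemma countable_enum (T : choiceType) (x0 : T) (D : set T) : countable D ->
  exists e : nat -> T, forall x, D x -> exists n, e n = x.
Proof.
move=> /countable_injP[f finj].
exists (fun n => xget x0 [set x | D x /\ f x = n]) => x Dx; exists (f x).
case: xgetP => [y _ [Dy fyx]|/(_ x)/(_ (conj Dx erefl))//].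
by apply: finj; rewrite ?inE.
Qed.

(** Back and forth along a dense sequence [e]: step [n] puts [e n] into the domain and into the
    range. The union is an isometry between dense sets, and its closure is the graph of a
    bijection. *)
Lemma partial_isometry_global s : partial_isometry s ->
  exists g : isometries U, forall a, a \in s -> isom_fun g a.1 = a.2.
Proof.
move=> s0i; have [D Dc Dd] := urysohn_separable uryU.
have [x0 _] := urysohn_point uryU.
have [e eD] := countable_enum x0 Dc.
have /choice[h hP] (sx : seq (U * U) * U) : exists t, partial_isometry sx.1 ->
    [/\ partial_isometry t, {subset sx.1 <= t}, exists y, (sx.2, y) \in t &
      exists y, (y, sx.2) \in t].
  have [si|nsi] := pselect (partial_isometry sx.1); last by exists [::].
  by have [t tP] := @back_and_forth_step sx.1 sx.2 si; exists t.
pose c := fix c n := if n is n'.+1 then h (c n', e n') else s.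
have ci n : partial_isometry (c n).
  by elim: n => //= n ih; have [] := hP (c n, e n) ih.
have cS n : {subset c n <= c n.+1} by have [] := hP (c n, e n) (ci n).
have cmono m n : (m <= n)%N -> {subset c m <= c n}.
  elim: n => [|n ih]; first by rewrite leqn0 => /eqP->.
  by rewrite leq_eqVlt => /orP[/eqP->//|/ih mn a /mn/cS].
pose E a b := exists n, (a, b) \in c n.
have Ei : rel_isometric E.
  move=> a b a' b' [m ab] [n ab'].
  have := @ci (maxn m n) (a, b) (a', b').
  by apply; [apply: cmono ab; exact: leq_maxl|apply: cmono ab'; exact: leq_maxr].
have dense_e x (r : R) : 0 < r -> exists n, mdist x (e n) < r.
  move=> r0; have [] := Dd (ball x r)°.
  - by exists x; exact: nbhsx_ballx.
  - exact: open_interior.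
  move=> y [/interior_subset]; rewrite ballEmdist /= => xy /eD[n en].
  by exists n; rewrite en.
have [|phi phiP] := choice (rel_closure_total Ei _).
  move=> x r /(dense_e x)[n xn].
  have [_ _ [y yn] _] := hP (c n, e n) (ci n).
  by exists (e n), y; split => //; exists n.+1.
pose E' a b := E b a.
have E'i : rel_isometric E' by move=> a b a' b' /Ei ab /ab.
have [|psi psiP] := choice (rel_closure_total E'i _).
  move=> x r /(dense_e x)[n xn].
  have [_ _ _ [y yn]] := hP (c n, e n) (ci n).
  by exists (e n), y; split => //; exists n.+1.
have psiP' y : rel_closure E (psi y) y.
  by move=> r /(psiP y)[a [b [? ? ?]]]; exists b, a.
have cli := rel_closure_isometric Ei.
have phii : isometric phi by move=> x y; rewrite (cli _ _ _ _ (phiP x) (phiP y)).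
have phib : bijective phi.
  exists psi => x.
  - apply: mdist_positivity.
    by rewrite (cli _ _ _ _ (psiP' (phi x)) (phiP x)) mdistxx.
  - apply: mdist_positivity.
    by rewrite -(cli _ _ _ _ (phiP (psi x)) (psiP' x)) ?mdistxx.
have phiI : (phi : {ptws U -> U}) \in isometries U by apply/mem_set; split.
exists (exist (fun f => f \in isometries U) _ phiI) => -[a b] sab.
rewrite /isom_fun/=; apply: mdist_positivity.
rewrite -(cli _ _ _ _ (phiP a) (_ : rel_closure E a b)) ?mdistxx// => r r0.
by exists a, b; rewrite !mdistxx; split => //; exists 0.
Qed.

End homogeneity.

Section generic.
Context {R : realType} {Lambda : set R} {U : metricType R}.
Hypothesis uryU : urysohn Lambda U.
Hypothesis Lpos : Lambda `<=` [set r | 0 < r].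

Let um := urysohn_ultrametric uryU.

Lemma ultra_le (x y z : U) (r : R) :
  mdist x y <= r -> mdist y z <= r -> mdist x z <= r.
Proof. by move=> xy yz; rewrite (le_trans (um x y z))// ge_max xy. Qed.

Lemma ultra_lt (x y z : U) (r : R) :
  mdist x y < r -> mdist y z < r -> mdist x z < r.
Proof. by move=> xy yz; rewrite (le_lt_trans (um x y z))// gt_max xy. Qed.

Section generic_homogeneity.
Variables (L : finType) (p q : L -> U) (r : L -> R) (ys : seq U).
Hypothesis r0 : forall l, 0 <= r l.
Hypothesis match_pq : forall l m,
  Num.max (mdist (q l) (q m)) (Num.max (r l) (r m)) =
  Num.max (mdist (p l) (p m)) (Num.max (r l) (r m)).

(** If [r l] is in [Lambda], several germs hang from the closed ball about [q l]. The germ of [z]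
    may be forced by an index [m] of smaller radius in the same open ball as [l]; when there is
    none, it has to avoid [ys]. *)
Let good_value (l : L) (z : U) := mdist z (q l) <= r l /\
  (Lambda (r l) -> (exists m, r m < r l /\ mdist (p l) (p m) < r l) \/
     forall y, y \in ys -> r l <= mdist z y).

Let match_le l m t : r l <= t -> r m <= t ->
  mdist (p l) (p m) <= t -> mdist (q l) (q m) <= t.
Proof.
move=> lt mt plm; have : Num.max (mdist (q l) (q m)) (Num.max (r l) (r m)) <= t.
  by rewrite match_pq !ge_max lt mt plm.
by rewrite ge_max => /andP[].
Qed.

Let match_gt l m : r m <= r l ->
  r l < mdist (p l) (p m) -> mdist (q l) (q m) = mdist (p l) (p m).
Proof.
move=> ml plm; have := match_pq l m.
rewrite [Num.max (r l) _]max_l// (max_l (ltW plm)) maxElt.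
by case: ltP => // _ e; move: plm; rewrite -e ltxx.
Qed.

(** The points are placed in the order of increasing radius: the head [l] comes last, and every
    placed radius is at most [r l]. Then [match_le] and [match_gt] apply, as the matching hypothesis
    only compares distances above the larger radius. *)
Lemma generic_values (s : seq L) : sorted (fun l m => r m <= r l) s ->
  exists f : L -> U,
    (forall l m, l \in s -> m \in s -> mdist (f l) (f m) = mdist (p l) (p m)) /\
    forall l, l \in s -> good_value l (f l).
Proof.
elim: s => [_|l s ih ls]; first by exists p.
have smax m : m \in s -> r m <= r l.
  have tr : transitive (fun l m => r m <= r l) by move=> a b c ab ca; exact: le_trans ca ab.
  by move: ls => /(order_path_min tr)/allP; exact.
have [f [fi fg]] := ih (path_sorted ls).
have [lins|lnins] := boolP (l \in s).
  exists f; split=> [a b|a]; rewrite !inE => /orP[/eqP->|?].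
  - by move=> /orP[/eqP->|?]; apply: fi.
  - by move=> /orP[/eqP->|?]; apply: fi.
  - exact: fg.
  - exact: fg.
suff [z zf zg] : exists2 z, (forall m, m \in s -> mdist z (f m) = mdist (p l) (p m)) &
    good_value l z.
  have nl m : m \in s -> (m == l) = false.
    by move=> ms; apply/negbTE/eqP => ml; move: lnins; rewrite -ml ms.
  exists (fun m => if m == l then z else f m); split=> [a b|a]; rewrite !inE.
    move=> /orP[/eqP->|sa] /orP[/eqP->|sb]; rewrite ?eqxx ?mdistxx ?(nl _ sa) ?(nl _ sb)//.
    - exact: zf.
    - by rewrite metric_sym zf// metric_sym.
    - exact: fi.
  by move=> /orP[/eqP->|sa]; rewrite ?eqxx// nl//; exact: fg.
have [/hasP[b bs plb]|/hasPn far] := boolP (has (fun m => mdist (p l) (p m) <= r l) s).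
  have s0 : s != [::] by apply/eqP => se; rewrite se in bs.
  have [a sa amin] := seq_argmin (fun m => mdist (p l) (p m)) s0.
  have pla : mdist (p l) (p a) <= r l by exact: le_trans (amin b bs) plb.
  have [||z zi zy] := @partial_isometry_extension _ _ _ uryU Lpos
      [seq (p m, f m) | m <- s] (p l) ys (p a, f a) _ (map_f _ sa).
  - by move=> _ _ /mapP[c cs ->] /mapP[d ds ->] /=; rewrite fi.
  - by move=> _ /mapP[c cs ->] /=; exact: amin.
  have zf m : m \in s -> mdist z (f m) = mdist (p l) (p m).
    move=> ms; rewrite -[LHS]/(mdist (p l, z).2 (p m, f m).2) -zi//.
      by rewrite inE eqxx.
    by rewrite inE map_f ?orbT.
  have ral := smax a sa; have [faq fay] := fg a sa.
  exists z => //; split=> [|Lrl].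
    apply: (@ultra_le _ (f a)); first by rewrite zf.
    apply: (@ultra_le _ (q a)); first exact: le_trans faq ral.
    by apply: match_le => //; rewrite metric_sym.
  (* If the nearest placed point is at distance at least [r l], the choice of [z] is generic.
     Otherwise [l] shares its open ball with [a]: either [a] is a forcing index, or the radii agree
     and [l] inherits the alternative that holds for [a]. *)
  have [rla|pltr] := leP (r l) (mdist (p l) (p a)).
    by right=> y yys; exact: le_trans rla (zy y yys).
  have [ralt|ralge] := ltP (r a) (r l); first by left; exists a.
  have rla : r a = r l by apply/eqP; rewrite eq_le ral.
  have [|[m [ma pam]]|far] := fay; first by rewrite rla.
    left; exists m; rewrite -rla; split=> //; apply: (@ultra_lt _ (p a)) => //.
    by rewrite rla.
  right=> y yys; have := far y yys; rewrite rla => lay; rewrite leNgt; apply/negP => zyr.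
  move: lay; rewrite leNgt => /negP; apply; apply: (@ultra_lt _ z) => //.
  by rewrite metric_sym zf.
(* No placed point is near [l], so every point of the closed ball about [q l] has the right
   distances, and only genericity remains to be arranged. *)
have qf z m : mdist z (q l) <= r l -> m \in s -> mdist z (f m) = mdist (p l) (p m).
  move=> zq ms; have := far m ms; rewrite -ltNge => plm.
  have qlm := match_gt (smax m ms) plm.
  have qfm : mdist (q l) (f m) = mdist (p l) (p m).
    rewrite metric_sym -qlm [RHS]metric_sym; apply: (ultra_eq uryU).
    have [fq _] := fg m ms; rewrite (le_lt_trans fq)// metric_sym qlm.
    exact: le_lt_trans (smax m ms) plm.
  by rewrite -qfm; apply: (ultra_eq uryU); rewrite qfm (le_lt_trans zq).
have [Lrl|nLrl] := pselect (Lambda (r l)); last first.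
  exists (q l); last by split; rewrite ?mdistxx.
  by move=> m ms; apply: qf; rewrite ?mdistxx.
have [z zP] := generic_point uryU Lpos (q l :: ys) (q l) Lrl.
have zq : mdist z (q l) <= r l by rewrite zP ?inE ?eqxx// mdistxx ge_max lexx r0.
exists z => [m ms|]; first exact: qf.
split=> // _; right=> y yys; rewrite zP ?inE ?yys ?orbT//.
by rewrite le_max lexx.
Qed.

Lemma generic_homogeneity : exists g : isometries U, forall l,
  mdist (isom_fun g (p l)) (q l) <= r l /\
  (Lambda (r l) -> (exists m, r m < r l /\ mdist (p l) (p m) < r l) \/
     forall y, y \in ys -> r l <= mdist (isom_fun g (p l)) y).
Proof.
have /generic_values[f [fi fg]] : sorted (fun l m => r m <= r l)
    (sort (fun l m => r m <= r l) (enum L)).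
  by apply: sort_sorted => l m; exact: le_total.
have sE l : l \in sort (fun l m => r m <= r l) (enum L) by rewrite mem_sort mem_enum.
have /(partial_isometry_global uryU Lpos)[g gP] :
    partial_isometry [seq (p l, f l) | l <- enum L].
  by move=> _ _ /mapP[c cs ->] /mapP[d ds ->] /=; rewrite fi.
exists g => l; have /= -> := gP (p l, f l) (map_f _ (mem_enum _ l)).
exact: fg.
Qed.

End generic_homogeneity.
End generic.

(** * Stabilizers of balls *)

Section isometry_group_theory.
Context {R : realType} {U : metricType R}.
Implicit Types g h k : isometries U.

Lemma isom_eq g h : (forall x, isom_fun g x = isom_fun h x) -> g = h.
Proof. by move=> gh; apply: val_inj; apply/funext. Qed.

Lemma isom_one_subproof : (idfun : {ptws U -> U}) \in isometries U.
Proof. by apply/mem_set; split=> //; exists idfun. Qed.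

Definition isom_one : isometries U :=
  exist (fun f => f \in isometries U) _ isom_one_subproof.

Lemma isom_oneE x : isom_fun isom_one x = x.
Proof. by []. Qed.

Lemma isom_inv_subproof g : exists h, forall x,
  isom_fun g (isom_fun h x) = x /\ isom_fun h (isom_fun g x) = x.
Proof.
have [f fg gf] := isom_bij g.
have fI : (f : {ptws U -> U}) \in isometries U.
  apply/mem_set; split; last by exists (isom_fun g).
  by move=> x y; rewrite -(isom_isometric g) !gf.
exists (exist (fun f => f \in isometries U) _ fI) => x.
by split; [exact: gf|exact: fg].
Qed.

Definition isom_inv g : isometries U := projT1 (cid (isom_inv_subproof g)).

Lemma isom_invK g x : isom_fun g (isom_fun (isom_inv g) x) = x.
Proof. by have [] := projT2 (cid (isom_inv_subproof g)) x. Qed.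

Lemma isom_invVK g x : isom_fun (isom_inv g) (isom_fun g x) = x.
Proof. by have [] := projT2 (cid (isom_inv_subproof g)) x. Qed.

Lemma isom_mulE g h x : isom_fun (isom_mul g h) x = isom_fun g (isom_fun h x).
Proof. by []. Qed.

Lemma isom_mulgV g : isom_mul g (isom_inv g) = isom_one.
Proof. by apply: isom_eq => x; rewrite isom_mulE isom_invK. Qed.

Lemma isom_mulVg g : isom_mul (isom_inv g) g = isom_one.
Proof. by apply: isom_eq => x; rewrite isom_mulE isom_invVK. Qed.

Lemma isom_mulVr g h : isom_mul g (isom_mul (isom_inv g) h) = h.
Proof. by apply: isom_eq => x; rewrite !isom_mulE isom_invK. Qed.

Lemma isom_mul1 g : isom_mul g isom_one = g.
Proof. exact: isom_eq. Qed.

Lemma mdist_inv g x y :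
  mdist (isom_fun (isom_inv g) x) y = mdist x (isom_fun g y).
Proof. by rewrite -(isom_isometric g) isom_invK. Qed.

(** In an ultrametric space an isometry moves the centre of a closed ball by at most the radius iff
    it preserves the ball. So this is the setwise stabilizer of finitely many balls. *)
Definition fixer (I : finType) (x : I -> U) (a : I -> R) : set (isometries U) :=
  [set k | forall i, mdist (isom_fun k (x i)) (x i) <= a i].

Lemma fixer_one (I : finType) (x : I -> U) a : (forall i, 0 <= a i) -> fixer x a isom_one.
Proof. by move=> a0 i; rewrite isom_oneE mdistxx. Qed.

Lemma fixer_inv (I : finType) (x : I -> U) a k : fixer x a k -> fixer x a (isom_inv k).
Proof. by move=> kx i; rewrite mdist_inv metric_sym. Qed.

Lemma fixer_mul (I : finType) (x : I -> U) a k k' : ultrametric U ->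
  fixer x a k -> fixer x a k' -> fixer x a (isom_mul k k').
Proof.
move=> um kx k'x i; rewrite isom_mulE.
rewrite (le_trans (um _ (isom_fun k (x i)) _))// ge_max isom_isometric k'x.
exact: kx.
Qed.

Lemma fixer_le (I : finType) (x : I -> U) a b : (forall i, a i <= b i) ->
  fixer x a `<=` fixer x b.
Proof. by move=> ab k kx i; exact: le_trans (kx i) (ab i). Qed.

End isometry_group_theory.

(** * Generic translates of one subtree relative to another *)

Section free_amalgamation.
Context {R : realType} {Lambda : set R} {U : metricType R}.
Hypothesis uryU : urysohn Lambda U.
Hypothesis Lpos : Lambda `<=` [set r | 0 < r].

(** Moving points inside their balls does not affect distances above both radii. This is the
    matching hypothesis of [generic_homogeneity] for translates by stabilizers. *)
Lemma match_close (x y x' y' : U) (s t : R) :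
  mdist x x' <= s -> mdist y y' <= t ->
  Num.max (mdist x' y') (Num.max s t) = Num.max (mdist x y) (Num.max s t).
Proof.
move=> xx' yy'; have le (a b a' b' : U) : mdist a a' <= s -> mdist b b' <= t ->
    Num.max (mdist a' b') (Num.max s t) <= Num.max (mdist a b) (Num.max s t).
  move=> aa' bb'; rewrite ge_max [X in _ && X]le_max lexx orbT andbT.
  apply: (ultra_le uryU (y := a)); first by rewrite metric_sym !le_max aa' !orbT.
  apply: (ultra_le uryU (y := b)); first by rewrite le_max lexx.
  by rewrite !le_max bb' !orbT.
apply/eqP; rewrite eq_le; apply/andP; split; first exact: le.
by apply: le; rewrite metric_sym.
Qed.

Variables (I J : finType) (x : I -> U) (y : J -> U).
Variables (a c : I -> R) (b : J -> R).
Hypotheses (a0 : forall i, 0 <= a i) (b0 : forall j, 0 <= b j).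
(* [c i] is the least height of a point of the path from [x i] which lies in
   the subtree spanned by the balls of radius [b j] about the [y j]. *)
Hypotheses (ac : forall i, a i <= c i)
  (c_le : forall i j, c i <= Num.max (Num.max (a i) (b j)) (mdist (x i) (y j)))
  (c_ge : forall i, exists j, Num.max (mdist (x i) (y j)) (b j) <= c i).

(** A generic [k] moves all the points [k' (x i)] away from the [y j] within the balls of radius
    [c i]. Then the balls about [k (k' (x i))] lie with respect to those about the [y j] just as the
    balls about the [x i] do, and homogeneity gives [k1]. *)
Lemma free_translate (ks : seq (isometries U)) :
  (forall k, k \in ks -> fixer x c k) ->
  exists2 k, fixer x c k & forall k', k' \in ks -> exists k1 k2,
    [/\ fixer y b k1, fixer x a k2 & isom_mul k k' = isom_mul k1 k2].
Proof.
(* The identity is adjoined so that [k] itself is seen to lie in [fixer x c]. *)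
move=> ksc; pose ks' := isom_one :: ks.
have c0 i : 0 <= c i by exact: le_trans (a0 i) (ac i).
have ks'c k : k \in ks' -> fixer x c k.
  by rewrite inE => /orP[/eqP->|/ksc//]; exact: fixer_one.
pose L : finType := (seq_sub ks' * I)%type.
have [|k kP] := @generic_homogeneity _ _ _ uryU Lpos L
    (fun l => isom_fun (ssval l.1) (x l.2)) (fun l => x l.2) (fun l => c l.2)
    [seq y j | j <- enum J] (fun l => c0 l.2).
  by move=> [[k kks] i] [[k' k'ks] i'] /=; apply: match_close; exact: ks'c.
have kkP k' i (kk : k' \in ks') := kP (SeqSub kk, i).
exists k => [i|k' k'ks].
  have [] := kkP isom_one i; first by rewrite inE eqxx.
  by [].
have k'ks' : k' \in ks' by rewrite inE k'ks orbT.
pose kk := isom_mul k k'.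
have ij i j : Num.max (mdist (isom_fun kk (x i)) (y j)) (Num.max (a i) (b j)) =
              Num.max (mdist (x i) (y j)) (Num.max (a i) (b j)).
  have [/= kx kgen] := kkP k' i k'ks'.
  have leD : mdist (isom_fun kk (x i)) (y j) <=
             Num.max (mdist (x i) (y j)) (Num.max (a i) (b j)).
    apply: (ultra_le uryU (y := x i)); last by rewrite le_max lexx.
    by rewrite isom_mulE (le_trans kx)// maxC c_le.
  have [Bab|abB] := leP (mdist (x i) (y j)) (Num.max (a i) (b j)).
    by rewrite max_r//; move: leD; rewrite max_r.
  rewrite -[RHS](max_l (ltW abB)); congr (Num.max _ _).
  have ciB : c i <= mdist (x i) (y j).
    by rewrite (le_trans (c_le i j))// ge_max lexx (ltW abB).
  have [cB|Bc] := ltP (c i) (mdist (x i) (y j)).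
    by apply: (ultra_eq uryU); rewrite isom_mulE (le_lt_trans kx).
  have cB : c i = mdist (x i) (y j) by apply/eqP; rewrite eq_le ciB.
  have aB : a i < c i by rewrite cB (le_lt_trans _ abB)// le_max lexx.
  have Lc : Lambda (c i).
    have [e|] := mdist_spectrum0 uryU (x i) (y j); last by rewrite cB.
    by move: aB; rewrite cB e ltNge a0.
  (* In the critical case [c i = mdist (x i) (y j)] only genericity keeps [kk (x i)] from coming
     closer to [y j]. A forced germ would give some [x i'] with [c i' < c i] in the open ball of
     radius [c i] about [x i]. By [c_ge] it has some [y j'] close to it, so the path from [x i]
     would meet the subtree below [c i], against [c_le]. *)
  have [[[[k'' k''ks] i'] /= [ci'i kki]]|far] := kgen Lc; last first.
    apply/eqP; rewrite eq_le; apply/andP; split.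
      by rewrite (le_trans leD)// ge_max lexx (ltW abB).
    by rewrite -cB; apply: far; rewrite map_f// mem_enum.
  exfalso; have : mdist (x i) (x i') < c i.
    rewrite -(isom_isometric k'); apply: (ultra_lt uryU kki).
    apply: (ultra_lt uryU (y := x i')); first exact: le_lt_trans (ks'c _ k''ks i') _.
    by rewrite metric_sym; exact: le_lt_trans (ks'c _ k'ks' i') _.
  have [j' xyj'] := c_ge i'; move: xyj'; rewrite ge_max => /andP[xyj' bj'] xx.
  have := c_le i j'; rewrite leNgt => /negP; apply; rewrite !gt_max aB/=.
  rewrite (le_lt_trans bj')//=; apply: (ultra_lt uryU xx).
  exact: le_lt_trans xyj' _.
(* No point has to be avoided this time. [g] preserves the balls about the [y j] and carries those
   about the [x i] to their translates by [kk]. *)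
have [[i|j]||g gP] := @generic_homogeneity _ _ _ uryU Lpos (I + J)%type
   (fun l => match l with inl i => x i | inr j => y j end)
   (fun l => match l with inl i => isom_fun kk (x i) | inr j => y j end)
   (fun l => match l with inl i => a i | inr j => b j end) [::] _.
- exact: a0.
- exact: b0.
- move=> [i|j] [i'|j'] //.
  + by rewrite isom_isometric.
  + by rewrite metric_sym (metric_sym (y j)) [Num.max (b j) _]maxC; exact: ij.
exists g, (isom_mul (isom_inv g) kk); split.
- by move=> j; have [] := gP (inr j).
- move=> i; rewrite isom_mulE mdist_inv metric_sym.
  by have [] := gP (inl i).
- by rewrite isom_mulVr.
Qed.

End free_amalgamation.

(** * Levels and approximation by isometries *)

Lemma seq_minimum (T : eqType) (le : T -> T -> Prop) (P : T -> Prop) (s : seq T) :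
  (forall a b, le a b \/ le b a) -> (forall b a c, le a b -> le b c -> le a c) ->
  (forall a, a \in s -> ~ P a) \/
  exists a, [/\ a \in s, P a & forall b, b \in s -> P b -> le a b].
Proof.
move=> tot tr; elim: s => [|c s [ih|[a [sa Pa amin]]]]; first by left.
- have [Pc|nPc] := pselect (P c); last first.
    by left=> a; rewrite inE => /orP[/eqP->//|/ih].
  right; exists c; split=> [|//|b]; first by rewrite inE eqxx.
  by rewrite inE => /orP[/eqP->|/ih//]; case: (tot c c).
- right; have [[Pc ca]|nca] := pselect (P c /\ le c a).
    exists c; split=> // [|b]; first by rewrite inE eqxx.
    rewrite inE => /orP[/eqP->|sb Pb]; first by case: (tot c c).
    exact: tr ca (amin b sb Pb).
  exists a; split=> // [|b]; first by rewrite inE sa orbT.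
  rewrite inE => /orP[/eqP-> Pc|]; last exact: amin.
  by case: (tot a c) => // ca; case: nca.
Qed.

Section levels.
Context {R : realType} {Lambda : set R} {U : metricType R}.
Hypothesis uryU : urysohn Lambda U.
Hypothesis Lpos : Lambda `<=` [set r | 0 < r].

Let um := urysohn_ultrametric uryU.

(* The level (r, false) stands for the closed balls of radius r and (r, true)
   for the open ones, that is, for the germs at the vertices of height r. *)
Definition level := (R * bool)%type.

Definition in_level (l : level) (t : R) : bool := if l.2 then t < l.1 else t <= l.1.

(* Different proper levels induce different partitions of U into balls. *)
Definition proper_level (l : level) : Prop :=
  if l.2 then Lambda l.1
  else 0 < l.1 /\ forall e, 0 < e -> exists t, Lambda t /\ l.1 < t < l.1 + e.

Lemma in_level_le l s t : s <= t -> in_level l t -> in_level l s.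
Proof.
by rewrite /in_level; case: l.2 => st; [exact: le_lt_trans|exact: le_trans].
Qed.

Lemma in_level_max l s t : in_level l s -> in_level l t -> in_level l (Num.max s t).
Proof. by rewrite maxElt; case: ifP. Qed.

Lemma in_level_trans l (y x z : U) :
  in_level l (mdist x y) -> in_level l (mdist y z) -> in_level l (mdist x z).
Proof. by move=> xy yz; apply: in_level_le (um x y z) _; exact: in_level_max. Qed.

Lemma in_level0 l : proper_level l -> in_level l 0.
Proof. by rewrite /in_level/proper_level; case: l.2 => [/Lpos//|[/ltW]]. Qed.

Definition level_le (l l' : level) := forall t, in_level l t -> in_level l' t.

Lemma level_le_total l l' : level_le l l' \/ level_le l' l.
Proof.
have [|/existsNP[t /not_implyP[lt nl't]]] := pselect (level_le l l'); first by left.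
right=> s l's; apply: in_level_le lt; rewrite leNgt; apply/negP => ts.
by apply: nl't; apply: in_level_le l's; exact: ltW.
Qed.

Lemma level_le_trans l' l l'' : level_le l l' -> level_le l' l'' -> level_le l l''.
Proof. by move=> ll' l'l'' t /ll'/l'l''. Qed.

Lemma proper_level_nontrivial l : proper_level l -> exists2 t, Lambda t & ~ in_level l t.
Proof.
rewrite /in_level/proper_level; case: l.2 => [Ll|[_ /(_ 1 ltr01)[t [Lt /andP[lt _]]]]].
  by exists l.1 => //; rewrite ltxx.
by exists t => //; rewrite leNgt lt.
Qed.

(** Let [inf S] be the infimum of the spectral values above [t0]. If it is one of them, the open
    balls of that radius are the closed balls of radius [t0]; if not, [Lambda] accumulates at it
    from above and the closed balls of that radius will do. *)
Lemma proper_closed_level t0 : 0 < t0 -> (exists2 t, Lambda t & t0 < t) ->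
  exists2 l, proper_level l & forall t, t = 0 \/ Lambda t -> in_level l t <-> t <= t0.
Proof.
move=> t00 [t1 Lt1 t01]; pose S := [set t | Lambda t /\ t0 < t].
have S0 : S !=set0 by exists t1.
have lbS : lbound S t0 by move=> t [_ /ltW].
have infS : has_inf S by split=> //; exists t0.
have t0inf : t0 <= inf S by exact: lb_le_inf.
have inflb : lbound S (inf S) by apply: ge_inf; exists t0.
have [[Linf t0lt]|nLinf] := pselect (Lambda (inf S) /\ t0 < inf S).
  exists (inf S, true) => // t tL; rewrite /in_level/=; split=> [tinf|tt0]; last first.
    exact: le_lt_trans tt0 _.
  rewrite leNgt; apply/negP => t0t; have St : S t.
    split=> //; case: tL => // t0e; move: (lt_trans t00 t0t); rewrite t0e ltxx//.
  by move: (inflb _ St); rewrite leNgt tinf.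
exists (inf S, false).
  split=> [|e e0] /=; first exact: lt_le_trans t0inf.
  have [t St tlt] := inf_adherent e0 infS; exists t; split; first by case: St.
  rewrite tlt andbT lt_neqAle inflb// andbT; apply/eqP => et.
  by apply: nLinf; rewrite et; case: St.
move=> t tL; rewrite /in_level/=; split=> [tinf|tt0]; last exact: le_trans t0inf.
rewrite leNgt; apply/negP => t0t; have St : S t.
  by split=> //; case: tL => // t0e; move: (lt_trans t00 t0t); rewrite t0e ltxx.
apply: nLinf; have et : t = inf S by apply/eqP; rewrite eq_le tinf inflb.
by rewrite -et; case: St.
Qed.

(** [E l x y] is to be read as: the ball of level [l] at [x] is sent to the ball of level [l] at
    [y]. Each proper level carries a partial injection between balls, and larger balls follow
    smaller ones. *)
Record coherent (E : level -> U -> U -> Prop) : Prop := {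
  coherent_near : forall l x y x' y', proper_level l ->
    in_level l (mdist x x') -> in_level l (mdist y y') -> E l x y -> E l x' y';
  coherent_fun : forall l x y y', proper_level l ->
    E l x y -> E l x y' -> in_level l (mdist y y');
  coherent_inj : forall l x x' y, proper_level l ->
    E l x y -> E l x' y -> in_level l (mdist x x');
  coherent_le : forall l l' x y, proper_level l -> proper_level l' ->
    (forall t, Lambda t -> in_level l t -> in_level l' t) -> E l x y -> E l' x y }.

Definition approximants (E : level -> U -> U -> Prop) (xs : seq U)
    (ls : seq level) : set (isometries U) :=
  [set g | forall l x y, l \in ls -> proper_level l -> x \in xs -> y \in xs ->
     in_level l (mdist (isom_fun g x) y) <-> E l x y].

Section density.
Variable E : level -> U -> U -> Prop.
Hypothesis cohE : coherent E.
Variables (xs : seq U) (ls : seq level) (x0 : U).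

Let dom l x := exists y, E l x y.

Let closed_level (t : R) : level :=
  xget (t, true) [set l | proper_level l /\
    forall s, s = 0 \/ Lambda s -> in_level l s <-> s <= t].

(** The levels of the mutual distances are added so that distances of images can be compared with
    those of the points at exactly these heights. *)
Let Ls := ls ++ flatten [seq [:: (mdist x y, true); closed_level (mdist x y)] | x <- xs, y <- xs].

(** As far as [Ls] can tell, [rho x] is the height at which the path from [x] enters the domain of
    [E], and [img x] is a common image of [x] at all the levels above. *)
Let rhos x := [set r | (r = 0 \/ Lambda r) /\
  forall l, l \in Ls -> proper_level l -> in_level l r <-> dom l x].

Let imgs x := [set y | forall l, l \in Ls -> proper_level l -> dom l x -> E l x y].

Let rho x := xget 0 (rhos x).
Let img x := xget x0 (imgs x).

Let dom_le l l' x : proper_level l -> proper_level l' -> level_le l l' ->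
  dom l x -> dom l' x.
Proof.
by move=> pl pl' ll' [y xy]; exists y; apply: coherent_le xy => // t _; exact: ll'.
Qed.

Let dom_near l x y : proper_level l -> in_level l (mdist x y) -> dom l x -> dom l y.
Proof.
move=> pl xy [z xz]; exists z; apply: coherent_near xz => //.
by rewrite mdistxx in_level0.
Qed.

Let rhoP x : rhos x (rho x).
Proof.
rewrite /rho; case: xgetP => [//|none].
have [none_out|[l' [l'Ls [pl' nl'] l'max]]] := @seq_minimum _ (fun l l' => level_le l' l)
    (fun l => proper_level l /\ ~ dom l x) Ls (fun a b => level_le_total b a)
    (fun b a c ab bc => level_le_trans bc ab).
  exfalso; apply: (none 0); split; first by left.
  move=> l lLs pl; split=> [_|_]; last exact: in_level0.
  by apply/not_notP => nd; apply: (none_out l).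
have [none_in|[l [lLs [pl dl] lmin]]] := @seq_minimum _ level_le
    (fun l => proper_level l /\ dom l x) Ls level_le_total level_le_trans.
  have [t Lt nl't] := proper_level_nontrivial pl'.
  exfalso; apply: (none t); split; first by right.
  move=> l lLs pl; split=> [lt|dl].
  - apply/not_notP => nd; apply: nl't.
    by apply: (l'max l lLs) lt.
  - by exfalso; apply: (none_in l).
(* Here [l'] is the largest level without an image of [x] and [l] the smallest with one. Were no
   spectral value between them, [coherent_le] would carry the image from [l] to [l']. *)
have [t [Lt lt nl't]] : exists t, [/\ Lambda t, in_level l t & ~ in_level l' t].
  apply/not_existsP => nt; apply: nl'; case: dl => y xy; exists y.
  apply: coherent_le xy => // t Lt lt; apply/not_notP => nl't.
  by apply: (nt t).
exfalso; apply: (none t); split; first by right.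
move=> m mLs pm; split=> [mt|dm].
- by apply/not_notP => nd; apply: nl't; apply: (l'max m mLs) mt.
- by apply: (lmin m mLs) lt.
Qed.

Let imgP x : imgs x (img x).
Proof.
rewrite /img; case: xgetP => [//|none].
have [none_in|[l [lLs [pl [y xy]] lmin]]] := @seq_minimum _ level_le
    (fun l => proper_level l /\ dom l x) Ls level_le_total level_le_trans.
  by exfalso; apply: (none x0) => l lLs pl dl; exfalso; apply: (none_in l).
exfalso; apply: (none y) => m mLs pm dm; apply: coherent_le xy => // t _.
exact: lmin.
Qed.

Let rho_ge0 x : 0 <= rho x.
Proof. by have [[->|/Lpos/ltW]] := rhoP x. Qed.

Let same_class x y :
  (forall l, l \in Ls -> proper_level l -> dom l x <-> dom l y) ->
  (forall l, l \in Ls -> proper_level l -> dom l x -> in_level l (mdist x y)) ->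
  rho x = rho y /\ img x = img y.
Proof.
move=> dxy nxy; split.
  rewrite /rho (_ : rhos x = rhos y)//; apply/seteqP.
  by split=> r [rL rP]; split=> // l lLs pl; rewrite rP// dxy.
rewrite /img (_ : imgs x = imgs y)//; apply/seteqP; split=> z zP l lLs pl dl.
- have dlx : dom l x by apply/dxy.
  by apply: coherent_near (zP l lLs pl dlx) => //; rewrite ?mdistxx ?in_level0// nxy.
- have dly : dom l y by apply/dxy.
  apply: coherent_near (zP l lLs pl dly) => //; rewrite ?mdistxx ?in_level0//.
  by rewrite metric_sym nxy.
Qed.

Let mem_Ls x y : x \in xs -> y \in xs ->
  (mdist x y, true) \in Ls /\ closed_level (mdist x y) \in Ls.
Proof.
move=> xxs yxs; rewrite !mem_cat; split; apply/orP; right; apply/flattenP;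
  exists [:: (mdist x y, true); closed_level (mdist x y)].
- by apply/allpairsP; exists (x, y).
- by rewrite inE eqxx.
- by apply/allpairsP; exists (x, y).
- by rewrite !inE eqxx orbT.
Qed.

Let closed_levelP t : 0 < t -> (exists2 s, Lambda s & t < s) ->
  proper_level (closed_level t) /\
  forall s, s = 0 \/ Lambda s -> in_level (closed_level t) s <-> s <= t.
Proof.
move=> t0 ts; rewrite /closed_level; case: xgetP => [//|none].
by have [l pl lP] := proper_closed_level t0 ts; case: (none l).
Qed.

Let img_le x y : x \in xs -> y \in xs -> 0 < mdist x y ->
  rho x <= mdist x y -> rho y <= mdist x y -> mdist (img x) (img y) <= mdist x y.
Proof.
move=> xxs yxs xy0 rx ry.
have [nt|triv] := pselect (exists2 s, Lambda s & mdist x y < s); last first.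
  rewrite leNgt; apply/negP => lt; apply: triv; exists (mdist (img x) (img y)) => //.
  have [e|//] := mdist_spectrum0 uryU (img x) (img y).
  by move: lt; rewrite e ltNge mdist_ge0.
have [pl lP] := closed_levelP xy0 nt; have [_ lLs] := mem_Ls xxs yxs.
have [rxL rxP] := rhoP x; have [ryL ryP] := rhoP y.
have lxy : in_level (closed_level (mdist x y)) (mdist x y).
  by apply/lP => //; exact: mdist_spectrum0.
apply/lP; first exact: mdist_spectrum0.
have dx : dom (closed_level (mdist x y)) x by apply/rxP => //; exact/lP.
have dy : dom (closed_level (mdist x y)) y by apply/ryP => //; exact/lP.
apply: coherent_fun (imgP lLs pl dx) _ => //.
apply: coherent_near (imgP lLs pl dy) => //; rewrite ?mdistxx ?in_level0//.
by rewrite (metric_sym y).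
Qed.

(** The closed level of [mdist x y] is among [Ls], and [x] has no image there, hence neither has
    [y]. So a level at which one of them has an image is large enough to identify the two points. *)
Let class_lt x y : x \in xs -> y \in xs -> mdist x y < rho x -> rho y <= rho x ->
  rho x = rho y /\ img x = img y.
Proof.
move=> xxs yxs xyr ryx.
have [xy0|Lxy] := mdist_spectrum0 uryU x y.
  by rewrite (mdist_positivity _ _ xy0).
have xy0 : 0 < mdist x y := Lpos Lxy.
have [rxL rxP] := rhoP x; have [ryL ryP] := rhoP y.
have nt : exists2 s, Lambda s & mdist x y < s.
  by exists (rho x) => //; case: rxL => // rx0; move: xyr; rewrite rx0 ltNge mdist_ge0.
have [pl lP] := closed_levelP xy0 nt; have [_ lLs] := mem_Ls xxs yxs.
set l' := closed_level (mdist x y) in pl lP lLs.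
have l'xy : in_level l' (mdist x y) by apply/lP => //; right.
have l'yx : in_level l' (mdist y x) by rewrite metric_sym.
have ndx : ~ dom l' x by move=> /rxP => /(_ lLs pl)/lP => /(_ rxL); rewrite leNgt xyr.
have ndy : ~ dom l' y by move=> dy; apply: ndx; exact: dom_near dy.
have near l z : proper_level l -> ~ dom l' z -> dom l z -> in_level l (mdist x y).
  move=> pl1 nd d; have [ll'|l'l] := level_le_total l l'.
    by case: nd; exact: dom_le d.
  exact: l'l.
apply: same_class => [l _ pl1|l _ pl1 d].
  split=> d; first exact: dom_near pl1 (near _ _ pl1 ndx d) d.
  by apply: (dom_near pl1 _ d); rewrite metric_sym; exact: (near _ _ pl1 ndy d).
exact: (near _ _ pl1 ndx d).
Qed.

(** Points closer than the larger [rho] have the same image. For the others, [coherent_fun] at the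
    closed level of [mdist x y] keeps the images from moving apart, and [coherent_inj] at the open
    level from coming closer. *)
Let img_match x y : x \in xs -> y \in xs ->
  Num.max (mdist (img x) (img y)) (Num.max (rho x) (rho y)) =
  Num.max (mdist x y) (Num.max (rho x) (rho y)).
Proof.
wlog ryx : x y / rho y <= rho x => [wl xxs yxs|xxs yxs].
  have /orP[ryx|rxy] := le_total (rho y) (rho x); first exact: wl.
  have := wl y x rxy yxs xxs; rewrite metric_sym (metric_sym y).
  by rewrite [Num.max (rho y) _]maxC.
rewrite (max_l ryx).
have [xyr|rxy] := boolP (mdist x y < rho x).
  have [_ ->] := class_lt xxs yxs xyr ryx.
  by rewrite mdistxx !max_r// ltW.
rewrite -leNgt in rxy.
have [xy0|xy0] := eqVneq (mdist x y) 0.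
  by rewrite (mdist_positivity _ _ xy0) !mdistxx.
have {}xy0 : 0 < mdist x y by rewrite lt_neqAle eq_sym xy0 mdist_ge0.
have ryxy : rho y <= mdist x y := le_trans ryx rxy.
have le := img_le xxs yxs xy0 rxy ryxy.
have [rlt|xyr] := boolP (rho x < mdist x y); last first.
  by rewrite -leNgt in xyr; rewrite !max_r// (le_trans le).
congr Num.max; apply/eqP; rewrite eq_le le leNgt; apply/negP => lt.
have Lxy : Lambda (mdist x y).
  by have [e|//] := mdist_spectrum0 uryU x y; move: xy0; rewrite e ltxx.
have [lLs _] := mem_Ls xxs yxs.
have pl : proper_level (mdist x y, true) by [].
have [_ rxP] := rhoP x; have [_ ryP] := rhoP y.
have dx : dom (mdist x y, true) x by apply/rxP.
have dy : dom (mdist x y, true) y by apply/ryP => //; exact: le_lt_trans ryx rlt.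
suff : in_level (mdist x y, true) (mdist x y) by rewrite /in_level/= ltxx.
apply: coherent_inj (imgP lLs pl dx) _ => //.
apply: coherent_near (imgP lLs pl dy) => //; rewrite ?mdistxx ?in_level0//.
by rewrite (metric_sym (img y)).
Qed.

(** [g x] is within [rho x] of [img x], which settles the levels at which [x] has an image. The
    other levels do not contain [rho x], and genericity with respect to [xs] keeps [g x] at distance
    at least [rho x] from every tested [y]. *)
Lemma approximants_nonempty_at : approximants E xs ls !=set0.
Proof.
have [|g gP] := @generic_homogeneity _ _ _ uryU Lpos (seq_sub xs) (fun x => ssval x)
    (fun x : seq_sub xs => img (ssval x)) (fun x : seq_sub xs => rho (ssval x)) xs
    (fun x : seq_sub xs => rho_ge0 (ssval x)).
  by move=> x y; exact: img_match (ssvalP x) (ssvalP y).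
exists g => l x y lls pl xxs yxs.
have lLs : l \in Ls by rewrite mem_cat lls.
have [/= gx gen] := gP (SeqSub xxs).
have [rxL rxP] := rhoP x.
have [dx|ndx] := pselect (dom l x).
  have gxi : in_level l (mdist (isom_fun g x) (img x)).
    by apply: in_level_le gx _; apply/rxP.
  split=> [gxy|Exy].
    apply: coherent_near (imgP lLs pl dx) => //; rewrite ?mdistxx ?in_level0//.
    by apply: (in_level_trans (y := isom_fun g x)) => //; rewrite metric_sym.
  apply: in_level_trans gxi _; exact: coherent_fun (imgP lLs pl dx) Exy.
have nlr : ~ in_level l (rho x) by move=> lr; apply: ndx; apply/rxP.
have Lr : Lambda (rho x).
  by case: rxL => // r0; case: nlr; rewrite r0 in_level0.
split=> [gxy|Exy]; last by case: ndx; exists y.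
(* A forced germ would come from a point [m] with [rho m < rho x], but at this distance the two
   values of [rho] agree. *)
have [[[m mxs] /= [rm xm]]|far] := gen Lr.
  have [e _] := class_lt xxs mxs xm (ltW rm).
  by move: rm; rewrite e ltxx.
by case: nlr; apply: in_level_le gxy; exact: far.
Qed.

End density.

Lemma approximants_nonempty E xs ls : coherent E -> approximants E xs ls !=set0.
Proof.
by move=> cohE; have [x0 _] := urysohn_point uryU; exact: approximants_nonempty_at.
Qed.

End levels.
Arguments proper_level {R} Lambda l.
Arguments coherent {R} Lambda {U} E.
Arguments approximants {R} Lambda {U} E xs ls.

(** * Vectors fixed by stabilizers *)

Section hilbert_geometry.
Context {R : realType} (H : completeNormedModType R[i]).
Variable dot : {dot H for @Num.conj R[i]}.
Hypothesis hn : hilbert_norm dot.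
Implicit Types u v w : H.

Definition rnorm u : R := complex.Re `|u|.

Lemma rnormE u : `|u| = (rnorm u)%:C%C.
Proof. by rewrite RRe_real ?normr_real. Qed.

Lemma rnorm_ge0 u : 0 <= rnorm u.
Proof. by rewrite -ler0c -rnormE. Qed.

Lemma rnormD u v : rnorm (u + v) <= rnorm u + rnorm v.
Proof. by rewrite -lecR rmorphD/= -!rnormE ler_normD. Qed.

Lemma rnormB u v : rnorm (u - v) = rnorm (v - u).
Proof. by rewrite /rnorm distrC. Qed.

Lemma rnorm_eq0 u : rnorm u = 0 -> u = 0.
Proof. by move=> u0; apply/normr0_eq0; rewrite rnormE u0. Qed.

Lemma rnormZ (a : R) u : 0 <= a -> rnorm (a%:C%C *: u) = a * rnorm u.
Proof.
by move=> a0; apply: complexI; rewrite rmorphM/= -!rnormE normrZ ger0_norm// ler0c.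
Qed.

Lemma dotC u v : dot u v = (dot v u)^*.
Proof. by rewrite hermC mul1r. Qed.

Lemma dot_rnorm u : dot u u = ((rnorm u) ^+ 2)%:C%C.
Proof. by rewrite -hn rnormE rmorphXn. Qed.

Lemma dotBl u v w : dot (u - v) w = dot u w - dot v w.
Proof. exact: linearBl. Qed.

Lemma dotBr u v w : dot w (u - v) = dot w u - dot w v.
Proof. exact: linearBr. Qed.

Lemma parallelogram u v :
  rnorm (u + v) ^+ 2 + rnorm (u - v) ^+ 2 = 2 * rnorm u ^+ 2 + 2 * rnorm v ^+ 2.
Proof.
apply: complexI; rewrite !mulr_natl !mulr2n !rmorphD/= -!dot_rnorm.
by rewrite dnormD dnormB; ring.
Qed.

Lemma cauchy_schwarz u v : `|dot u v| <= (rnorm u * rnorm v)%:C%C.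
Proof.
have [->|v0] := eqVneq v 0; first by rewrite linear0r normr0 ler0c mulr_ge0 ?rnorm_ge0.
have N0 : 0 < dot v v by rewrite dnorm_gt0.
have Nc : (dot v v)^* = dot v v by rewrite -dotC.
have /= := dnorm_ge0 dot (u - (dot u v / dot v v) *: v).
rewrite dnormB dnormZ linearZr_LR/= normrM exprMn normfV (gtr0_norm N0) normCK.
rewrite rmorphM/= fmorphV/= Nc rmorphM/= rmorphM/= fmorphV/= Nc conjCK.
rewrite (_ : _ - _ = dot u u - dot u v * (dot u v)^* / dot v v); last first.
  by field; rewrite gt_eqF.
rewrite subr_ge0 ler_pdivrMr// -normCK !dot_rnorm -rmorphM/= -exprMn rmorphXn/= => le.
by rewrite -(@ler_pXn2r _ 2)// nnegrE ler0c mulr_ge0// rnorm_ge0.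
Qed.

Lemma dot_le u v : complex.Re `|dot u v| <= rnorm u * rnorm v.
Proof. by rewrite -lecR RRe_real ?normr_real ?cauchy_schwarz. Qed.

Lemma eq_dot w w' : (forall v, dot w v = dot w' v) -> w = w'.
Proof.
move=> e; apply/eqP; rewrite -subr_eq0 -(dnorm_eq0 dot).
by rewrite dotBl e subrr.
Qed.

Lemma rnorm_ball u v (e : R[i]) : ball u e v = (`|u - v| < e).
Proof. by rewrite -ball_normE. Qed.

Lemma rnorm_lt u (e : R[i]) : 0 < e -> (`|u| < e) = (rnorm u < complex.Re e).
Proof.
move=> e0; rewrite rnormE -[in LHS](RRe_real (ger0_real (ltW e0))).
by rewrite ltcR.
Qed.

Lemma Re_gt0 (e : R[i]) : 0 < e -> 0 < complex.Re e.
Proof. by rewrite ltcE => /andP[]. Qed.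

Definition midpoint u v := 2^-1 *: (u + v).

Lemma midpoint_rnorm u v :
  rnorm (u - v) ^+ 2 = 2 * rnorm u ^+ 2 + 2 * rnorm v ^+ 2 - 4 * rnorm (midpoint u v) ^+ 2.
Proof.
have -> : rnorm (midpoint u v) = 2^-1 * rnorm (u + v).
  by rewrite -rnormZ ?invr_ge0// /midpoint fmorphV/= rmorph_nat.
by rewrite -parallelogram; field.
Qed.

Definition midclosed (S : set H) := forall u v, S u -> S v -> S (midpoint u v).

(* In the closures of the sets of the family, the vectors of almost minimal
   norm form a Cauchy filter by the parallelogram identity. *)
Lemma midclosed_limit (B : set (set H)) (M : R) :
  B !=set0 -> (forall S S', B S -> B S' -> exists2 S'', B S'' & S'' `<=` S `&` S') ->
  (forall S, B S -> midclosed S) -> (forall S, B S -> exists2 u, S u & rnorm u <= M) ->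
  exists w, (forall S (e : R), B S -> 0 < e -> exists2 u, S u & rnorm (u - w) < e) /\
    forall c, (forall S, B S -> exists2 u, S u & rnorm u <= c) -> rnorm w <= c.
Proof.
move=> [S0 BS0] Bdir Bmid BM.
pose sigma S := inf [set rnorm u | u in S].
have sinf S : B S -> has_inf [set rnorm u | u in S].
  move=> BS; split; first by have [u Su _] := BM S BS; exists (rnorm u), u.
  by exists 0 => _ [u _ <-]; exact: rnorm_ge0.
have sle S u : B S -> S u -> sigma S <= rnorm u.
  by move=> BS Su; apply: ge_inf; [have [] := sinf S BS|exists u].
have sc S c : B S -> (exists2 u, S u & rnorm u <= c) -> sigma S <= c.
  by move=> BS [u Su uc]; rewrite (le_trans _ uc)// sle.
pose m := sup [set sigma S | S in B].
have msup : has_sup [set sigma S | S in B].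
  by split; [exists (sigma S0), S0|exists M => _ [S BS <-]; apply: sc => //; exact: BM].
have sm S : B S -> sigma S <= m.
  by move=> BS; apply: sup_upper_bound => //; exists S.
have m0 : 0 <= m.
  rewrite (le_trans _ (sm S0 BS0))//; apply: lb_le_inf; first by have [] := sinf S0 BS0.
  by move=> _ [u _ <-]; exact: rnorm_ge0.
have mc c : (forall S, B S -> exists2 u, S u & rnorm u <= c) -> m <= c.
  move=> cP; apply: ge_sup; first by have [] := msup.
  by move=> _ [S BS <-]; apply: sc => //; exact: cP.
pose D : set (set H * R) := [set Se | [/\ B Se.1, 0 < Se.2 & m - Se.2 < sigma Se.1]].
pose T (Se : set H * R) := [set u | Se.1 u /\ rnorm u < m + Se.2].
have Dex e S : B S -> 0 < e -> exists2 S', D (S', e) & S' `<=` S.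
  move=> BS e0; have [_ [S1 BS1 <-] S1e] := sup_adherent e0 msup.
  have [S2 BS2 S2S] := Bdir _ _ BS BS1; exists S2; last by move=> u /S2S[].
  split=> //=; rewrite (lt_le_trans S1e)//.
  have [] := sinf S2 BS2; move=> S2ne _; apply: lb_le_inf => // _ [u S2u <-].
  by apply: sle => //; have [] := S2S _ S2u.
have Tne Se : D Se -> exists u, T Se u.
  case: Se => S e [/= BS e0 mS].
  have [_ [u Su <-] ue] := inf_adherent e0 (sinf S BS); exists u; split=> //=.
  by rewrite (lt_le_trans ue)// lerD2r sm.
have FF : ProperFilter (filter_from D T).
  apply: filter_from_proper => //; apply: filter_from_filter.
    by have [S' DS' _] := Dex 1 S0 BS0 ltr01; exists (S', 1).
  move=> [S e] [S' e'] [/= BS e0 mS] [/= BS' e'0 mS'].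
  have e''0 : 0 < Num.min e e' by rewrite lt_min e0.
  have [S1 BS1 S1S] := Bdir _ _ BS BS'; have [S2 DS2 S2S] := Dex _ _ BS1 e''0.
  exists (S2, Num.min e e') => // u [/= /S2S/S1S[Su S'u]].
  by rewrite -ltrBlDl lt_min => /andP[ue ue']; split; split=> //=; rewrite -ltrBlDl.
have Fc : cauchy (filter_from D T).
  apply: cauchy_exP => eps eps0; pose d := complex.Re eps; have d0 := Re_gt0 eps0.
  have k0 : 0 < 16 * m + 17 by rewrite ltr_wpDl ?mulr_ge0.
  (* If [u] and [v] have norms below [m + e] and their midpoint above [m - e], the parallelogram
     identity bounds the squared distance by [16 * m * e]; for [e > m] it is at most
     [4 * (m + e) ^+ 2], which is below [16 * e] as [e <= 1]. The sum of both bounds plus one more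
     [e] makes the inequality strict. *)
  pose e := Num.min 1 (d ^+ 2 / (16 * m + 17)).
  have e0 : 0 < e by rewrite lt_min ltr01 divr_gt0 ?exprn_gt0.
  have e1 : e <= 1 by rewrite ge_min lexx.
  have ed : e * (16 * m + 17) <= d ^+ 2 by rewrite -ler_pdivlMr// ge_min lexx orbT.
  have [S' DS' _] := Dex e S0 BS0 e0; have [u Tu] := Tne _ DS'.
  exists u; exists (S', e) => // v Tv.
  rewrite rnorm_ball rnorm_lt// -/d -(@ltr_pXn2r _ 2)// ?nnegrE ?rnorm_ge0 ?(ltW d0)//.
  have [/= BS' _ mS'] := DS'; have [/= S'u ue] := Tu; have [/= S'v ve] := Tv.
  have mid : m - e < rnorm (midpoint u v).
    by rewrite (lt_le_trans mS')// sle//; exact: Bmid.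
  have ple x : 0 <= x -> x < m + e -> x ^+ 2 <= (m + e) ^+ 2.
    by move=> x0 /ltW xle; rewrite ler_pXn2r// nnegrE ?addr_ge0// ltW.
  have u2 := ple _ (rnorm_ge0 u) ue; have v2 := ple _ (rnorm_ge0 v) ve.
  rewrite midpoint_rnorm.
  have [em|me] := leP e m.
    have c2 : (m - e) ^+ 2 <= rnorm (midpoint u v) ^+ 2.
      by rewrite ler_pXn2r ?nnegrE ?rnorm_ge0 ?subr_ge0// ltW.
    nra.
  have c2 := sqr_ge0 (rnorm (midpoint u v)).
  nra.
have Fw := cauchy_cvg _ Fc.
set w := lim _ in Fw; exists w.
have close S e d : B S -> 0 < e -> 0 < d ->
    exists u, [/\ S u, rnorm u < m + e & rnorm (u - w) < d].
  move=> BS e0 d0; have [S' DS' S'S] := Dex e S BS e0.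
  have dC : 0 < d%:C%C :> R[i] by rewrite ltcR.
  have /Fw near_w : nbhs w (ball w d%:C%C) by exact: nbhsx_ballx.
  have FT : filter_from D T (T (S', e)) by exists (S', e).
  have [u [[/= S'u ue]]] := filter_ex (filterI FT near_w).
  by rewrite rnorm_ball rnorm_lt// rnormB; exists u; split=> //; exact: S'S.
split=> [S e BS e0|c /mc mlec].
  by have [u [Su _ uw]] := close S e e BS e0 e0; exists u.
rewrite (le_trans _ mlec)//; apply/ler_addgt0Pr => e e0.
have e20 : 0 < e / 2 by rewrite divr_gt0.
have [u [_ um uw]] := close _ _ _ BS0 e20 e20.
have := rnormD u (w - u); rewrite subrKC => le1.
rewrite rnormB in uw; lra.
Qed.

End hilbert_geometry.

Section midhull.
Context {R : realType} (H : completeNormedModType R[i]).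
Variable dot : {dot H for @Num.conj R[i]}.
Implicit Types (u v w : H) (X Y : set H).

(** Dyadic averages are enough for [midclosed_limit], and bounds on distances and coefficients pass
    from [X] to the hull by a two-case induction. *)
Inductive midhull (X : set H) : H -> Prop :=
| midhull_in (u : H) : X u -> midhull X u
| midhull_mid (u v : H) : midhull X u -> midhull X v -> midhull X (midpoint u v).

Lemma midhull_sub (X Y : set H) u : X `<=` Y -> midhull X u -> midhull Y u.
Proof.
move=> XY; elim=> [v /XY|v w _ + _]; first exact: midhull_in.
exact: midhull_mid.
Qed.

Lemma midhull_map (X Y : set H) (f : {linear H -> H}) u :
  (forall v, X v -> Y (f v)) -> midhull X u -> midhull Y (f u).
Proof.
move=> XY; elim=> [v /XY|v w _ + _]; first exact: midhull_in.
rewrite /midpoint linearZ linearD; exact: midhull_mid.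
Qed.

Lemma dot_midpoint u v w : dot (midpoint u v) w = 2^-1 * (dot u w + dot v w).
Proof. by rewrite linearZl_LR linearDl. Qed.

Lemma midhull_dot (X : set H) v (a : R[i]) u :
  (forall w, X w -> dot w v = a) -> midhull X u -> dot u v = a.
Proof.
move=> Xa; elim=> [w /Xa//|w w' _ ew _ ew'].
by rewrite dot_midpoint ew ew'; field.
Qed.

Lemma midpointB u v w : midpoint u v - w = midpoint (u - w) (v - w).
Proof.
rewrite /midpoint addrACA -opprD scalerBr -[w + w]mulr2n -[w *+ 2]scaler_nat scalerA.
by rewrite mulVf ?pnatr_eq0// scale1r.
Qed.

Lemma midpoint_le u v : rnorm (midpoint u v) <= (rnorm u + rnorm v) / 2.
Proof.
have -> : rnorm (midpoint u v) = 2^-1 * rnorm (u + v).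
  by rewrite -rnormZ ?invr_ge0// /midpoint fmorphV/= rmorph_nat.
by have := rnormD u v; lra.
Qed.

Lemma midhull_near (X : set H) v (e : R) u :
  (forall w, X w -> rnorm (w - v) <= e) -> midhull X u -> rnorm (u - v) <= e.
Proof.
move=> Xe; elim=> [w /Xe//|w w' _ ew _ ew'].
by rewrite midpointB (le_trans (midpoint_le _ _))//; lra.
Qed.

Lemma midhull_dot_near (X : set H) v (a : R[i]) (e : R) u :
  (forall w, X w -> complex.Re `|dot w v - a| <= e) -> midhull X u ->
  complex.Re `|dot u v - a| <= e.
Proof.
have RE (z : R[i]) : (complex.Re `|z| <= e) = (`|z| <= e%:C%C).
  by rewrite -lecR RRe_real ?normr_real.
move=> Xe; elim=> [w /Xe//|w w' _ + _]; rewrite !RE dot_midpoint => ew ew'.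
have -> : 2^-1 * (dot w v + dot w' v) - a = 2^-1 * ((dot w v - a) + (dot w' v - a)).
  by field.
rewrite normrM ger0_norm ?invr_ge0// ler_pdivrMl//.
by rewrite (le_trans (ler_normD _ _))// mulr_natl mulr2n lerD.
Qed.

End midhull.

(** * Projections to fixed vectors and their independence *)

Section representation.
Context {R : realType} {U : metricType R} (H : completeNormedModType R[i]).
Variable dot : {dot H for @Num.conj R[i]}.
Hypothesis hn : hilbert_norm dot.
Variable rho : isometries U -> bounded_op H.
Hypothesis rep : unitary_representation dot rho.
Hypothesis um : ultrametric U.
Implicit Types (g h k : isometries U) (u v w : H) (K : set (isometries U)).

Lemma rep_dot g u v : dot (rho g u) (rho g v) = dot u v.
Proof. by have [_] := rep_unitary rep g; exact. Qed.

Lemma rep_one u : rho isom_one u = u.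
Proof.
have [/bij_inj inj _] := rep_unitary rep isom_one; apply: inj.
by rewrite -(rep_mul rep) isom_mul1.
Qed.

Lemma rep_invK g u : rho g (rho (isom_inv g) u) = u.
Proof. by rewrite -(rep_mul rep) isom_mulgV rep_one. Qed.

Lemma rep_invVK g u : rho (isom_inv g) (rho g u) = u.
Proof. by rewrite -(rep_mul rep) isom_mulVg rep_one. Qed.

Lemma rep_dotV g u v : dot (rho g u) v = dot u (rho (isom_inv g) v).
Proof. by rewrite -[in LHS](rep_invK g v) rep_dot. Qed.

Lemma rep_rnorm g u : rnorm (rho g u) = rnorm u.
Proof.
apply/eqP; rewrite -(@eqrXn2 _ 2)// ?rnorm_ge0//; apply/eqP/complexI.
by rewrite -!(dot_rnorm hn) rep_dot.
Qed.

Lemma small_eq (a b : R[i]) :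
  (forall e : R, 0 < e -> complex.Re `|a - b| <= e) -> a = b.
Proof.
move=> small; apply/eqP; rewrite -subr_eq0 -normr_eq0.
rewrite -(RRe_real (normr_real (a - b))) (_ : complex.Re _ = 0)//.
apply/eqP; rewrite eq_le -ler0c RRe_real ?normr_real ?normr_ge0 ?andbT//.
by apply/ler_addgt0Pr => e e0; rewrite add0r small.
Qed.

Record is_subgroup K : Prop := {
  subgroup1 : K isom_one;
  subgroupM : forall g h, K g -> K h -> K (isom_mul g h);
  subgroupV : forall g, K g -> K (isom_inv g) }.

Lemma fixer_subgroup (I : finType) (x : I -> U) a :
  (forall i, 0 <= a i) -> is_subgroup (fixer x a).
Proof.
move=> a0; split; [exact: fixer_one|move=> g h; exact: fixer_mul|].
exact: fixer_inv.
Qed.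

Definition fixed K : set H := [set v | forall k, K k -> rho k v = v].

Lemma fixed_sub K K' : K `<=` K' -> fixed K' `<=` fixed K.
Proof. by move=> KK' v fv k /KK'; exact: fv. Qed.

Lemma fixedB K u v : fixed K u -> fixed K v -> fixed K (u - v).
Proof. by move=> fu fv k Kk; rewrite linearB fu ?fv. Qed.

Lemma eq_fixed K w w' : fixed K w -> fixed K w' ->
  (forall v, fixed K v -> dot w v = dot w' v) -> w = w'.
Proof.
move=> fw fw' e; apply/eqP; rewrite -subr_eq0 -(dnorm_eq0 dot).
by rewrite (dotBl _ w w') e ?subrr//; exact: fixedB.
Qed.

(** The Alaoglu-Birkhoff argument: [w] has least norm among the limits of averages of the orbit. The
    midpoint of [w] and [rho k w] is such a limit too, so its norm is not smaller, and the
    parallelogram identity forces [rho k w = w]. Averaging over [K] does not change coefficients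
    with fixed vectors. *)
Lemma orbit_projection K u : is_subgroup K -> exists w,
  [/\ fixed K w, forall v, fixed K v -> dot u v = dot w v &
    forall e : R, 0 < e ->
      exists2 z, midhull [set rho k u | k in K] z & rnorm (z - w) < e].
Proof.
move=> KG; pose S := midhull [set rho k u | k in K].
have [||||w [wS wmin]] := @midclosed_limit _ _ _ hn [set S] (rnorm u).
- by exists S.
- by move=> _ _ -> ->; exists S => // z.
- by move=> _ -> a b; exact: midhull_mid.
- move=> _ ->; exists u => //; apply: midhull_in; exists isom_one.
    exact: subgroup1.
  exact: rep_one.
exists w; split; last by move=> e e0; exact: wS.
  move=> k Kk; apply/eqP; rewrite -subr_eq0; apply/eqP/rnorm_eq0/eqP.
  rewrite -sqrf_eq0 eq_le sqr_ge0 andbT (midpoint_rnorm hn) rep_rnorm.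
  have kS z : S z -> S (rho k z).
    apply: midhull_map => _ [k' Kk' <-]; exists (isom_mul k k').
      exact: subgroupM.
    by rewrite (rep_mul rep).
  have le : rnorm w <= rnorm (midpoint (rho k w) w).
    apply/ler_addgt0Pr => e e0; have [z Sz zw] := wS S e erefl e0.
    apply: wmin => _ ->; exists (midpoint (rho k z) z).
      by apply: midhull_mid => //; exact: kS.
    have d : rnorm (midpoint (rho k z) z - midpoint (rho k w) w) <= e.
      rewrite (_ : _ - _ = midpoint (rho k (z - w)) (z - w)).
        by rewrite (le_trans (midpoint_le _ _))// rep_rnorm; lra.
      by rewrite /midpoint -scalerBr (linearB (rho k)) opprD addrACA.
    have := rnormD (midpoint (rho k w) w) (midpoint (rho k z) z - midpoint (rho k w) w).
    by rewrite subrKC; lra.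
  have w0 := rnorm_ge0 w; nra.
move=> v fv; apply: small_eq => e e0.
have v1 : 0 < rnorm v + 1 by rewrite ltr_wpDl ?rnorm_ge0.
have [z Sz zw] := wS S (e / (rnorm v + 1)) erefl (divr_gt0 e0 v1).
rewrite -(midhull_dot (dot := dot) (v := v) (a := dot u v) _ Sz) => [|_ [k Kk <-]]; last first.
  by rewrite rep_dotV fv//; exact: subgroupV.
rewrite -dotBl (le_trans (dot_le hn _ _))//.
move: zw; rewrite ltr_pdivlMr// => /ltW; apply: le_trans.
by rewrite ler_wpM2l ?rnorm_ge0// lerDl.
Qed.

Definition fixproj K u : H :=
  xget 0 [set w | fixed K w /\ forall v, fixed K v -> dot u v = dot w v].

Lemma projP K u : is_subgroup K ->
  fixed K (fixproj K u) /\ forall v, fixed K v -> dot u v = dot (fixproj K u) v.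
Proof.
move=> KG; rewrite /fixproj; case: xgetP => [//|none].
by have [w [fw wP _]] := orbit_projection u KG; case: (none w).
Qed.

Lemma projE K u w : is_subgroup K -> fixed K w ->
  (forall v, fixed K v -> dot u v = dot w v) -> fixproj K u = w.
Proof.
move=> KG fw wP; have [fp pP] := projP u KG.
by apply: eq_fixed fp fw _ => v fv; rewrite -pP// wP.
Qed.

Lemma projB K u v : is_subgroup K -> fixproj K (u - v) = fixproj K u - fixproj K v.
Proof.
move=> KG; have [fu uP] := projP u KG; have [fv vP] := projP v KG.
apply: projE => //; first exact: fixedB.
by move=> w fw; rewrite !dotBl uP// vP.
Qed.

Lemma proj_dotC K u v : is_subgroup K -> dot (fixproj K u) v = dot u (fixproj K v).
Proof.
move=> KG; have [fu uP] := projP u KG; have [fv vP] := projP v KG.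
by rewrite (uP _ fv) [LHS]dotC (vP _ fu) -dotC.
Qed.

Lemma proj_pythagoras K K' u : is_subgroup K -> is_subgroup K' -> K `<=` K' ->
  rnorm (fixproj K u - fixproj K' u) ^+ 2 = rnorm (fixproj K u) ^+ 2 - rnorm (fixproj K' u) ^+ 2.
Proof.
move=> KG K'G KK'; apply: complexI; rewrite rmorphB/= -!(dot_rnorm hn).
have [fu uP] := projP u KG; have [fu' uP'] := projP u K'G.
have fKu' : fixed K (fixproj K' u) by exact: fixed_sub KK' _ _.
have e : dot (fixproj K u) (fixproj K' u) = dot (fixproj K' u) (fixproj K' u) by rewrite -uP -?uP'.
have e' : dot (fixproj K' u) (fixproj K u) = dot (fixproj K' u) (fixproj K' u).
  by rewrite dotC e -dotC.
by rewrite dotBl !dotBr e e' subrr subr0.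
Qed.

Lemma proj_rnorm K u : is_subgroup K -> rnorm (fixproj K u) <= rnorm u.
Proof.
move=> KG; have [fu uP] := projP u KG.
have [->|p0] := eqVneq (rnorm (fixproj K u)) 0; first exact: rnorm_ge0.
have pp : 0 < rnorm (fixproj K u) by rewrite lt_neqAle eq_sym p0 rnorm_ge0.
rewrite -(ler_pM2r pp); have := dot_le hn u (fixproj K u).
by rewrite uP// dot_rnorm// ger0_norm ?ler0c ?sqr_ge0//= expr2.
Qed.

Lemma proj_close K u (e : R) : is_subgroup K ->
  (forall k, K k -> rnorm (rho k u - u) <= e) -> rnorm (u - fixproj K u) <= e.
Proof.
move=> KG Ke; have [w [fw wP wS]] := orbit_projection u KG.
rewrite (projE KG fw wP); apply/ler_addgt0Pr => d d0; have [z Sz zw] := wS d d0.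
have zu : rnorm (z - u) <= e by apply: midhull_near Sz => _ [k Kk <-]; exact: Ke.
have := rnormD (u - z) (z - w); rewrite subrKA (rnormB u z); lra.
Qed.

(** [free_translate] treats finitely many group elements at a time, and a single average involves no
    more. *)
Lemma midhull_orbit_finite K u z : midhull [set rho k u | k in K] z ->
  exists2 ks : seq (isometries U), (forall k, k \in ks -> K k) &
    midhull [set rho k u | k in [set` ks]] z.
Proof.
elim=> [_ [k Kk <-]|w w' _ [ks ksK ksw] _ [ks' ks'K ksw']].
  exists [:: k] => [k'|]; first by rewrite inE => /eqP->.
  by apply: midhull_in; exists k => //=; rewrite inE.
exists (ks ++ ks') => [k|]; first by rewrite mem_cat => /orP[/ksK|/ks'K].
by apply: midhull_mid; [apply: midhull_sub ksw|apply: midhull_sub ksw'];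
  move=> _ [k /= kks <-]; exists k => //=; rewrite mem_cat kks ?orbT.
Qed.

Context {Lambda : set R}.
Hypothesis uryU : urysohn Lambda U.
Hypothesis Lpos : Lambda `<=` [set r | 0 < r].

Section independence.
Variables (I J : finType) (x : I -> U) (y : J -> U).
Variables (a c : I -> R) (b : J -> R).
Hypotheses (a0 : forall i, 0 <= a i) (b0 : forall j, 0 <= b j).
Hypotheses (ac : forall i, a i <= c i)
  (c_le : forall i j, c i <= Num.max (Num.max (a i) (b j)) (mdist (x i) (y j)))
  (c_ge : forall i, exists j, Num.max (mdist (x i) (y j)) (b j) <= c i).

(** The projection is approximated by an average of vectors [rho k' u]. A generic [k] in [fixer x c]
    fixes the projection and makes every [k k'] a product [k1 k2] in which [k2] fixes [u] and [k1]
    fixes [v]; so each term of the translated average has the coefficient of [u] itself. *)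
Lemma independence u v : fixed (fixer x a) u -> fixed (fixer y b) v ->
  dot u v = dot (fixproj (fixer x c) u) v.
Proof.
move=> fu fv; have c0 i : 0 <= c i by exact: le_trans (a0 i) (ac i).
have KG := fixer_subgroup x c0.
have [w [fw wP wS]] := orbit_projection u KG; rewrite (projE KG fw wP).
apply: small_eq => e e0; have v1 : 0 < rnorm v + 1 by rewrite ltr_wpDl ?rnorm_ge0.
have [z /midhull_orbit_finite[ks ksK Sz] zw] := wS (e / (rnorm v + 1)) (divr_gt0 e0 v1).
have [k Kk kP] := free_translate uryU Lpos a0 b0 ac c_le c_ge ksK.
have -> : dot u v = dot (rho k z) v.
  rewrite rep_dotV; apply/esym; apply: midhull_dot Sz => _ [k' /= k'ks <-].
  rewrite -rep_dotV -(rep_mul rep); have [k1 [k2 [yk1 xk2 ->]]] := kP k' k'ks.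
  rewrite (rep_mul rep) fu// rep_dotV fv//; exact: fixer_inv.
rewrite -[in X in _ - X](fw k Kk) -dotBl -(linearB (rho k)).
rewrite (le_trans (dot_le hn _ _))// rep_rnorm.
move: zw; rewrite ltr_pdivlMr// => /ltW; apply: le_trans.
by rewrite ler_wpM2l ?rnorm_ge0// lerDl.
Qed.

End independence.

(** This is [independence] for two families of balls with the same centres: by the condition on [t],
    the path from the ball of radius [a i] about [x i] meets the subtree spanned by the balls of
    radii [t j] first at height [Num.max (a i) (t i)]. *)
Lemma proj_max (I : finType) (x : I -> U) (a t : I -> R) u :
  (forall i, 0 <= a i) -> (forall i, 0 <= t i) ->
  (forall i j, t i <= Num.max (t j) (mdist (x i) (x j))) ->
  fixproj (fixer x t) (fixproj (fixer x a) u) = fixproj (fixer x (fun i => Num.max (a i) (t i))) u.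
Proof.
move=> a0 t0 tc; pose m i := Num.max (a i) (t i).
have m0 i : 0 <= m i by rewrite le_max a0.
have aG := fixer_subgroup x a0; have tG := fixer_subgroup x t0.
have mG := fixer_subgroup x m0.
have tm : fixer x t `<=` fixer x m by apply: fixer_le => i; rewrite le_max lexx orbT.
have am : fixer x a `<=` fixer x m by apply: fixer_le => i; rewrite le_max lexx.
have [fa aP] := projP u aG; have [fm mP] := projP u mG.
apply: projE => // [|v fv]; first exact: fixed_sub tm _ _.
rewrite (@independence _ _ x x a m t a0 t0 _ _ _ _ v fa fv).
- congr (dot _ v); apply: projE => // w fw; rewrite -aP ?mP//.
  exact: fixed_sub am _ _.
- by move=> i; rewrite le_max lexx.
- move=> i j; rewrite ge_max !le_max lexx/= -!le_max.
  by have := tc i j; rewrite !le_max => /orP[->|->]; rewrite ?orbT.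
- by move=> i; exists i; rewrite mdistxx ge_max m0 le_max lexx orbT.
Qed.

Lemma proj_maxC (I : finType) (x : I -> U) (a t : I -> R) u :
  (forall i, 0 <= a i) -> (forall i, 0 <= t i) ->
  (forall i j, t i <= Num.max (t j) (mdist (x i) (x j))) ->
  fixproj (fixer x a) (fixproj (fixer x t) u) = fixproj (fixer x (fun i => Num.max (a i) (t i))) u.
Proof.
move=> a0 t0 tc; have m0 i : 0 <= Num.max (a i) (t i) by rewrite le_max a0.
have aG := fixer_subgroup x a0; have tG := fixer_subgroup x t0.
have mG := fixer_subgroup x m0.
apply: (eq_dot (dot := dot)) => v.
by rewrite (proj_dotC _ _ aG) (proj_dotC _ _ tG) proj_max// (proj_dotC _ _ mG).
Qed.

End representation.

(** * Convergence of matrix coefficients *)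

Section monotone_limit.
Context {R : realType} {T : Type} (F : set_system T).
Context {FF : ProperFilter F}.

(* If a filter decides on which side of every cut of the real line f lies, then
   it makes every monotone function of f converge. *)
Lemma decided_monotone_limit (f : T -> R) (m : R -> R) (M : R) :
  (forall r, F [set g | f g <= r] \/ F [set g | r < f g]) ->
  (forall r, F [set g | f g < r] \/ F [set g | r <= f g]) ->
  {homo m : r r' / r <= r' >-> r' <= r} -> (forall r, 0 <= m r) -> (forall r, m r <= M) ->
  exists L, forall e, 0 < e -> F [set g | L - e < m (f g) <= L + e].
Proof.
move=> dle dlt mono m0 mM.
have dec c : F [set g | m (f g) <= c] \/ F [set g | c < m (f g)].
  pose A := [set r | m r <= c].
  have [A0|/set0P/negP] := pselect (A !=set0); last first.
    rewrite negbK => /eqP A0; right; apply: (filterS _ filterT) => g _ /=.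
    rewrite ltNge; apply/negP => mc.
    by have : A (f g) by []; rewrite A0.
  have [[r1 nAr1]|allA] := pselect (exists r1, ~ A r1); last first.
    left; apply: (filterS _ filterT) => g _ /=; apply/not_notP => nA.
    by apply: allA; exists (f g).
  have up r r' : A r -> r <= r' -> A r' by move=> Ar /mono/le_trans; exact.
  have lbA : lbound A r1.
    by move=> r Ar; rewrite leNgt; apply/negP => /ltW/(up _ _ Ar).
  have infA : has_inf A by split=> //; exists r1.
  have gtA r : inf A < r -> A r.
    rewrite -subr_gt0 => /inf_adherent /(_ infA)[r' Ar']; rewrite subrKC => /ltW.
    exact: up.
  have geA r : A r -> inf A <= r by move=> Ar; apply: ge_inf => //; exists r1.
  have [Ainf|nAinf] := pselect (A (inf A)).
    have [lt|ge] := dlt (inf A); [right|left].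
      apply: filterS lt => g /= fg; rewrite ltNge; apply/negP => /geA.
      by rewrite leNgt fg.
    by apply: filterS ge => g /= /(up _ _ Ainf).
  have [le|gt] := dle (inf A); [right|left].
    apply: filterS le => g /= fg; rewrite ltNge; apply/negP => Afg.
    by apply: nAinf; exact: up Afg fg.
  by apply: filterS gt => g /= /gtA.
pose B := [set c | F [set g | m (f g) <= c]].
have B0 c : B c -> 0 <= c.
  by move=> /filter_ex[g /=]; exact: le_trans.
have infB : has_inf B.
  split; last by exists 0 => c /B0.
  by exists M; apply: (filterS _ filterT) => g _ /=.
exists (inf B) => e e0.
have [c Bc ce] := inf_adherent e0 infB.
have [Bn|gt] := dec (inf B - e).
  exfalso; have : inf B <= inf B - e by apply: ge_inf => //; exists 0 => ? /B0.
  by lra.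
apply: filterS (filterI Bc gt) => g [/= mc lt]; rewrite lt/=.
by rewrite (le_trans mc)// ltW.
Qed.

End monotone_limit.

Section approximation_filter.
Context {R : realType} {Lambda : set R} {U : metricType R}.
Hypothesis uryU : urysohn Lambda U.
Hypothesis Lpos : Lambda `<=` [set r | 0 < r].
Implicit Types (x y : U) (E : @level R -> U -> U -> Prop).

Definition approximation_filter E : set_system (isometries U) :=
  [set P | exists xs ls, approximants Lambda E xs ls `<=` P].

Lemma approximants_sub E xs ys (ls ms : seq level) :
  {subset xs <= ys} -> {subset ls <= ms} ->
  approximants Lambda E ys ms `<=`
    approximants Lambda E xs ls.
Proof. by move=> xy lm g gP l x y /lm lms pl /xy xys /xy yys; exact: gP. Qed.

Lemma approximation_filter_proper E : coherent Lambda E ->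
  ProperFilter (approximation_filter E).
Proof.
move=> cohE; apply: Build_ProperFilter_ex.
  move=> P [xs [ls sP]]; have [g gP] := approximants_nonempty uryU Lpos xs ls cohE.
  by exists g; exact: sP.
split=> [|P Q [xs [ls sP]] [ys [ms sQ]]|P Q PQ [xs [ls sP]]].
- by exists [::], [::].
- exists (xs ++ ys), (ls ++ ms) => g gP; split.
    by apply: sP; apply: approximants_sub gP => z; rewrite mem_cat => ->.
  by apply: sQ; apply: approximants_sub gP => z; rewrite mem_cat orbC => ->.
- by exists xs, ls => g /sP/PQ.
Qed.

Variable E : @level R -> U -> U -> Prop.
Local Notation F := (approximation_filter E).
Context {FF : ProperFilter F}.

Lemma approximation_in_level l x y : proper_level Lambda l ->
  F [set g | in_level l (mdist (isom_fun g x) y) <-> E l x y].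
Proof.
move=> pl; exists [:: x; y], [:: l] => g gP.
by apply: gP => //; rewrite !inE eqxx ?orbT.
Qed.

Lemma decided_in_level l x y : proper_level Lambda l ->
  F [set g | in_level l (mdist (isom_fun g x) y)] \/
  F [set g | ~ in_level l (mdist (isom_fun g x) y)].
Proof.
move=> /(approximation_in_level x y) near_l.
by have [Exy|nExy] := pselect (E l x y); [left|right];
  apply: filterS near_l => g /= gP; apply/gP.
Qed.

(** The filter only knows proper levels, but a cut of the real line restricted to distances is
    either a proper level or satisfied by every distance. *)
Lemma decided_le r x y : 0 < r ->
  F [set g | mdist (isom_fun g x) y <= r] \/ F [set g | r < mdist (isom_fun g x) y].
Proof.
move=> r0; have [nt|triv] := pselect (exists2 t, Lambda t & r < t); last first.
  left; apply: (filterS _ filterT) => g _ /=; rewrite leNgt; apply/negP => lt.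
  apply: triv; exists (mdist (isom_fun g x) y) => //.
  have [e|//] := mdist_spectrum0 uryU (isom_fun g x) y.
  by move: lt; rewrite e ltNge (ltW r0).
have [l pl lP] := proper_closed_level r0 nt.
have [le|gt] := decided_in_level x y pl; [left; apply: filterS le|right; apply: filterS gt];
  move=> g /=; have := lP _ (mdist_spectrum0 uryU (isom_fun g x) y).
- by move=> [+ _].
- by move=> lr nl; rewrite ltNge; apply/negP => /lr.
Qed.

Lemma decided_lt r x y : 0 < r ->
  F [set g | mdist (isom_fun g x) y < r] \/ F [set g | r <= mdist (isom_fun g x) y].
Proof.
move=> r0; have [Lr|nLr] := pselect (Lambda r).
  have pl : proper_level Lambda (r, true) by [].
  have [lt|ge] := decided_in_level x y pl; first by left.
  by right; apply: filterS ge => g /= /negP; rewrite -leNgt.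
have neq g : mdist (isom_fun g x) y != r.
  apply/eqP => e; have [e0|] := mdist_spectrum0 uryU (isom_fun g x) y.
    by move: r0; rewrite -e e0 ltxx.
  by rewrite e.
have [le|gt] := decided_le x y r0; [left; apply: filterS le|right; apply: filterS gt].
- by move=> g /= le; rewrite lt_neqAle neq.
- by move=> g /ltW.
Qed.

Lemma decided_exists (I : finType) (P Q : I -> set (isometries U)) :
  (forall i, F (P i) \/ F (Q i)) ->
  (exists i, F (P i)) \/ F [set g | forall i, Q i g].
Proof.
move=> PQ; have [[i Pi]|none] := pselect (exists i, F (P i)); first by left; exists i.
by right; apply: (@filter_forall _ I Q F) => i; have [Pi|//] := PQ i; case: none; exists i.
Qed.

End approximation_filter.

(** * Where translated paths meet a finite subtree *)

Section depth.
Context {R : realType} {Lambda : set R} {U : metricType R}.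
Hypothesis uryU : urysohn Lambda U.
Hypothesis Lpos : Lambda `<=` [set r | 0 < r].
Variables (I : finType) (x : I -> U) (s : R).
Hypothesis s0 : 0 < s.
Implicit Types (g h : isometries U) (i j : I).

Let um := urysohn_ultrametric uryU.

Let depths g := [set t : I -> R | [/\ forall i, s <= t i,
  forall i j, t i <= Num.max s (mdist (isom_fun g (x i)) (x j)) &
  forall i, exists j, Num.max s (mdist (isom_fun g (x i)) (x j)) = t i]].

(* The least height at which the path from [g (x i)] meets the subtree spanned
   by the balls of radius [s] about the points of [x]. *)
Definition depth g : I -> R := xget (fun=> s) (depths g).

Lemma depthP g : depths g (depth g).
Proof.
rewrite /depth; case: xgetP => [//|none].
have /choice[f fP] i : exists j, forall j',
    mdist (isom_fun g (x i)) (x j) <= mdist (isom_fun g (x i)) (x j').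
  have ne : enum I != [::].
    by apply/eqP => e; have := mem_enum I i; rewrite e.
  have [j _ jmin] := seq_argmin (fun j => mdist (isom_fun g (x i)) (x j)) ne.
  by exists j => j'; apply: jmin; rewrite mem_enum.
exfalso; apply: (none (fun i => Num.max s (mdist (isom_fun g (x i)) (x (f i))))).
split=> [i|i j|i]; first by rewrite le_max lexx.
  by rewrite ge_max !le_max lexx/= fP orbT.
by exists (f i).
Qed.

Lemma depth_ge g i : s <= depth g i.
Proof. by have [] := depthP g. Qed.

Lemma depth_le_max g i j :
  depth g i <= Num.max s (mdist (isom_fun g (x i)) (x j)).
Proof. by have [] := depthP g. Qed.

Lemma depth_max g i : exists j,
  Num.max s (mdist (isom_fun g (x i)) (x j)) = depth g i.
Proof. by have [] := depthP g. Qed.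

(** Equivalently, the path from [x i] meets the subtree spanned by the balls of radii [t j] about
    the [x j] at no height below [t i]. *)
Definition consistent (t : I -> R) :=
  forall i j, t i <= Num.max (t j) (mdist (x i) (x j)).

Lemma depth_consistent g : consistent (depth g).
Proof.
move=> i j; have [j' <-] := depth_max g j.
rewrite (le_trans (depth_le_max g i j'))// ge_max !le_max lexx/= -!le_max.
rewrite -maxA [X in Num.max _ X]maxC le_max; apply/orP; right.
by rewrite (le_trans (um _ (isom_fun g (x j)) _))// isom_isometric.
Qed.

(* The condition obtained from [fixer x (fun=> s)] by cutting off what lies below
   the ball of radius [r] about [x i] in the direction of [x i]. *)
Definition branch i r j := if mdist (x i) (x j) < r then Num.max s r else s.

Lemma branch_ge i r j : s <= branch i r j.
Proof. by rewrite /branch; case: ifP => // _; rewrite le_max lexx. Qed.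

Lemma branch_consistent i r : consistent (branch i r).
Proof.
move=> j l; have sl := branch_ge i r l.
rewrite [X in X <= _]/branch; case: ifP => [ij|_]; last by rewrite le_max sl.
have [il|ril] := ltP (mdist (x i) (x l)) r.
  by rewrite /branch il le_max lexx.
rewrite ge_max !le_max sl/=; apply/orP; right.
have lt : mdist (x j) (x i) < mdist (x i) (x l).
  by rewrite metric_sym; exact: lt_le_trans ij ril.
by rewrite (ultra_eq uryU lt).
Qed.

Lemma branch_le i r r' j : r <= r' -> branch i r j <= branch i r' j.
Proof.
move=> rr'; rewrite /branch; case: ifP => [ij|_].
  by rewrite (lt_le_trans ij rr') ge_max !le_max lexx rr' orbT.
by case: ifP => // _; rewrite le_max lexx.
Qed.

Lemma branch_max i r r' j :
  Num.max (branch i r j) (branch i r' j) = branch i (Num.max r r') j.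
Proof.
by have /orP[rr'|r'r] := le_total r r';
  [rewrite !max_r// branch_le|rewrite !max_l// branch_le].
Qed.

(** Together with [branch_self] this makes a consistent [t] the pointwise maximum of its branches,
    so that heights can be raised one branch at a time. *)
Lemma branch_bound t i j : (forall i, s <= t i) -> consistent t ->
  branch i (t i) j <= t j.
Proof.
move=> st tc; rewrite /branch; case: ifP => // ij.
have := tc i j; rewrite ge_max st le_max => /orP[//|].
by rewrite leNgt ij.
Qed.

Lemma branch_self t i : (forall i, s <= t i) -> branch i (t i) i = t i.
Proof.
by move=> st; rewrite /branch mdistxx (lt_le_trans s0 (st i)) max_r.
Qed.

Section decided_depth.
Variable E : @level R -> U -> U -> Prop.
Local Notation F := (approximation_filter (Lambda := Lambda) E).
Context {FF : ProperFilter F}.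

(** For [r] at least [s], the depth is at most [r] iff one of finitely many distances is, and each
    of these cuts is decided. *)
Lemma decided_depth_le i r : F [set g | depth g i <= r] \/ F [set g | r < depth g i].
Proof.
have [rs|sr] := ltP r s.
  by right; apply: (filterS _ filterT) => g _ /=; exact: lt_le_trans (depth_ge g i).
have r0 := lt_le_trans s0 sr.
have [[j le]|gt] := decided_exists (fun j => decided_le uryU (E := E) (x i) (x j) r0).
  left; apply: filterS le => g /= le.
  by rewrite (le_trans (depth_le_max g i j))// ge_max sr.
right; apply: filterS gt => g /= gt; have [j <-] := depth_max g i.
by rewrite lt_max gt orbT.
Qed.

Lemma decided_depth_lt i r : F [set g | depth g i < r] \/ F [set g | r <= depth g i].
Proof.
have [rs|sr] := leP r s.
  by right; apply: (filterS _ filterT) => g _ /=; exact: le_trans (depth_ge g i).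
have r0 := lt_trans s0 sr.
have [[j lt]|ge] := decided_exists (fun j => decided_lt uryU (E := E) (x i) (x j) r0).
  left; apply: filterS lt => g /= lt.
  by rewrite (le_lt_trans (depth_le_max g i j))// gt_max sr.
right; apply: filterS ge => g /= ge; have [j <-] := depth_max g i.
by rewrite le_max ge orbT.
Qed.

(* Near a point of the compactification, [g (x i)] and [h (x i)] branch off the
   subtree spanned by [x] towards the same [x j]. *)
Lemma depth_translate : exists2 N, F N & forall g h, N g -> N h ->
  fixer x (fun i => Num.max (depth g i) (depth h i)) (isom_mul (isom_inv h) g).
Proof.
exists (approximants Lambda E [seq x i | i <- enum I]
    [seq (mdist (x i) (x j), true) | i <- enum I, j <- enum I]).
  by exists [seq x i | i <- enum I],
    [seq (mdist (x i) (x j), true) | i <- enum I, j <- enum I].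
move=> g h gN hN i; rewrite isom_mulE mdist_inv.
have [j gj] := depth_max g i; have [j' hj'] := depth_max h i.
have gxj : mdist (isom_fun g (x i)) (x j) <= depth g i by rewrite -gj le_max lexx orbT.
have hxj' : mdist (isom_fun h (x i)) (x j') <= depth h i by rewrite -hj' le_max lexx orbT.
have via l : mdist (isom_fun g (x i)) (x l) <= depth g i ->
    mdist (isom_fun h (x i)) (x l) <= depth h i ->
    mdist (isom_fun g (x i)) (isom_fun h (x i)) <= Num.max (depth g i) (depth h i).
  move=> gl hl; apply: (ultra_le uryU (y := x l)); first by rewrite le_max gl.
  by rewrite metric_sym le_max hl orbT.
have [jj'0|Ljj'] := mdist_spectrum0 uryU (x j) (x j').
  by apply: (via j) => //; rewrite (mdist_positivity _ _ jj'0).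
have memx k : x k \in [seq x i | i <- enum I] by rewrite map_f// mem_enum.
have lev : (mdist (x j) (x j'), true) \in
    [seq (mdist (x i) (x j), true) | i <- enum I, j <- enum I].
  by apply/allpairsP; exists (j, j'); rewrite !mem_enum.
have gE := gN _ _ _ lev Ljj' (memx i) (memx j).
have hE := hN _ _ _ lev Ljj' (memx i) (memx j).
(* The open level of [mdist (x j) (x j')] is tested by [N]. If [g (x i)] is that close to [x j], so
   is [h (x i)], which is then no farther from [x j] than from [x j']; if not, [x j'] is as good as
   [x j] for [g]. *)
have [glt|ge] := ltP (mdist (isom_fun g (x i)) (x j)) (mdist (x j) (x j')).
  have hlt : mdist (isom_fun h (x i)) (x j) < mdist (x j) (x j') by apply/hE/gE.
  apply: (via j) => //; rewrite (le_trans (ltW hlt))//.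
  by rewrite -(ultra_eq uryU hlt).
apply: (via j') => //; apply: (ultra_le uryU (y := x j)) => //.
exact: le_trans ge gxj.
Qed.

End decided_depth.
End depth.

Section operator_topologies.
Context {R : realType}.

Lemma cvg_initial (S : choiceType) (T : topologicalType) (f : S -> T)
    (F : set_system S) (s : S) :
  Filter F -> f @ F --> f s -> F --> (s : initial_topology f).
Proof.
move=> FF fFs A [_ [[B oB <-] Bfs BA]]; apply: filterS BA _.
by apply: fFs; exact: open_nbhs_nbhs.
Qed.

Lemma cvg_ptws (X : Type) (T : topologicalType) (F : set_system {ptws X -> T})
    (f : {ptws X -> T}) :
  Filter F -> (forall x, (fun h : {ptws X -> T} => h x) @ F --> f x) -> F --> f.
Proof. by move=> FF Ff; apply/cvg_sup => x; exact: cvg_initial. Qed.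

Lemma cvg_isometries (U : metricType R) (F : set_system (isometries U)) (g : isometries U) :
  Filter F -> (forall x, (fun h => isom_fun h x) @ F --> isom_fun g x) -> F --> g.
Proof.
move=> FF Fg; apply: cvg_initial.
by apply: cvg_ptws => x; exact: Fg.
Qed.

Context (H : completeNormedModType R[i]).
Variable dot : {dot H for @Num.conj R[i]}.

Lemma strong_op_eval_continuous (u : H) :
  continuous (fun S : strong_op H => S u).
Proof.
move=> S; apply: (@continuous_comp _ _ _
  (fun T : strong_op H => (T : H -> H) : {ptws H -> H}) (fun f => f u)).
  exact: initial_continuous.
exact: proj_continuous.
Qed.

Lemma weak_op_eval_continuous (u v : H) :
  continuous (fun S : weak_op dot => dot (S u) v : (R[i] : numFieldType)).
Proof.
move=> S; apply: (@continuous_comp _ _ _ (fun T : weak_op dot =>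
  (fun uv : H * H => dot (T uv.1) uv.2) : {ptws (H * H)%type -> (R[i] : numFieldType)})
  (fun f => f (u, v))).
  exact: initial_continuous.
exact: proj_continuous.
Qed.

Lemma cvg_weak_op (F : set_system (weak_op dot)) (S : weak_op dot) : Filter F ->
  (forall u v, (fun T : weak_op dot => dot (T u) v : (R[i] : numFieldType)) @ F
     --> (dot (S u) v : (R[i] : numFieldType))) -> F --> S.
Proof.
move=> FF FS; apply: cvg_initial.
by apply: cvg_ptws => -[u v]; exact: FS.
Qed.

End operator_topologies.

Section complex_limits.
Context {R : realType}.

Lemma Re_normr_le (z : R[i]) (e : R) : (complex.Re `|z| <= e) = (`|z| <= e%:C%C).
Proof. by rewrite -lecR RRe_real ?normr_real. Qed.

Lemma Re_normD (z w : R[i]) :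
  complex.Re `|z + w| <= complex.Re `|z| + complex.Re `|w|.
Proof.
rewrite Re_normr_le; apply: le_trans (ler_normD _ _) _.
by rewrite -[in leLHS](RRe_real (normr_real z)) -[in leLHS](RRe_real (normr_real w)) -rmorphD.
Qed.

Lemma Re_normB (z w : R[i]) : complex.Re `|z - w| = complex.Re `|w - z|.
Proof. by rewrite distrC. Qed.

Lemma cvg_complexP (T : Type) (F : set_system T) (f : T -> (R[i] : numFieldType))
    (a : (R[i] : numFieldType)) : Filter F ->
  f @ F --> a <-> forall e : R, 0 < e -> F [set t | complex.Re `|f t - a| <= e].
Proof.
move=> FF; split=> [/cvgrPdist_le fa e e0|fa].
  have /fa : 0 < e%:C%C :> R[i] by rewrite ltcR.
  by apply: filterS => t /=; rewrite -Re_normr_le distrC.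
apply/cvgrPdist_le => e e0; apply: filterS (fa _ (Re_gt0 e0)) => t /=.
by rewrite Re_normr_le distrC RRe_real ?gtr0_real.
Qed.

End complex_limits.

Section matrix_coefficients.
Context {R : realType} {U : metricType R} (H : completeNormedModType R[i]).
Variable dot : {dot H for @Num.conj R[i]}.
Hypothesis hn : hilbert_norm dot.
Variable rho : isometries U -> bounded_op H.
Hypothesis rep : unitary_representation dot rho.
Context {Lambda : set R}.
Hypothesis uryU : urysohn Lambda U.
Hypothesis Lpos : Lambda `<=` [set r | 0 < r].
Implicit Types (g h k : isometries U) (u v w : H).

Let um := urysohn_ultrametric uryU.

Section fixed_vectors.
Variables (I : finType) (x : I -> U) (s : R).
Hypothesis s0 : 0 < s.

Local Notation P t := (fixproj dot rho (fixer x t)).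
Local Notation B := (branch x s).

Let branch0 i r j : 0 <= B i r j.
Proof. exact: le_trans (ltW s0) (branch_ge x s i r j). Qed.

Let branchG i r : is_subgroup (fixer x (B i r)).
Proof. by apply: fixer_subgroup => // j; exact: branch0. Qed.

(* Raising the heights of all the branches from t to max t t' costs no more than
   raising them one at a time, since the projections commute. *)
Lemma proj_branches (t t' : I -> R) u : (forall i, s <= t i) -> (forall i, s <= t' i) ->
  consistent x t -> consistent x t' ->
  rnorm (P t u - P (fun i => Num.max (t i) (t' i)) u) <=
  \sum_i rnorm (P (B i (t i)) u - P (B i (Num.max (t i) (t' i))) u).
Proof.
move=> st st' tc tc'.
(* [raise l] raises [t] to [t'] along the branches listed in [l] only; the full list gives the
   pointwise maximum. *)
pose raise l j := foldr (fun i a => Num.max a (B i (t' i) j)) (t j) l.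
have traise l j : t j <= raise l j.
  by elim: l => //= i l ih; rewrite le_max ih.
have raise0 l j : 0 <= raise l j.
  by rewrite (le_trans _ (traise l j))// (le_trans (ltW s0)).
have raiseG l : is_subgroup (fixer x (raise l)) by exact: fixer_subgroup.
have t0 i : 0 <= t i by rewrite (le_trans (ltW s0)).
have tG : is_subgroup (fixer x t) by exact: fixer_subgroup.
have raiseE : raise (enum I) = fun i => Num.max (t i) (t' i).
  apply/funext => j; apply/eqP; rewrite eq_le; apply/andP; split.
    elim: (enum I) => [|i l ih] /=; first by rewrite le_max lexx.
    by rewrite ge_max ih le_max branch_bound ?orbT.
  rewrite ge_max traise/=; have : j \in enum I by rewrite mem_enum.
  elim: (enum I) => //= i l ih; rewrite inE le_max => /orP[/eqP<-|/ih->//].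
  by rewrite branch_self// lexx orbT.
rewrite -raiseE -big_enum /=.
elim: (enum I) => [|i l ih]; first by rewrite big_nil subrr /rnorm normr0.
rewrite big_cons addrC.
have -> : P t u - P (raise (i :: l)) u =
    (P t u - P (raise l) u) + (P (raise l) u - P (raise (i :: l)) u) by rewrite subrKA.
rewrite (le_trans (rnormD _ _))// lerD//.
(* The consistent family needed by [proj_maxC] is the branch. As a result, each single step is the
   image under the contraction [P (raise l)] of a difference of two branch projections. *)
have step (r : R) : P (raise l) (P (B i r) u) = P (fun j => Num.max (raise l j) (B i r j)) u.
  exact: (proj_maxC hn rep um uryU Lpos u (raise0 l) (branch0 i r)
    (branch_consistent uryU x s i r)).
have e1 : P (raise l) u = P (raise l) (P (B i (t i)) u).
  rewrite step; congr (P _ u); apply/funext => j.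
  by apply/esym/max_l; apply: le_trans (traise l j); exact: branch_bound.
have e2 : P (raise (i :: l)) u = P (raise l) (P (B i (Num.max (t i) (t' i))) u).
  rewrite step; congr (P _ u); apply/funext => j /=.
  rewrite -branch_max maxA; congr Num.max.
  by apply/esym/max_l; apply: le_trans (traise l j); exact: branch_bound.
by rewrite e1 e2 -projB// proj_rnorm.
Qed.

(** Moving [g] to the other side turns [v] into a vector fixed by the stabilizer of the balls about
    the points [g^-1 (x j)]. With respect to these, [depth] gives the heights required by
    [independence]. *)
Lemma coefficient_depth g u v : fixed rho (fixer x (fun=> s)) u ->
  fixed rho (fixer x (fun=> s)) v -> dot (rho g u) v = dot (rho g (P (depth x s g) u)) v.
Proof.
move=> fu fv; rewrite !(rep_dotV rep).
pose y i := isom_fun (isom_inv g) (x i).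
apply: (@independence _ _ _ _ hn _ rep um _ uryU Lpos I I x y (fun=> s) (depth x s g) (fun=> s)).
- by move=> _; exact: ltW.
- by move=> _; exact: ltW.
- by move=> i; exact: depth_ge.
- move=> i j; rewrite maxxx /y metric_sym mdist_inv metric_sym; exact: depth_le_max.
- move=> i; have [j <-] := depth_max x s g i; exists j.
  by rewrite /y metric_sym mdist_inv metric_sym maxC.
- exact: fu.
- move=> k ky; have gk : fixer x (fun=> s) (isom_mul g (isom_mul k (isom_inv g))).
    move=> i; rewrite !isom_mulE metric_sym -mdist_inv metric_sym; exact: ky.
  by have := fv _ gk; rewrite !(rep_mul rep) => e; rewrite -[in RHS]e (rep_invVK rep).
Qed.

Variable E : @level R -> U -> U -> Prop.
Local Notation F := (approximation_filter (Lambda := Lambda) E).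
Context {FF : ProperFilter F}.

(** The squared norm of the projection decreases as the branch is cut higher, so it converges along
    the filter; by Pythagoras a small drop of the squared norm is a small distance of the
    projections. *)
Lemma branch_limit i u (d : R) : 0 < d -> exists2 N, F N & forall g h, N g -> N h ->
  rnorm (P (B i (depth x s g i)) u -
         P (B i (Num.max (depth x s g i) (depth x s h i))) u) <= d.
Proof.
move=> d0; pose m r := rnorm (P (B i r) u) ^+ 2.
have sub r r' : r <= r' -> fixer x (B i r) `<=` fixer x (B i r').
  by move=> rr'; apply: fixer_le => j; exact: branch_le.
have mB r r' : r <= r' -> rnorm (P (B i r) u - P (B i r') u) ^+ 2 = m r - m r'.
  by move=> rr'; apply: proj_pythagoras => //; exact: sub.
have [|||L LP] := @decided_monotone_limit _ _ F FF (fun g => depth x s g i) m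
    (rnorm u ^+ 2) (decided_depth_le uryU x s0 i) (decided_depth_lt uryU x s0 i).
- by move=> r r' /mB e; rewrite -subr_ge0 -e sqr_ge0.
- by move=> r; exact: sqr_ge0.
- by move=> r; rewrite ler_pXn2r ?nnegrE ?rnorm_ge0// proj_rnorm.
have d2 : 0 < d ^+ 2 / 2 by rewrite divr_gt0 ?exprn_gt0.
exists [set g | L - d ^+ 2 / 2 < m (depth x s g i) <= L + d ^+ 2 / 2]; first exact: LP.
move=> g h /= /andP[g1 g2] /andP[h1 h2].
rewrite -(@ler_pXn2r _ 2) ?nnegrE ?rnorm_ge0 ?(ltW d0)// mB ?le_max ?lexx//.
by rewrite maxElt; case: ifP => _; lra.
Qed.

Lemma coefficient_cauchy_fixed u v (e : R) : fixed rho (fixer x (fun=> s)) u ->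
  fixed rho (fixer x (fun=> s)) v -> 0 < e ->
  exists2 N, F N & forall g h, N g -> N h ->
    complex.Re `|dot (rho g u) v - dot (rho h u) v| <= e.
Proof.
move=> fu fv e0.
have v1 : 0 < rnorm v + 1 by rewrite ltr_wpDl ?rnorm_ge0.
have c0 : 0 < 2 * #|I|%:R + 1 :> R by rewrite ltr_wpDl ?mulr_ge0.
(* Replacing the projections by [A] costs at most [#|I| * d * rnorm v] for [g] and as much for [h].
   The added ones keep the divisor positive. *)
pose d := e / ((2 * #|I|%:R + 1) * (rnorm v + 1)).
have d0 : 0 < d by rewrite divr_gt0 ?mulr_gt0.
have /choice[N NP] i : exists N, F N /\ forall g h, N g -> N h ->
    rnorm (P (B i (depth x s g i)) u -
           P (B i (Num.max (depth x s g i) (depth x s h i))) u) <= d.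
  by have [N FN NP] := branch_limit i u d0; exists N.
have [N0 FN0 N0P] := depth_translate uryU x s E.
exists (N0 `&` [set g | forall i, N i g]).
  by apply: filterI => //; apply: (@filter_forall _ I N F) => i; have [] := NP i.
move=> g h [N0g Ng] [N0h Nh].
rewrite (coefficient_depth g fu fv) (coefficient_depth h fu fv).
pose t g := depth x s g.
have est g1 h1 : (forall i, N i g1) -> (forall i, N i h1) ->
    rnorm (P (t g1) u - P (fun i => Num.max (t g1 i) (t h1 i)) u) <= #|I|%:R * d.
  move=> Ng1 Nh1; have /le_trans := proj_branches u (depth_ge x s g1) (depth_ge x s h1)
    (depth_consistent uryU x s g1) (depth_consistent uryU x s h1).
  apply; rewrite mulr_natl -sumr_const; apply: ler_sum => i _.
  by have [_] := NP i; apply.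
pose A := P (fun i => Num.max (t g i) (t h i)) u.
have m0 i : 0 <= Num.max (t g i) (t h i).
  by rewrite le_max (le_trans (ltW s0) (depth_ge _ _ _ _)).
have [fA _] := projP hn rep u (fixer_subgroup um x m0).
have ghA : rho g A = rho h A.
  have := fA _ (N0P g h N0g N0h); rewrite (rep_mul rep) -/A => eA.
  by rewrite -{2}eA (rep_invK rep).
(* [h^-1 g] fixes [A], so the contributions of [A] cancel. *)
have -> : dot (rho g (P (t g) u)) v - dot (rho h (P (t h) u)) v =
    dot (rho g (P (t g) u - A)) v - dot (rho h (P (t h) u - A)) v.
  by rewrite !linearB !dotBl ghA opprB addrA subrK.
have gA := est g h Ng Nh; have hA := est h g Nh Ng.
have {}hA : rnorm (P (t h) u - A) <= #|I|%:R * d.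
  rewrite /A (_ : (fun i => Num.max (t g i) (t h i)) = fun i => Num.max (t h i) (t g i))//.
  by apply/funext => i; rewrite maxC.
have v0 := rnorm_ge0 v.
rewrite (le_trans (Re_normD _ _))// normrN.
have B1 : complex.Re `|dot (rho g (P (t g) u - A)) v| <= #|I|%:R * d * rnorm v.
  by rewrite (le_trans (dot_le hn _ _))// (rep_rnorm hn rep) ler_wpM2r.
have B2 : complex.Re `|dot (rho h (P (t h) u - A)) v| <= #|I|%:R * d * rnorm v.
  by rewrite (le_trans (dot_le hn _ _))// (rep_rnorm hn rep) ler_wpM2r.
rewrite (le_trans (lerD B1 B2))//.
have -> : e = d * ((2 * #|I|%:R + 1) * (rnorm v + 1)).
  by rewrite /d divfK// gt_eqF// mulr_gt0.
have I0 : 0 <= #|I|%:R :> R by [].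
nra.
Qed.

End fixed_vectors.
End matrix_coefficients.

Section weak_limits.
Context {R : realType} {U : metricType R} (H : completeNormedModType R[i]).
Variable dot : {dot H for @Num.conj R[i]}.
Hypothesis hn : hilbert_norm dot.
Variable rho : isometries U -> bounded_op H.
Hypothesis rep : unitary_representation dot rho.
Context {Lambda : set R}.
Hypothesis uryU : urysohn Lambda U.
Hypothesis Lpos : Lambda `<=` [set r | 0 < r].
Implicit Types (g h k : isometries U) (u v w : H).

Let um := urysohn_ultrametric uryU.

Definition seq_fixer (xs : seq U) (s : R) : set (isometries U) :=
  fixer (fun z : seq_sub xs => ssval z) (fun=> s).

Lemma seq_fixer_sub xs ys s t : {subset xs <= ys} -> t <= s ->
  seq_fixer ys t `<=` seq_fixer xs s.
Proof.
move=> xy ts k kP z; apply: le_trans ts.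
exact: (kP (SeqSub (xy _ (ssvalP z)))).
Qed.

(** Stabilizers of finitely many balls of small radius converge to the identity in the topology of
    pointwise convergence. *)
Lemma rep_continuous_at_one u (e : R) : 0 < e -> exists xs s, 0 < s /\
  forall k, seq_fixer xs s k -> rnorm (rho k u - u) < e.
Proof.
move=> e0; pose N : set_system (isometries U) :=
  [set P | exists xs s, 0 < s /\ seq_fixer xs s `<=` P].
have NF : Filter N.
  split=> [|P Q [xs [s [s0 sP]]] [ys [t [t0 tQ]]]|P Q PQ [xs [s [s0 sP]]]].
  - by exists [::], 1.
  - exists (xs ++ ys), (Num.min s t); split; first by rewrite lt_min s0.
    move=> k kP; split.
      by apply: sP; apply: seq_fixer_sub kP => [z|]; rewrite ?ge_min ?lexx// mem_cat => ->.
    apply: tQ; apply: seq_fixer_sub kP => [z|]; rewrite ?ge_min ?lexx ?orbT//.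
    by rewrite mem_cat orbC => ->.
  - by exists xs, s; split=> // k /sP/PQ.
have None : N --> (isom_one : isometries U).
  apply: cvg_isometries => x P /nbhs_ballP[d /= d0 dP].
  exists [:: x], (d / 2); split; first by rewrite divr_gt0.
  have xx : x \in [:: x] by rewrite inE.
  move=> k /(_ (SeqSub xx)) /= kx; apply: dP.
  by rewrite ballEmdist /= isom_oneE metric_sym (le_lt_trans kx)// ltr_pdivrMr// ltr_pMr// ltr1n.
have cont : (fun k => rho k u) @ N --> rho isom_one u.
  move=> A nA; apply: None.
  have nA' : nbhs (rho isom_one : strong_op H) [set S | A (S u)].
    exact: strong_op_eval_continuous nA.
  exact: (rep_continuous rep nA').
have eC : 0 < e%:C%C :> R[i] by rewrite ltcR.
have /cont[xs [s [s0 sP]]] : nbhs (rho isom_one u) (ball (rho isom_one u) e%:C%C).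
  exact: nbhsx_ballx.
exists xs, s; split=> // k /sP; rewrite /= (rep_one rep) rnorm_ball rnorm_lt//.
by rewrite rnormB.
Qed.

(** Balls about the identity are subgroups here, so a vector which such a group moves by less than
    [e] is within [e] of its projection to the fixed vectors. *)
Lemma smooth_dense u (e : R) : 0 < e -> exists xs s w,
  [/\ 0 < s, fixed rho (seq_fixer xs s) w & rnorm (u - w) <= e].
Proof.
move=> e0; have [xs [s [s0 sP]]] := rep_continuous_at_one u e0.
have G : is_subgroup (seq_fixer xs s).
  by apply: fixer_subgroup => // _; exact: ltW.
exists xs, s, (fixproj dot rho (seq_fixer xs s) u); split=> //.
  by have [] := projP hn rep u G.
by apply: proj_close => // k /sP/ltW.
Qed.

Section limit_along.
Variable E : @level R -> U -> U -> Prop.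
Local Notation F := (approximation_filter (Lambda := Lambda) E).
Context {FF : ProperFilter F}.

Lemma coefficient_cauchy u v (e : R) : 0 < e ->
  exists2 N, F N & forall g h, N g -> N h ->
    complex.Re `|dot (rho g u) v - dot (rho h u) v| <= e.
Proof.
move=> e0; have u1 : 0 < rnorm u + 1 by rewrite ltr_wpDl ?rnorm_ge0.
have v1 : 0 < rnorm v + 1 by rewrite ltr_wpDl ?rnorm_ge0.
have a0 : 0 < e / 8 / (rnorm u + 1) by rewrite !divr_gt0.
(* The bound 1 ensures [rnorm u' <= rnorm u + 1], the factor against which [a0] controls [v - v'].
   Each replacement costs [e / 8], hence [e / 4] for [g] and [e / 4] for [h]. *)
have b0 : 0 < Num.min 1 (e / 8 / (rnorm v + 1)) by rewrite lt_min ltr01 !divr_gt0.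
have [ys [t [v' [t0 fv vv']]]] := smooth_dense v a0.
have [xs [s [u' [s0 fu uu']]]] := smooth_dense u b0.
pose zs := xs ++ ys; pose r := Num.min s t.
have r0 : 0 < r by rewrite lt_min s0.
have fu' : fixed rho (seq_fixer zs r) u'.
  apply: fixed_sub fu; apply: seq_fixer_sub => [z|]; rewrite ?ge_min ?lexx//.
  by rewrite mem_cat => ->.
have fv' : fixed rho (seq_fixer zs r) v'.
  apply: fixed_sub fv; apply: seq_fixer_sub => [z|]; rewrite ?ge_min ?lexx ?orbT//.
  by rewrite mem_cat orbC => ->.
have e2 : 0 < e / 2 by rewrite divr_gt0.
have [N FN NP] := @coefficient_cauchy_fixed _ _ _ _ hn _ rep _ uryU Lpos _ _ _ r0 E FF
  u' v' (e / 2) fu' fv' e2.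
exists N => // g h Ng Nh.
have close k : complex.Re `|dot (rho k u) v - dot (rho k u') v'| <= e / 4.
  have -> : dot (rho k u) v - dot (rho k u') v' =
      dot (rho k (u - u')) v + dot (rho k u') (v - v').
    by rewrite linearB dotBl dotBr addrA subrK.
  rewrite (le_trans (Re_normD _ _))//.
  have h1 := dot_le hn (rho k (u - u')) v; have h2 := dot_le hn (rho k u') (v - v').
  rewrite !(rep_rnorm hn rep) in h1 h2.
  have := rnormD u (u' - u); rewrite subrKC (rnormB u' u) => u'le.
  move: uu'; rewrite le_min => /andP[uu1]; rewrite ler_pdivlMr// => uue.
  move: vv'; rewrite ler_pdivlMr// => vve.
  have p1 := rnorm_ge0 (u - u'); have p2 := rnorm_ge0 (v - v').
  have p3 := rnorm_ge0 u'; have p4 := rnorm_ge0 v.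
  nra.
have -> : dot (rho g u) v - dot (rho h u) v =
    (dot (rho g u) v - dot (rho g u') v') +
    ((dot (rho g u') v' - dot (rho h u') v') + (dot (rho h u') v' - dot (rho h u) v)).
  by rewrite subrKA subrKA.
have := Re_normD (dot (rho g u) v - dot (rho g u') v')
    ((dot (rho g u') v' - dot (rho h u') v') + (dot (rho h u') v' - dot (rho h u) v)).
have := Re_normD (dot (rho g u') v' - dot (rho h u') v') (dot (rho h u') v' - dot (rho h u) v).
have := close g; have := close h; have := NP g h Ng Nh.
rewrite [complex.Re `|dot (rho h u') v' - dot (rho h u) v|]Re_normB; lra.
Qed.

(** The hulls of the sets [rho g u], [g] in a set of the filter, form a directed family, and
    [midclosed_limit] gives a vector close to all of them. Coefficients vary by little on a small
    enough set of the filter, hence also on its hull, so this vector is the weak limit. *)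
Lemma weak_limit_vector u : exists w, forall v,
  (fun g => dot (rho g u) v : (R[i] : numFieldType)) @ F --> (dot w v : (R[i] : numFieldType)).
Proof.
pose B := [set S : set H | exists2 N, F N & S = midhull [set rho g u | g in N]].
have [||||w [wB _]] := @midclosed_limit _ _ _ hn B (rnorm u).
- exists (midhull [set rho g u | g in [set: isometries U]]).
  by exists [set: isometries U]; first exact: filterT.
- move=> _ _ [N FN ->] [N' FN' ->]; exists (midhull [set rho g u | g in N `&` N']).
    by exists (N `&` N') => //; exact: filterI.
  move=> z zP; split; apply: midhull_sub zP => _ [g [Ng N'g] <-]; by exists g.
- by move=> _ [N _ ->] a b; exact: midhull_mid.
- move=> _ [N FN ->]; have [g Ng] := filter_ex FN.
  by exists (rho g u); [apply: midhull_in; exists g|rewrite (rep_rnorm hn rep)].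
exists w => v; apply/cvg_complexP => e e0.
have e2 : 0 < e / 2 by rewrite divr_gt0.
have [N FN NP] := coefficient_cauchy u v e2.
have BN : B (midhull [set rho g u | g in N]) by exists N.
apply: filterS FN => g Ng; rewrite /mkset.
have v1 : 0 < rnorm v + 1 by rewrite ltr_wpDl ?rnorm_ge0.
have ev : 0 < e / 2 / (rnorm v + 1) by rewrite !divr_gt0.
have [z zP zw] := wB _ _ BN ev.
have zg : complex.Re `|dot z v - dot (rho g u) v| <= e / 2.
  by apply: midhull_dot_near zP => _ [h Nh <-]; exact: NP.
have zwv := dot_le hn (z - w) v; rewrite dotBl in zwv.
move: zw; rewrite ltr_pdivlMr// => zw; have v0 := rnorm_ge0 v; have p := rnorm_ge0 (z - w).
have := Re_normD (dot (rho g u) v - dot z v) (dot z v - dot w v).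
rewrite subrKA => h; rewrite Re_normB in zg; nra.
Qed.

Lemma weak_limit_operator : exists T : bounded_op H, forall u v,
  (fun g => dot (rho g u) v : (R[i] : numFieldType)) @ F --> (dot (T u) v : (R[i] : numFieldType)).
Proof.
have [f fP] := choice weak_limit_vector.
have uniq (z z' : R[i] : numFieldType) (q : isometries U -> (R[i] : numFieldType)) :
    q @ F --> z -> q @ F --> z' -> z = z'.
  by apply: cvg_unique; exact: norm_hausdorff.
have flin : linear f.
  move=> a u v; apply: (eq_dot (dot := dot)) => w.
  apply: uniq (fP _ w) _; rewrite linearDl linearZl_LR /=.
  have -> : (fun g => dot (rho g (a *: u + v)) w) =
            (fun g => a * dot (rho g u) w + dot (rho g v) w).
    by apply/funext => g; rewrite linearD linearZ linearDl linearZl_LR.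
  exact: (cvgD (cvgMl_tmp (fP u w)) (fP v w)).
pose L : {linear H -> H} := HB.pack f (GRing.isLinear.Build _ _ _ _ f flin).
have fle u : rnorm (f u) <= rnorm u.
  have [->|p0] := eqVneq (rnorm (f u)) 0; first exact: rnorm_ge0.
  have pp : 0 < rnorm (f u) by rewrite lt_neqAle eq_sym p0 rnorm_ge0.
  rewrite -(ler_pM2r pp); apply/ler_addgt0Pr => e e0.
  have /cvg_complexP/(_ _ e0)/filter_ex[g fg] := fP u (f u).
  have d : complex.Re `|dot (f u) (f u)| = rnorm (f u) ^+ 2.
    by rewrite (dot_rnorm hn) ger0_norm ?ler0c ?sqr_ge0.
  have := Re_normD (dot (f u) (f u) - dot (rho g u) (f u)) (dot (rho g u) (f u)).
  have := dot_le hn (rho g u) (f u); rewrite (rep_rnorm hn rep) subrK d.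
  rewrite /mkset Re_normB in fg; rewrite -expr2; lra.
have Lb : bounded_near L (nbhs (0 : H)).
  apply/linear_boundedP; near=> r => u; rewrite /= !rnormE.
  have r1 : 1 <= r by near: r; apply: nbhs_pinfty_ge; rewrite real1.
  rewrite (le_trans (_ : _ <= (rnorm u)%:C%C))// ?lecR//.
  by rewrite ler_peMl// ler0c rnorm_ge0.
by exists (BoundedOp Lb).
Unshelve. all: by end_near.
Qed.

End limit_along.
End weak_limits.

(** * The tree and the semigroup *)

Local Notation over := Defs.over.
Local Notation radius := Defs.radius.

Section tree_geometry.
Context {R : realType} {U : metricType R}.
Hypothesis um : ultrametric U.
Implicit Types (x y z : U) (r s t : {nonneg R}) (p q : tree U).

Lemma iballP (b : iball U) : exists x, b = ibeta x (radius b).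
Proof. by have [x bx] := iball_ex b; exists x; exact: iball_eq. Qed.

Lemma beta_eqP x y r s : beta x r = beta y s <-> r = s /\ mdist x y <= r%:num.
Proof.
rewrite /beta; split=> [[]|/(ibetaP _ _ _ _ um) ->//].
move=> eC er; apply/(ibetaP _ _ _ _ um); exact: iball_eq.
Qed.

Lemma over_betaP x y r s :
  over (beta y s) (beta x r) <-> r%:num < s%:num /\ mdist x y <= s%:num.
Proof.
split=> [[x0 [y0 []]]|[rs xy]]; last by exists x, y.
move=> /= /(ibetaP _ _ _ _ um)[_ xx0] /(ibetaP _ _ _ _ um)[_ yy0] rs xy0; split=> //.
rewrite (le_trans (um x x0 y))// ge_max (le_trans xx0 (ltW rs))/=.
by rewrite (le_trans (um x0 y0 y))// ge_max xy0 metric_sym.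
Qed.

Lemma ascending_betaP x y r s :
  ascending_path (beta x r) (beta y s) <-> r%:num <= s%:num /\ mdist x y <= s%:num.
Proof.
split=> [[/beta_eqP[-> yx]|/over_betaP[/ltW rs xy]]|[]] //.
  by rewrite lexx metric_sym.
rewrite le_eqVlt => /orP[/eqP/val_inj <-|rs] xy; [left|right; exact/over_betaP].
by apply/beta_eqP; rewrite metric_sym.
Qed.

Lemma ascendingP x r q : ascending_path (beta x r) q ->
  q = None \/ exists2 s, q = beta x s & r%:num <= s%:num.
Proof.
case: q => [c|]; last by left.
have [y ->] := iballP c => /ascending_betaP[rs xy]; right.
exists (radius c) => //; apply/beta_eqP; split=> //.
by rewrite metric_sym.
Qed.

Lemma over_vertexP x s q : over (beta x s) q ->
  exists y r, [/\ q = beta y r, r%:num < s%:num & mdist y x <= s%:num].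
Proof.
case: q => [b|]//; have [y ->] := iballP b => /over_betaP[rs yx].
by exists y, (radius b).
Qed.

Lemma nonneg_of (a : R) : 0 <= a -> exists t, t%:num = a.
Proof. by move=> a0; exists (NngNum a0). Qed.

Lemma germ_classP x y z r s t : s%:num < r%:num -> mdist y x <= r%:num ->
  germ_class (beta x r) (beta y s) (beta z t) <->
  t%:num < r%:num /\ mdist y z < r%:num.
Proof.
move=> sr yx; split=> [[/over_betaP[tr zx] [w [rw]]]|[tr yz]].
  move: rw; case: w => [c|]//; have [w ->] := iballP c => /over_betaP[cr wx].
  move=> /ascending_betaP[sc yw] /ascending_betaP[tc zw]; split=> //.
  rewrite (le_lt_trans (um y w z))// gt_max (le_lt_trans yw cr)/=.
  by rewrite metric_sym (le_lt_trans zw cr).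
split; first apply/over_betaP; first split=> //.
  by rewrite (le_trans (um z y x))// ge_max yx metric_sym ltW.
(* This is the height at which the two ascending paths join. *)
have [w wE] : exists w : {nonneg R}, w%:num = Num.max (mdist y z) (Num.max s%:num t%:num).
  by apply: nonneg_of; rewrite le_max mdist_ge0.
have wr : w%:num < r%:num by rewrite wE !gt_max yz sr.
exists (beta y w); split; first exact/over_betaP.
  by apply/ascending_betaP; rewrite mdistxx wE !le_max lexx !orbT mdist_ge0.
by apply/ascending_betaP; rewrite wE !le_max metric_sym !lexx !orbT.
Qed.

Lemma germ_class_beta x y r s : s%:num < r%:num -> mdist y x <= r%:num ->
  germ_class (beta x r) (beta y s) = [set q | exists z t,
    [/\ q = beta z t, t%:num < r%:num & mdist y z < r%:num]].
Proof.
move=> sr yx; apply/seteqP; split=> [q qP|_ [z [t [-> tr yz]]]]; last exact/germ_classP.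
have [/over_vertexP[z [t [eq tr zx]]] _] := qP; exists z, t; split=> //.
by move: qP; rewrite eq => /germ_classP -[].
Qed.

End tree_geometry.

(** * Balls and germs described by levels and centres *)

Section nodes.
Context {R : realType} {Lambda : set R} {U : metricType R}.
Hypothesis uryU : urysohn Lambda U.
Hypothesis Lpos : Lambda `<=` [set r | 0 < r].
Implicit Types (x y z : U) (r s t : {nonneg R}) (l : @level R) (w : tilde_tree Lambda U).

Let um := urysohn_ultrametric uryU.

(* w is the closed ball, resp. the germ, of level l at x *)
Definition node l x w : Prop :=
  match w with
  | inl a => ~~ l.2 /\ exists2 r : {nonneg R}, r%:num = l.1 & set_val a = beta x r
  | inr c => l.2 /\ exists2 r : {nonneg R}, r%:num = l.1 &
      germ_vertex c = beta x r /\ germ_dir c = germ_class (beta x r) (beta x 0%:nng)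
  end.

Lemma germ_vertex_height (c : germ Lambda U) x r :
  germ_vertex c = beta x r -> Lambda r%:num.
Proof.
by have [l Ll hl] := germ_vertexP c => cx; move: hl; rewrite cx => -[->].
Qed.

Lemma node_germ_level l x c : node l x (inr c) -> Lambda l.1.
Proof. by move=> [_ [r <- [/germ_vertex_height]]]. Qed.

Lemma node_germ_dir l x c y s : node l x (inr c) ->
  germ_dir c (beta y s) <-> s%:num < l.1 /\ mdist x y < l.1.
Proof.
move=> cP; have := node_germ_level cP; case: cP => _ [r <- [_ ->]] Lr.
apply: germ_classP => //; first exact: Lpos.
by rewrite mdistxx; exact/ltW/Lpos.
Qed.

Lemma node_fun l x w w' : node l x w -> node l x w' -> w = w'.
Proof.
case: w w' => [a|c] [a'|c'] [b [r rl cP]] [b' [r' r'l c'P]];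
  try (by rewrite b' in b); try (by rewrite b in b').
  have er : r = r' by apply: val_inj; rewrite /= rl r'l.
  by congr inl; apply: val_inj; rewrite -er -cP in c'P.
have er : r = r' by apply: val_inj; rewrite /= rl r'l.
rewrite -er in c'P; case: cP c'P => cv cd [c'v c'd].
by have -> : c = c' by apply: germ_eq; rewrite ?cv ?cd.
Qed.

Lemma node_near l x y w : node l x w -> in_level l (mdist x y) -> node l y w.
Proof.
rewrite /in_level; case: w => [a|c] [b [r rl cP]].
  rewrite (negbTE b) => xy; split=> //; exists r => //; rewrite cP.
  by apply/(beta_eqP um); rewrite rl.
rewrite b => xy; split=> //; exists r => //; case: cP => -> ->.
have vxy : beta x r = beta y r by apply/(beta_eqP um); rewrite rl ltW.
split=> //; rewrite vxy.
have r0 : 0 < r%:num by rewrite rl (le_lt_trans (mdist_ge0 x y)).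
have xy' : mdist x y < r%:num by rewrite rl.
have yy : mdist y y <= r%:num by rewrite mdistxx.
rewrite (germ_class_beta um (s := 0%:nng) r0 (ltW xy')).
rewrite (germ_class_beta um (s := 0%:nng) r0 yy).
apply/seteqP; split=> q [z [t [-> tr zy]]]; exists z, t; split=> //.
  by apply: (ultra_lt uryU (y := x)) => //; rewrite metric_sym.
exact: (ultra_lt uryU (y := y)).
Qed.

(** Through this equivalence, statements about points and germs of the tree and their images become
    conditions on distances. *)
Lemma node_eqP l x y w w' : node l x w -> node l y w' ->
  w = w' <-> in_level l (mdist x y).
Proof.
move=> xw yw'; split=> [e|xy]; last exact: node_fun (node_near xw xy) yw'.
move: xw; rewrite e /in_level => xw'; case: w' {e} xw' yw' => [a|c] /=.
  move=> [b [r rl ->]] [_ [r' r'l /(beta_eqP um)[_ xy]]].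
  by rewrite (negbTE b) -rl.
move=> xc yc; have := xc => -[-> _].
have Ll : 0 < l.1 := Lpos (node_germ_level xc).
have /(node_germ_dir y 0%:nng yc) : 0%:nng%:num < l.1 /\ mdist y y < l.1.
  by rewrite mdistxx.
by move=> /(node_germ_dir _ _ xc)[].
Qed.

Lemma node_exists l x : proper_level Lambda l -> exists w, node l x w.
Proof.
rewrite /proper_level; case: l => [r0 [|]] /= => [Lr|[r00 _]].
  have [r rE] := nonneg_of (ltW (Lpos Lr)).
  have v : vertex Lambda (beta x r) by exists r0; rewrite //= rE.
  have d : exists2 q, over (beta x r) q &
      germ_class (beta x r) (beta x 0%:nng) = germ_class (beta x r) q.
    exists (beta x 0%:nng) => //; apply/(over_betaP um).
    by rewrite /= mdistxx rE; split; [exact: Lpos|exact/ltW/Lpos].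
  by exists (inr (Germ v d)); split=> //; exists r.
have [r rE] := nonneg_of (ltW r00).
have P : beta x r \in tilde_points U.
  by apply/mem_set; left; rewrite /= lte_fin rE.
by exists (inl (exist (fun q => q \in tilde_points U) _ P)); split=> //; exists r.
Qed.

Lemma germ_node (c : germ Lambda U) z r : germ_vertex c = beta z r ->
  exists y, node (r%:num, true) y (inr c).
Proof.
move=> cz; have r0 := Lpos (germ_vertex_height cz).
have [q] := germ_dirP c; rewrite cz => /[dup] vq /(over_vertexP um)[y [t [eq tr yz]]] dE.
exists y; split=> //; exists r => //.
have vzy : beta z r = beta y r by apply/(beta_eqP um); rewrite metric_sym.
have yy : mdist y y <= r%:num by rewrite mdistxx ltW.
rewrite cz dE eq vzy; split=> //.
by rewrite (germ_class_beta um tr yy) (germ_class_beta um (s := 0%:nng) r0 yy).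
Qed.

Lemma tilde_cases w : (exists2 a, w = inl a & set_val a = None) \/
  exists l x, node l x w.
Proof.
case: w => [a|c].
  case e : (set_val a) => [b|]; last by left; exists a.
  have [x bx] := iballP b; right; exists ((radius b)%:num, false), x; split=> //.
  by exists (radius b) => //; rewrite e /beta -bx.
right; have [l Ll] := germ_vertexP c; case e : (germ_vertex c) => [b|]// _.
have [x bx] := iballP b; have [|y cy] := @germ_node c x (radius b).
  by rewrite e /beta -bx.
by exists ((radius b)%:num, true), y.
Qed.

Lemma node_act g l x w : node l x w -> node l (isom_fun g x) (act_tilde g w).
Proof.
case: w => [a|c] [b [r rl cP]]; split=> //; exists r => //.
  by rewrite -[set_val _]/(act_tree g (set_val a)) cP /= act_ibeta.
split; first by rewrite -[germ_vertex _]/(act_tree g (germ_vertex c)) cP.1 /= act_ibeta.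
rewrite -[germ_dir _]/(act_tree g @` germ_dir c) cP.2 act_germ_class /=.
by rewrite !act_ibeta.
Qed.

Definition trace (p : partial_bij (tilde_tree Lambda U)) l x y :=
  exists w w', [/\ node l x w, node l y w' & sends p w w'].

Lemma traceE p l x y w w' : node l x w -> node l y w' ->
  trace p l x y <-> sends p w w'.
Proof.
move=> xw yw'; split=> [[v [v' [xv yv' vv']]]|ww']; last by exists w, w'.
by rewrite (node_fun xw xv) (node_fun yw' yv').
Qed.

Lemma trace_star p l x y : trace (pb_star p) l x y <-> trace p l y x.
Proof. by split=> -[w [w' [? ? ?]]]; exists w', w. Qed.

Lemma trace_isom g l x y : proper_level Lambda l ->
  trace (isom_pb g) l x y <-> in_level l (mdist (isom_fun g x) y).
Proof.
move=> pl; have [w xw] := node_exists x pl; have [w' yw'] := node_exists y pl.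
rewrite (traceE _ xw yw') -(node_eqP (node_act g xw) yw') /=.
by split=> ->.
Qed.

Lemma coherent_isom g : coherent Lambda (trace (isom_pb g)).
Proof.
split.
- move=> l x y x' y' pl xx' yy'; rewrite !trace_isom// => gxy.
  apply: (in_level_trans uryU (y := y)) => //.
  apply: (in_level_trans uryU (y := isom_fun g x)) => //.
  by rewrite isom_isometric metric_sym.
- move=> l x y y' pl; rewrite !trace_isom// => gxy gxy'.
  by apply: (in_level_trans uryU (y := isom_fun g x)) => //; rewrite metric_sym.
- move=> l x x' y pl; rewrite !trace_isom// => gxy gx'y.
  rewrite -(isom_isometric g); apply: (in_level_trans uryU (y := y)) => //.
  by rewrite metric_sym.
- move=> l l' x y pl pl' ll'; rewrite !trace_isom// => gxy.
  have [e|Lxy] := mdist_spectrum0 uryU (isom_fun g x) y; last exact: ll'.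
  by rewrite e (in_level0 Lpos).
Qed.

End nodes.

(** * Elements of the semigroup as coherent relations *)

Section gamma.
Context {R : realType} {Lambda : set R} {U : metricType R}.
Hypothesis uryU : urysohn Lambda U.
Hypothesis Lpos : Lambda `<=` [set r | 0 < r].
Implicit Types (x y z : U) (r s t : {nonneg R}) (l : @level R) (w : tilde_tree Lambda U).

Let um := urysohn_ultrametric uryU.

Lemma height_beta (q : tree U) r : height q = (r%:num%:E)%E -> exists y, q = beta y r.
Proof.
case: q => [b|]//= -[bh]; have [y eb] := iballP b; exists y.
by rewrite eb /beta; congr (Some (ibeta y _)); apply: val_inj.
Qed.

Section partial_isomorphism.
Variable p : partial_bij (tilde_tree Lambda U).
Hypothesis wp : woolly (pb_dom p).
Hypothesis ip : tree_isomorphism p.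

Lemma sends_inl a w : sends p (inl a) w -> exists a', w = inl a'.
Proof. by case: w => [a'|c]; [exists a'|have [] := tiso_sort ip a c]. Qed.

Lemma sends_inr c w : sends p (inr c) w -> exists c', w = inr c'.
Proof. by case: w => [a|c']; [have [] := tiso_sort ip a c|exists c']. Qed.

Lemma dom_point q : has_point (pb_dom p) q -> exists a a',
  set_val a = q /\ sends p (inl a) (inl a').
Proof.
by move=> [a aq [w aw]]; have [a' e] := sends_inl aw; exists a, a'; rewrite -e.
Qed.

(** The domain contains the whole path, and a point over a given one is determined by its height;
    both height and [over] are preserved. *)
Lemma sends_ascending a a' x y r s : sends p (inl a) (inl a') ->
  set_val a = beta x r -> set_val a' = beta y r -> r%:num <= s%:num ->
  exists b b', [/\ set_val b = beta x s, set_val b' = beta y s & sends p (inl b) (inl b')].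
Proof.
move=> aa' ax a'y; rewrite le_eqVlt => /orP[/eqP/val_inj <-|rs]; first by exists a, a'.
have [|asc _] := woolly_ascending wp (xi := a); first by exists (inl a').
have [|b [b' [bx bb']]] := @dom_point (beta x s).
  by apply: asc; rewrite ax; apply/(ascending_betaP um); rewrite mdistxx ltW.
exists b, b'; split=> //; have := tiso_height ip bb'; rewrite bx => /height_beta[z b'z].
have /(tiso_over ip bb' aa') : over (set_val b) (set_val a).
  by rewrite bx ax; apply/(over_betaP um); rewrite mdistxx.
rewrite b'z a'y => /(over_betaP um)[_ yz].
by apply/(beta_eqP um); rewrite metric_sym.
Qed.

Lemma sends_germ_vertex c c' x r : sends p (inr c) (inr c') ->
  germ_vertex c = beta x r -> exists y b b',
    [/\ set_val b = beta x r, set_val b' = beta y r, germ_vertex c' = beta y r &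
      sends p (inl b) (inl b')].
Proof.
move=> cc' cx; have [|b [b' [bc bb']]] := @dom_point (germ_vertex c).
  by apply: (woolly_germ wp); exists (inr c').
have := tiso_height ip bb'; rewrite bc cx => /height_beta[y b'y].
exists y, b, b'; split=> //; first by rewrite bc.
by rewrite -b'y; apply/(tiso_vertex ip cc' bb').
Qed.

Lemma sends_germ a a' x y r l c : sends p (inl a) (inl a') ->
  set_val a = beta x r -> set_val a' = beta y r -> r%:num < l.1 ->
  node l x (inr c) -> exists2 c', node l y (inr c') & sends p (inr c) (inr c').
Proof.
move=> aa' ax a'y rl xc; have Ll := node_germ_level xc.
have [l2 [s sl [cv _]]] := xc.
have rs : r%:num < s%:num by rewrite sl.
have [b [b' [bx b'y bb']]] := sends_ascending aa' ax a'y (ltW rs).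
have [|_ dirs] := woolly_ascending wp (xi := a); first by exists (inl a').
have cax : germ_dir c (set_val a).
  by rewrite ax; apply/(node_germ_dir uryU Lpos _ _ xc); rewrite mdistxx Lpos.
have [|w cw] := dirs c _ cax.
  by rewrite ax cv; apply/(ascending_betaP um); rewrite mdistxx ltW.
have [c' e] := sends_inr cw; rewrite {w}e in cw; exists c' => //.
have c'v : germ_vertex c' = beta y s.
  by rewrite -b'y; apply/(tiso_vertex ip cw bb'); rewrite bx.
have [z c'z] := germ_node uryU Lpos c'v.
have el : (s%:num, true) = l by case: l l2 sl {rl xc Ll} => [l1 [|]]//= _ ->.
rewrite el in c'z; have /(tiso_dir ip cw aa') : germ_dir c (set_val a) by [].
rewrite a'y => /(node_germ_dir uryU Lpos _ _ c'z)[_ zy].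
by apply: (node_near uryU c'z); rewrite /in_level l2.
Qed.

Lemma sends_node l x w w' : sends p w w' -> node l x w -> exists y, node l y w'.
Proof.
case: w => [a|c] ww'.
  have [a' e] := sends_inl ww'; rewrite e in ww' *; move=> [l2 [r rl ax]].
  have := tiso_height ip ww'; rewrite ax => /height_beta[y a'y].
  by exists y; split=> //; exists r.
have [c' e] := sends_inr ww'; rewrite e in ww' *; move=> [l2 [r rl [cx _]]].
have [y [b [b' [_ _ c'y _]]]] := sends_germ_vertex ww' cx.
have [z c'z] := germ_node uryU Lpos c'y; exists z.
by case: l l2 rl => [l1 [|]]//= _ <-.
Qed.

(* A proper level lying below another one on Lambda lies below it on the whole
   line, so that [sends_ascending] and [sends_germ] apply. *)
Lemma trace_le l l' x y : proper_level Lambda l -> proper_level Lambda l' ->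
  (forall a : R, Lambda a -> in_level l a -> in_level l' a) -> trace p l x y -> trace p l' x y.
Proof.
move=> pl pl' ll' [w [w' [xw yw' ww']]].
have le : l.1 <= l'.1 /\ (~~ l.2 -> l'.2 -> l.1 < l'.1).
  move: pl' ll' {xw yw'}; case: l pl => [r b]; case: l' => [r' b'].
  rewrite /proper_level /in_level /=; case: b'; case: b => pl pl' ll'.
  - split=> //; rewrite leNgt; apply/negP => lt.
    by have := ll' _ pl' lt; rewrite ltxx.
  - suff lt : r < r' by split=> //; exact: ltW.
    rewrite ltNge; apply/negP => le; have := ll' _ pl' le.
    by rewrite ltxx.
  (* A proper closed level is a limit of [Lambda] from above, so a spectral value would lie strictly
     between the two radii and violate the assumed inclusion. *)
  - split=> //; rewrite leNgt; apply/negP => lt; have [_ dense'] := pl'.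
    have [|t [Lt /andP[r't tr]]] := dense' (r - r'); first by rewrite subr_gt0.
    rewrite subrKC in tr; have := ll' t Lt tr.
    by rewrite leNgt r't.
  - split=> //; rewrite leNgt; apply/negP => lt; have [_ dense'] := pl'.
    have [|t [Lt /andP[r't tr]]] := dense' (r - r'); first by rewrite subr_gt0.
    rewrite subrKC in tr; have := ll' t Lt (ltW tr).
    by rewrite leNgt r't.
have l'0 : 0 <= l'.1.
  by move: pl'; rewrite /proper_level; case: l'.2 => [/Lpos/ltW|[/ltW]].
(* One can climb to level [l'] from any point below it. For a germ the starting point is its vertex,
   except when the two levels coincide. *)
have from_ball a a' r : sends p (inl a) (inl a') -> set_val a = beta x r ->
    set_val a' = beta y r -> r%:num <= l'.1 -> (l'.2 -> r%:num < l'.1) -> trace p l' x y.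
  move=> aa' ax a'y rl' rl't; case e : l'.2; last first.
    have [s sE] := nonneg_of l'0; rewrite -sE in rl'.
    have [b [b' [bx b'y bb']]] := sends_ascending aa' ax a'y rl'.
    by exists (inl b), (inl b'); split=> //; split; rewrite ?e//; exists s.
  have [v xv] := node_exists uryU Lpos x pl'.
  case: v xv => [b [+ _]|c xc]; first by rewrite e.
  have [c' yc' cc'] := sends_germ aa' ax a'y (rl't e) xc.
  by exists (inr c), (inr c').
have [le1 le2] := le.
case: w xw ww' => [a|c] xw ww'.
  have [a' e] := sends_inl ww'; rewrite {w'}e in yw' ww'.
  have [l2 [r rl ax]] := xw; have [_ [r' r'l a'y]] := yw'.
  have er : r' = r by apply: val_inj; rewrite /= rl r'l.
  by apply: (from_ball a a' r) => //; rewrite -?er ?r'l//; apply: le2.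
have [c' e] := sends_inr ww'; rewrite {w'}e in yw' ww'.
have Ll := node_germ_level xw; have [l2 [r rl [cx cdx]]] := xw.
have [_ [r' r'l [c'y _]]] := yw'.
have er : r' = r by apply: val_inj; rewrite /= rl r'l.
have [z [b [b' [bx b'z c'z bb']]]] := sends_germ_vertex ww' cx.
have b'y : set_val b' = beta y r by rewrite b'z -c'z c'y er.
have [e|lt] := eqVneq l.1 l'.1; last first.
  apply: from_ball bb' bx b'y _ _; rewrite rl//.
  by move=> _; rewrite lt_neqAle lt.
case l'2 : l'.2.
  have el : l = l'.
    move: l l' l2 l'2 e {pl pl' ll' xw yw' Ll rl r'l le le1 le2 l'0 from_ball}.
    by move=> [? []] [? []] //= _ _ ->.
  by rewrite -el; exists (inr c), (inr c').
by apply: from_ball bb' bx b'y _ _; rewrite ?l'2// rl.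
Qed.

Lemma coherent_trace : coherent Lambda (trace p).
Proof.
split.
- move=> l x y x' y' pl xx' yy' [w [w' [xw yw' ww']]].
  by exists w, w'; split=> //; [exact: (node_near uryU xw)|exact: (node_near uryU yw')].
- move=> l x y y' pl [w [w' [xw yw' ww']]] [v [v' [xv yv' vv']]].
  rewrite -(node_eqP uryU Lpos yw' yv'); rewrite (node_fun xv xw) in vv'.
  exact: sends_fun ww' vv'.
- move=> l x x' y pl [w [w' [xw yw' ww']]] [v [v' [xv yv' vv']]].
  rewrite -(node_eqP uryU Lpos xw xv); rewrite (node_fun yv' yw') in vv'.
  exact: sends_inj ww' vv'.
- by move=> l l' x y; exact: trace_le.
Qed.

End partial_isomorphism.

Lemma trace_mul (p q : partial_bij (tilde_tree Lambda U)) l x y :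
  woolly (pb_dom q) -> tree_isomorphism q ->
  trace (pb_mul p q) l x y <-> exists2 z, trace q l x z & trace p l z y.
Proof.
move=> wq iq; split=> [[w [w' [xw yw' [v wv vw']]]]|
  [z [w [v [xw zv wv]]] [v' [w' [zv' yw' v'w']]]]].
  have [z zv] := sends_node wq iq wv xw.
  by exists z; [exists w, v|exists v, w'].
exists w, w'; split=> //; exists v => //.
by rewrite (node_fun zv zv').
Qed.

End gamma.

(** * Limits of isometries belong to the semigroup *)

Section ultralimit.
Context {R : realType} {Lambda : set R} {U : metricType R}.
Hypothesis uryU : urysohn Lambda U.
Hypothesis Lpos : Lambda `<=` [set r | 0 < r].
Implicit Types (x y z : U) (r s t : {nonneg R}) (l : @level R).
Implicit Types (w : tilde_tree Lambda U) (S : set (tilde_tree Lambda U)).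

Let um := urysohn_ultrametric uryU.

Lemma act_tilde_infinity g (a : tilde_points U) : set_val a = None ->
  act_tilde g (inl a : tilde_tree Lambda U) = inl a.
Proof.
move=> aN; congr inl; apply: val_inj.
by rewrite -[LHS]/(act_tree g (set_val a)) aN.
Qed.

Lemma act_tilde_mul g h w : act_tilde (isom_mul g h) w = act_tilde g (act_tilde h w).
Proof.
have [[a -> aN]|[l [x xw]]] := tilde_cases uryU Lpos w.
  by rewrite !act_tilde_infinity.
apply: (@node_fun _ _ _ l (isom_fun g (isom_fun h x))).
  exact: (node_act (isom_mul g h) xw).
exact: node_act (node_act h xw).
Qed.

Lemma act_tilde_one w : act_tilde isom_one w = w.
Proof.
have [[a -> aN]|[l [x xw]]] := tilde_cases uryU Lpos w; first exact: act_tilde_infinity.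
exact: node_fun (node_act isom_one xw) xw.
Qed.

(** Equivalently, the stabilizer of [w] in the isometry group is contained in that of [w']. *)
Definition determines w w' :=
  forall g h, act_tilde g w = act_tilde h w -> act_tilde g w' = act_tilde h w'.

Lemma node_determines l l' x w w' : node l x w -> node l' x w' ->
  (forall a : R, a = 0 \/ Lambda a -> in_level l a -> in_level l' a) -> determines w w'.
Proof.
move=> xw xw' ll' g h /(node_eqP uryU Lpos (node_act g xw) (node_act h xw)) gh.
apply/(node_eqP uryU Lpos (node_act g xw') (node_act h xw')); apply: ll' => //.
exact: mdist_spectrum0.
Qed.

Lemma point_node (a : tilde_points U) x r : set_val a = beta x r ->
  node (r%:num, false) x (inl a : tilde_tree Lambda U).
Proof. by move=> ax; split=> //; exists r. Qed.

Lemma infinity_point : exists a : tilde_points U, set_val a = None.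
Proof.
have P : (None : tree U) \in tilde_points U by apply/mem_set; left; rewrite /= ltry.
by exists (exist (fun q => q \in tilde_points U) _ P).
Qed.

Lemma positive_point x r : 0 < r%:num -> exists a : tilde_points U, set_val a = beta x r.
Proof.
move=> r0; have P : beta x r \in tilde_points U.
  by apply/mem_set; left; rewrite /= lte_fin.
by exists (exist (fun q => q \in tilde_points U) _ P).
Qed.

Lemma vertex_actual x r : Lambda r%:num -> actual_vertex Lambda (beta x r).
Proof.
move=> Lr; have [y yP] := generic_point uryU Lpos [:: x] x Lr.
have xy : mdist x y = r%:num.
  by rewrite metric_sym yP ?inE// mdistxx max_l// ltW// Lpos.
have germ_at z : exists2 c : germ Lambda U, germ_vertex c = beta z r &
    node (r%:num, true) z (inr c).
  have [[a [//]|c cz]] := node_exists uryU Lpos z (Lr : proper_level Lambda (r%:num, true)).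
  exists c => //; have [_ [s sr [-> _]]] := cz.
  by apply/(beta_eqP um); rewrite mdistxx; split=> //; apply: val_inj.
have [c cv cx] := germ_at x; have [c' c'v c'y] := germ_at y.
exists c, c'; split=> //.
  by rewrite c'v; apply/(beta_eqP um); rewrite metric_sym xy.
move=> e; have : (inr c : tilde_tree Lambda U) = inr c' by rewrite e.
by move=> /(node_eqP uryU Lpos cx c'y); rewrite /in_level/= xy ltxx.
Qed.

Lemma naked_gap xi x r s : naked Lambda xi (beta x r) -> Lambda s%:num ->
  r%:num < s%:num -> over xi (beta x s) -> False.
Proof.
move=> [_ nk] Ls rs os; apply: (nk (beta x s)); last exact: vertex_actual.
- split; last by right.
  by apply/(ascending_betaP um); rewrite mdistxx ltW.
- move=> e; case: xi os {nk} e => [b|//] os e; rewrite -e in os.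
  by move: os => /(over_betaP um)[]; rewrite ltxx.
- by move=> /(beta_eqP um)[e _]; rewrite e ltxx in rs.
Qed.

Lemma gap_isolated x (a : R) : 0 < a -> (forall b, Lambda b -> ~ b < a) ->
  isolated [set: U] x.
Proof.
move=> a0 gap; split; first exact: in_setT.
exists (ball x a); first exact: nbhsx_ballx.
rewrite setIT; apply/seteqP; split=> y /=; last by move=> ->; exact: ballxx.
rewrite ballEmdist /= => xy; have [e|Lxy] := mdist_spectrum0 uryU x y.
  by rewrite (mdist_positivity _ _ e).
by case: (gap _ Lxy).
Qed.

(* If the gap reaches down to height 0, then x is isolated. *)
Lemma gap_point x r (a : R) : r%:num < a ->
  (forall b, Lambda b -> r%:num < b -> ~ b < a) ->
  exists q : tilde_points U, set_val q = beta x r.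
Proof.
move=> ra gap; have [r0|] := ltP 0 r%:num; first exact: positive_point.
move=> r0; have e : r = 0%:nng by apply: val_inj; apply/eqP; rewrite /= eq_le r0/=.
have a0 : 0 < a by rewrite (le_lt_trans _ ra).
have P : beta x r \in tilde_points U.
  apply/mem_set; right; exists x; last by rewrite e.
  apply: gap_isolated a0 _ => b Lb; apply: gap => //.
  by rewrite (le_lt_trans r0)// Lpos.
by exists (exist (fun q => q \in tilde_points U) _ P).
Qed.

(** Every clause of [woolly] leads from an element to one that it determines, or to infinity. For
    the lower end of a naked segment the reason is the gap in the spectrum: no distance lies
    strictly between the two heights, so fixing the upper ball or germ already fixes the lower
    ball. *)
Lemma determined_woolly S :
  (forall a, set_val a = None -> S (inl a)) ->
  (forall w w', determines w w' -> S w -> S w') -> woolly S.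
Proof.
move=> SN Sdet.
have [aN aNE] := infinity_point.
split.
- by exists (inl aN); exact: SN.
- move=> a Sa; case ae : (set_val a) => [b|].
    have [x bx] := iballP b; rewrite bx -/(beta x _) in ae *.
    set r := radius b in ae *.
    have ax := point_node ae; split=> [q|c].
      move=> /(ascendingP um)[->|[s -> rs]]; first by exists aN => //; exact: SN.
      have [r0|r0] := ltP 0 s%:num.
        have [d dx] := positive_point x r0; exists d => //.
        apply: Sdet Sa; apply: node_determines ax (point_node dx) _ => t _.
        by rewrite /in_level/= => /le_trans; exact.
      exists a => //; rewrite ae; congr beta; apply/val_inj/le_anti.
      by apply/andP; split=> //; exact: (le_trans r0 (_ : 0 <= r%:num)).
    move=> _ cx; have [[? //]|[l [y cy]]] := tilde_cases uryU Lpos (inr c).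
    have /(node_germ_dir uryU Lpos _ _ cy)[rl yx] := cx.
    have l2 : l.2 by have [] := cy.
    have cx' : node l x (inr c) by apply: (node_near uryU cy); rewrite /in_level l2.
    apply: Sdet Sa; apply: node_determines ax cx' _ => t _.
    by rewrite /in_level/= l2 => /le_lt_trans; exact.
  split=> [q [->|]|c _].
  + by exists a.
  + by case: q.
  + by have [q _ ->] := germ_dirP c => -[]; case: (germ_vertex c).
- move=> c Sc; have [[? //]|[l [y cy]]] := tilde_cases uryU Lpos (inr c).
  have [l2 [r rl [cv _]]] := cy.
  have r0 : 0 < r%:num by rewrite rl; exact: Lpos (node_germ_level cy).
  have [d dx] := positive_point y r0; exists d; first by rewrite dx.
  apply: Sdet Sc; apply: node_determines cy (point_node dx) _ => t _.
  by rewrite /in_level/= l2 rl => /ltW.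
- move=> xi eta [nk _]; have oe : over xi eta by case: nk.
  have [x [r er]] : exists x r, eta = beta x r.
    case: eta oe {nk} => [b|]; last by case: xi.
    by move=> _; have [x bx] := iballP b; exists x, (radius b); rewrite /beta -bx.
  rewrite {eta}er in nk oe *; split.
    move=> z [rz zxi] zNxi zNe [d dz Sd]; rewrite -dz in rz zxi zNxi zNe.
    have [dN|[s ds rs]] := ascendingP um rz.
      by case: zxi => [e|]; [case: zNxi; rewrite e|rewrite dN; case: xi {nk oe zNxi}].
    have oxi : over xi (beta x s) by case: zxi => [e|]; [case: zNxi|rewrite ds].
    have {}rs : r%:num < s%:num.
      rewrite lt_neqAle rs andbT; apply/eqP => e; apply: zNe; rewrite ds.
      by congr beta; apply: val_inj.
    have gap (b : R) : Lambda b -> r%:num < b -> ~ b <= s%:num.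
      move=> Lb rb bs; have [u ub] := nonneg_of (ltW (Lpos Lb)); rewrite -ub in Lb rb bs.
      apply: (naked_gap nk Lb rb).
      case: xi oxi {nk oe zxi zNxi} => [c|//].
      have [y cy] := iballP c; rewrite cy -/(beta y _).
      move=> /(over_betaP um)[su xy]; apply/(over_betaP um); split=> //.
      exact: le_lt_trans bs su.
    have [|q qx] := @gap_point x r s%:num rs.
      by move=> b Lb rb /ltW; exact: gap.
    exists q => //; apply: Sdet Sd.
    apply: node_determines (point_node ds) (point_node qx) _ => b bL.
    rewrite /in_level/= => bs; rewrite leNgt; apply/negP => rb.
    have [e|Lb] := bL; last by case: (gap b).
    by have : 0 <= r%:num by []; rewrite leNgt -e rb.
  move=> c cxi ce Sc; have [[? //]|[l [y cy]]] := tilde_cases uryU Lpos (inr c).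
  have /(node_germ_dir uryU Lpos _ _ cy)[rl yx] := ce.
  have l2 : l.2 by have [] := cy.
  have cx : node l x (inr c) by apply: (node_near uryU cy); rewrite /in_level l2.
  have [_ [u ul [cv _]]] := cx; rewrite -cxi cv in nk.
  have gap (b : R) : Lambda b -> r%:num < b -> ~ b < l.1.
    move=> Lb rb bl; have [t tb] := nonneg_of (ltW (Lpos Lb)); rewrite -tb in Lb rb bl.
    apply: (naked_gap nk Lb rb); apply/(over_betaP um); rewrite mdistxx ul; split=> //.
    exact: ltW (Lpos (node_germ_level cy)).
  have [q qx] := gap_point x rl gap.
  exists q => //; apply: Sdet Sc.
  apply: node_determines cx (point_node qx) _ => b bL.
  rewrite /in_level/= l2 => bs; rewrite leNgt; apply/negP => rb.
  have [e|Lb] := bL; last by case: (gap b).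
  by have : 0 <= r%:num by []; rewrite leNgt -e rb.
Qed.

Section limit.
Variable F : set_system (isometries U).
Context {FF : ProperFilter F}.

(** The limit for the discrete topology of the tree; it is defined where the images are eventually
    constant. *)
Definition limit_pb : partial_bij (tilde_tree Lambda U).
Proof.
exists (fun w w' => F [set g | act_tilde g w = w']).
- move=> w w1 w2 F1 F2; have [g [/= <- <-]] := filter_ex (filterI F1 F2).
  by [].
- move=> w1 w2 w F1 F2; have [g [/= e1 e2]] := filter_ex (filterI F1 F2).
  by apply: (@act_tilde_inj _ _ _ g); rewrite e1 e2.
Defined.

Lemma limit_dom_woolly : woolly (pb_dom limit_pb).
Proof.
apply: determined_woolly => [a aN|w w' ww' [v Fv]].
  by exists (inl a); apply: (filterS _ filterT) => g _ /=; exact: act_tilde_infinity.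
have [g0 g0w] := filter_ex Fv; exists (act_tilde g0 w').
by apply: filterS Fv => g /= gw; apply: ww'; rewrite gw.
Qed.

Lemma limit_im_woolly : woolly (pb_im limit_pb).
Proof.
apply: determined_woolly => [a aN|w w' ww' [v Fv]].
  by exists (inl a); apply: (filterS _ filterT) => g _ /=; exact: act_tilde_infinity.
have [g0 g0v] := filter_ex Fv; rewrite /= in g0v.
(* Both [g] and [g0] send [v] to [w], so [g g0^-1] fixes [w], and with it [w']. *)
exists (act_tilde (isom_inv g0) w'); apply: filterS Fv => g /= gv.
rewrite -act_tilde_mul -[RHS]act_tilde_one; apply: ww'.
rewrite act_tilde_mul act_tilde_one -{1}g0v -(act_tilde_mul (isom_inv g0)).
by rewrite isom_mulVg act_tilde_one.
Qed.

Lemma limit_isomorphism : tree_isomorphism limit_pb.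
Proof.
have act2 w1 w1' w2 w2' : sends limit_pb w1 w1' -> sends limit_pb w2 w2' ->
    exists g, act_tilde g w1 = w1' /\ act_tilde g w2 = w2'.
  by move=> F1 F2; have [g [? ?]] := filter_ex (filterI F1 F2); exists g.
split.
- by move=> a c; split=> /filter_ex[].
- move=> a a' Fa; have [g /= [<-]] := filter_ex Fa.
  by rewrite -[set_val (act_point _ _)]/(act_tree g (set_val a)) act_height.
- move=> a a' b b' Fa Fb; have [g [[<-] [<-]]] := act2 _ _ _ _ Fa Fb.
  exact: act_over.
- move=> c c' a a' Fc Fa; have [g [[<-] [<-]]] := act2 _ _ _ _ Fc Fa.
  rewrite -[set_val (act_point _ _)]/(act_tree g (set_val a)) /=.
  by split=> [/(bij_inj (act_tree_bij g))|->].
- move=> c c' a a' Fc Fa; have [g [[<-] [<-]]] := act2 _ _ _ _ Fc Fa.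
  have -> : germ_dir (act_germ g c) = act_tree g @` germ_dir c by [].
  rewrite -[set_val (act_point _ _)]/(act_tree g (set_val a)) image_inj//.
  exact: bij_inj (act_tree_bij g).
Qed.

Lemma limit_Gamma : Gamma Lambda U limit_pb.
Proof.
split; [exact: limit_dom_woolly|exact: limit_im_woolly|exact: limit_isomorphism].
Qed.

End limit.
Arguments limit_pb F {FF}.

(** The ultrafilter property is needed for relations absent from the trace: these must fail for
    almost all [g]. *)
Lemma trace_limit (F : set_system (isometries U)) (FF : UltraFilter F) l x y :
  proper_level Lambda l ->
  F [set g | in_level l (mdist (isom_fun g x) y) <-> trace (limit_pb F) l x y].
Proof.
move=> pl; have [w xw] := node_exists uryU Lpos x pl.
have [w' yw'] := node_exists uryU Lpos y pl.
have iff g : act_tilde g w = w' <-> in_level l (mdist (isom_fun g x) y).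
  exact: (node_eqP uryU Lpos (node_act g xw) yw').
have tE := traceE (limit_pb F) xw yw'.
have [Fw|Fnw] := in_ultra_setVsetC [set g | act_tilde g w = w'] FF.
  have tr : trace (limit_pb F) l x y by apply/tE.
  by apply: filterS Fw => g /= /iff gl; split.
have ntr : ~ trace (limit_pb F) l x y.
  by move=> /tE Fw; have [h []] := filter_ex (filterI Fw Fnw).
by apply: filterS Fnw => g /= ngw; split=> [/iff|].
Qed.

End ultralimit.

(** * The extended representation *)

Lemma filter_seq (T : Type) (I : eqType) (F : set_system T) (s : seq I) (P : I -> set T) :
  Filter F -> (forall i, i \in s -> F (P i)) -> F [set t | forall i, i \in s -> P i t].
Proof.
move=> FF; elim: s => [_|i s ih Ps]; first by apply: (filterS _ filterT).
have Fi : F (P i) by apply: Ps; rewrite inE eqxx.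
have Fs : F [set t | forall j, j \in s -> P j t].
  by apply: ih => j js; apply: Ps; rewrite inE js orbT.
apply: filterS (filterI Fi Fs) => t [Pit Pst] j.
by rewrite inE => /orP[/eqP->|/Pst].
Qed.

Lemma nbhs_sends (Omega : Type) (p : partial_bij Omega) (a b : Omega) :
  nbhs p [set q | sends q a b <-> sends p a b].
Proof.
have sub (A : set (partial_bij Omega)) : pb_subbase A -> open A.
  move=> sA; exists [set A]; last by rewrite bigcup_set1.
  by move=> _ ->; exact: finI_from1.
have [pab|npab] := pselect (sends p a b).
  have : nbhs p [set q | sends q a b].
    by apply: open_nbhs_nbhs; split=> //; apply: sub; exists a, b; left.
  by apply: filterS => q /= qab; split.
have : nbhs p [set q | ~ sends q a b].
  by apply: open_nbhs_nbhs; split=> //; apply: sub; exists a, b; right.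
by apply: filterS => q /= nqab; split.
Qed.

Lemma bounded_op_eq (R : realType) (H : completeNormedModType R[i]) (S T : bounded_op H) :
  (forall u, S u = T u) -> S = T.
Proof.
case: S T => [S Sb] [T Tb] /= ST.
have e : S = T.
  case: S T ST {Sb Tb} => [S [[Sa] [Ss]]] [T [[Ta] [Ts]]] /= /funext ST.
  subst T; congr GRing.Linear.Pack; congr GRing.Linear.Class.
    by congr Algebra.isNmodMorphism.Axioms_; exact: Prop_irrelevance.
  by congr GRing.isScalable.Axioms_; exact: Prop_irrelevance.
by subst T; congr BoundedOp; exact: Prop_irrelevance.
Qed.

Section coherent_relations.
Context {R : realType} {Lambda : set R} {U : metricType R}.
Hypothesis uryU : urysohn Lambda U.
Hypothesis Lpos : Lambda `<=` [set r | 0 < r].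
Implicit Types (E : @level R -> U -> U -> Prop).

Lemma coherent_eq E E' : (forall l x y, E l x y <-> E' l x y) ->
  coherent Lambda E -> coherent Lambda E'.
Proof.
move=> EE' [near func inj le]; split.
- by move=> l x y x' y' pl xx' yy' /EE' xy; apply/EE'; exact: near xy.
- by move=> l x y y' pl /EE' xy /EE' xy'; exact: func xy xy'.
- by move=> l x x' y pl /EE' xy /EE' xy'; exact: inj xy xy'.
- by move=> l l' x y pl pl' ll' /EE' xy; apply/EE'; exact: le xy.
Qed.

Lemma coherent_converse E : coherent Lambda E -> coherent Lambda (fun l x y => E l y x).
Proof.
move=> [near func inj le]; split.
- by move=> l x y x' y' pl xx' yy'; exact: near.
- by move=> l x y y' pl; exact: inj.
- by move=> l x x' y pl; exact: func.
- by move=> l l' x y pl pl' ll'; exact: le.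
Qed.

Lemma coherent_comp E E' : coherent Lambda E -> coherent Lambda E' ->
  coherent Lambda (fun l x y => exists2 z, E' l x z & E l z y).
Proof.
move=> [near func inj le] [near' func' inj' le']; split.
- move=> l x y x' y' pl xx' yy' [z xz zy]; have zz : in_level l (mdist z z).
    by rewrite mdistxx (in_level0 Lpos).
  by exists z; [exact: near' xz|exact: near zy].
- move=> l x y y' pl [z xz zy] [z' xz' z'y'].
  have z'z := func' _ _ _ _ pl xz' xz; apply: func zy _ => //.
  by apply: near z'y' => //; rewrite mdistxx (in_level0 Lpos).
- move=> l x x' y pl [z xz zy] [z' xz' z'y].
  have z'z := inj _ _ _ _ pl z'y zy; apply: inj' xz _ => //.
  by apply: near' xz' => //; rewrite mdistxx (in_level0 Lpos).
- move=> l l' x y pl pl' ll' [z xz zy].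
  by exists z; [exact: le' xz|exact: le zy].
Qed.

Lemma filter_agree (T : Type) (F : set_system T) (E : T -> @level R -> U -> U -> Prop)
    (E0 : @level R -> U -> U -> Prop) (xs : seq U) (ls : seq level) : Filter F ->
  (forall l x y, proper_level Lambda l -> F [set t | E t l x y <-> E0 l x y]) ->
  F [set t | forall l, l \in ls -> forall x, x \in xs -> forall y, y \in xs ->
    proper_level Lambda l -> (E t l x y <-> E0 l x y)].
Proof.
move=> FF FE.
apply: filter_seq => l _; apply: filter_seq => x _; apply: filter_seq => y _.
have [pl|npl] := pselect (proper_level Lambda l); last by apply: (filterS _ filterT).
by apply: filterS (FE l x y pl) => t.
Qed.

End coherent_relations.

Section extension.
Context {R : realType} {U : metricType R} (H : completeNormedModType R[i]).
Variable dot : {dot H for @Num.conj R[i]}.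
Hypothesis hn : hilbert_norm dot.
Variable rho : isometries U -> bounded_op H.
Hypothesis rep : unitary_representation dot rho.
Context {Lambda : set R}.
Hypothesis uryU : urysohn Lambda U.
Hypothesis Lpos : Lambda `<=` [set r | 0 < r].
Implicit Types (g h k : isometries U) (u v w : H).
Implicit Types (p q : partial_bij (tilde_tree Lambda U)).

Definition weak_limit (E : @level R -> U -> U -> Prop) (T : bounded_op H) := forall u v,
  (fun g => dot (rho g u) v : (R[i] : numFieldType)) @
    approximation_filter (Lambda := Lambda) E --> (dot (T u) v : (R[i] : numFieldType)).

(** A weak limit exists whenever the trace is coherent; the default value is arbitrary. *)
Definition extension p : bounded_op H := xget (rho isom_one) (weak_limit (trace p)).

Lemma extensionP p : coherent Lambda (trace p) -> weak_limit (trace p) (extension p).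
Proof.
move=> cp; rewrite /extension; case: xgetP => [//|none].
have FF := approximation_filter_proper uryU Lpos cp.
by have [T /none] := weak_limit_operator hn rep uryU Lpos (E := trace p).
Qed.

Lemma extension_near p u v (e : R) : coherent Lambda (trace p) -> 0 < e ->
  exists xs ls, forall g, approximants Lambda (trace p) xs ls g ->
    complex.Re `|dot (rho g u) v - dot (extension p u) v| <= e.
Proof.
move=> cp e0; have FF := approximation_filter_proper uryU Lpos cp.
have lim := extensionP cp; have /cvg_complexP/(_ e e0)[xs [ls sP]] := lim u v.
by exists xs, ls => g /sP.
Qed.

Lemma coherent_Gamma p : Gamma Lambda U p -> coherent Lambda (trace p).
Proof. by move=> [wp _ ip]; exact: coherent_trace. Qed.

(** [g] is itself an approximant of its own trace, to any precision. *)
Lemma extension_isom g : extension (isom_pb g) = rho g.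
Proof.
apply: bounded_op_eq => u; apply: (eq_dot (dot := dot)) => v; apply: small_eq => e e0.
have [xs [ls sP]] := extension_near u v (coherent_isom uryU Lpos g) e0.
by rewrite Re_normB; apply: sP => l x y _ pl _ _; rewrite trace_isom.
Qed.

(** An iterated limit: [g] approximates [p] for the coefficient of [extension q u], and then [h],
    depending on [g], approximates [q] for the coefficient with [rho (g^-1) v]. Both are chosen so
    that the product also approximates the trace of [pb_mul p q]. *)
Lemma extension_mul p q : Gamma Lambda U p -> Gamma Lambda U q ->
  forall u, extension (pb_mul p q) u = extension p (extension q u).
Proof.
move=> Gp Gq u; have cp := coherent_Gamma Gp; have cq := coherent_Gamma Gq.
have mulE l x y : trace (pb_mul p q) l x y <-> exists2 z, trace q l x z & trace p l z y.
  by case: Gq => wq _ iq; exact: trace_mul.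
have cpq : coherent Lambda (trace (pb_mul p q)).
  by apply: coherent_eq (coherent_comp Lpos cp cq) => l x y; rewrite mulE.
apply: (eq_dot (dot := dot)) => v; apply: small_eq => e e0.
have e3 : 0 < e / 3 by rewrite divr_gt0.
have [xs [ls sP]] := extension_near u v cpq e3.
have [ys [ms sPp]] := extension_near (extension q u) v cp e3.
pose mid l x := xget x [set z | trace q l x z].
pose zs := [seq mid l x | l <- ls, x <- xs].
have [g gP] := approximants_nonempty uryU Lpos (ys ++ xs ++ zs) (ms ++ ls) cp.
have [zs' [ns sPq]] := extension_near u (rho (isom_inv g) v) cq e3.
(* [g (h x)] is close to [y] iff [h x] is close to [g^-1 y], hence the additional test points
   [g^-1 x]. *)
have [h hP] := approximants_nonempty uryU Lpos
  (zs' ++ xs ++ zs ++ [seq isom_fun (isom_inv g) x | x <- xs]) (ns ++ ls) cq.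
have ghP : approximants Lambda (trace (pb_mul p q)) xs ls (isom_mul g h).
  move=> l x y lls pl xxs yxs; rewrite mulE isom_mulE.
  have hE : in_level l (mdist (isom_fun h x) (isom_fun (isom_inv g) y)) <->
      trace q l x (isom_fun (isom_inv g) y).
    by apply: hP => //; rewrite !mem_cat ?lls ?xxs ?orbT// map_f ?orbT.
  rewrite metric_sym mdist_inv metric_sym in hE; rewrite hE.
  have zzs : mid l x \in zs by apply/allpairsP; exists (l, x).
  have gE : in_level l (mdist (isom_fun g (mid l x)) y) <-> trace p l (mid l x) y.
    by apply: gP => //; rewrite !mem_cat ?lls ?yxs ?zzs ?orbT.
  split=> [xgy|[z xz zy]].
    have xm : trace q l x (mid l x) by rewrite /mid; case: xgetP => // /(_ _ xgy).
    exists (mid l x) => //; apply/gE.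
    by have := coherent_fun cq pl xm xgy; rewrite metric_sym mdist_inv metric_sym.
  have xm : trace q l x (mid l x) by rewrite /mid; case: xgetP => // /(_ _ xz).
  have zm := coherent_fun cq pl xz xm.
  have my : trace p l (mid l x) y.
    by apply: (coherent_near cp pl zm _ zy); rewrite mdistxx (in_level0 Lpos).
  apply: (coherent_near cq pl _ _ xm); first by rewrite mdistxx (in_level0 Lpos).
  by rewrite metric_sym mdist_inv metric_sym; apply/gE.
have gp : approximants Lambda (trace p) ys ms g.
  by apply: approximants_sub gP => z; rewrite mem_cat => ->.
have hq : approximants Lambda (trace q) zs' ns h.
  by apply: approximants_sub hP => z; rewrite mem_cat => ->.
have h1 := sP _ ghP; have h2 := sPp _ gp; have h3 := sPq _ hq.
rewrite (rep_mul rep) in h1; rewrite -!(rep_dotV rep) in h3.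
have h4 := Re_normD (dot (extension (pb_mul p q) u) v - dot (rho g (rho h u)) v)
  (dot (rho g (rho h u)) v - dot (extension p (extension q u)) v).
have h5 := Re_normD (dot (rho g (rho h u)) v - dot (rho g (extension q u)) v)
  (dot (rho g (extension q u)) v - dot (extension p (extension q u)) v).
rewrite subrKA in h4; rewrite subrKA in h5; rewrite Re_normB in h1.
lra.
Qed.

Lemma extension_star p : Gamma Lambda U p -> adjoint dot (extension p) (extension (pb_star p)).
Proof.
move=> /coherent_Gamma cp u v.
have cs : coherent Lambda (trace (pb_star p)).
  by apply: coherent_eq (coherent_converse cp) => l x y; rewrite trace_star.
apply: small_eq => e e0; have e2 : 0 < e / 2 by rewrite divr_gt0.
have [xs [ls sP]] := extension_near u v cp e2.
have [ys [ms sPs]] := extension_near v u cs e2.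
have [g gP] := approximants_nonempty uryU Lpos (xs ++ ys) (ls ++ ms) cp.
have gp : approximants Lambda (trace p) xs ls g.
  by apply: approximants_sub gP => z; rewrite mem_cat => ->.
have gs : approximants Lambda (trace (pb_star p)) ys ms (isom_inv g).
  move=> l x y lms pl xys yys; rewrite trace_star mdist_inv metric_sym.
  by apply: gP => //; rewrite mem_cat ?lms ?xys ?yys orbT.
have h1 := sP _ gp; have h2 := sPs _ gs.
have conjE : complex.Re `|dot u (rho (isom_inv g) v) - dot u (extension (pb_star p) v)| =
    complex.Re `|dot (rho (isom_inv g) v) u - dot (extension (pb_star p) v) u|.
  by rewrite (dotC _ u) (dotC _ u (extension _ v)) -rmorphB norm_conjC.
rewrite -conjE -(rep_dotV rep) in h2; rewrite Re_normB in h1.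
have := Re_normD (dot (extension p u) v - dot (rho g u) v)
  (dot (rho g u) v - dot u (extension (pb_star p) v)).
rewrite subrKA; lra.
Qed.

Lemma nbhs_trace p l x y : proper_level Lambda l ->
  nbhs p [set q | trace q l x y <-> trace p l x y].
Proof.
move=> pl; have [w xw] := node_exists uryU Lpos x pl.
have [w' yw'] := node_exists uryU Lpos y pl.
by apply: filterS (nbhs_sends p w w') => q; rewrite /= !(traceE _ xw yw').
Qed.

(** A neighbourhood of [p] prescribes finitely many trace relations. A sufficiently fine approximant
    of a nearby [q] therefore approximates [p] as well, and one isometry compares the two
    operators. *)
Lemma extension_continuous :
  {within Gamma Lambda U, continuous (extension : _ -> weak_op dot)}.
Proof.
apply/subspace_continuousP => p Gp; apply: cvg_weak_op => u v.
have cp := coherent_Gamma Gp.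
apply/cvg_complexP => e e0; have e2 : 0 < e / 2 by rewrite divr_gt0.
have [xs [ls sP]] := extension_near u v cp e2.
have near_p : nbhs p [set q | forall l, l \in ls -> forall x, x \in xs ->
    forall y, y \in xs -> proper_level Lambda l -> (trace q l x y <-> trace p l x y)].
  by apply: filter_agree => l x y; exact: nbhs_trace.
apply: filterS near_p => q qp Gq; have cq := coherent_Gamma Gq.
suff : complex.Re `|dot (extension q u) v - dot (extension p u) v| <= e by [].
have [ys [ms sPq]] := extension_near u v cq e2.
have [g gP] := approximants_nonempty uryU Lpos (xs ++ ys) (ls ++ ms) cq.
have gp : approximants Lambda (trace p) xs ls g.
  move=> l x y lls pl xxs yxs; rewrite -qp//.
  by apply: gP => //; rewrite mem_cat ?lls ?xxs ?yxs.
have gq : approximants Lambda (trace q) ys ms g.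
  by apply: approximants_sub gP => z; rewrite mem_cat orbC => ->.
have h1 := sP _ gp; have h2 := sPq _ gq; rewrite Re_normB in h2.
have := Re_normD (dot (extension q u) v - dot (rho g u) v)
  (dot (rho g u) v - dot (extension p u) v).
rewrite subrKA; lra.
Qed.

Lemma extension_closure :
  closure (range rho : set (weak_op dot)) = extension @` Gamma Lambda U.
Proof.
apply/seteqP; split=> [A clA|_ [p Gp <-] B nB]; last first.
  have cp := coherent_Gamma Gp; have FF := approximation_filter_proper uryU Lpos cp.
  pose G : set_system (weak_op dot) :=
    fmap rho (approximation_filter (Lambda := Lambda) (trace p)).
  have FG : ProperFilter G by exact: fmap_proper_filter.
  have cvg_rho : G --> (extension p : weak_op dot).
    by apply: cvg_weak_op => u v; exact: extensionP.
  by have [g Bg] := @filter_ex _ _ FF _ (cvg_rho B nB); exists (rho g).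
pose N : set_system (isometries U) := filter_from (nbhs (A : weak_op dot))
  (fun B => [set g | B (rho g : weak_op dot)]).
have NF : ProperFilter N.
  apply: filter_from_proper => [|B /clA[_ [[g _ <-] Bg]]]; last by exists g.
  apply: filter_from_filter => [|B B' nB nB']; first by exists setT; exact: filterT.
  by exists (B `&` B') => //; exact: filterI.
have [F [FF NsubF]] := ultraFilterLemma NF.
pose p : partial_bij (tilde_tree Lambda U) := limit_pb (FF := @ultra_proper _ _ FF).
have Gp : Gamma Lambda U p by exact: limit_Gamma.
have cp := coherent_Gamma Gp.
exists p => //; apply: bounded_op_eq => u.
apply: (eq_dot (dot := dot)) => v; apply: small_eq => e e0.
have e2 : 0 < e / 2 by rewrite divr_gt0.
(* [F] refines the inverse images of the neighbourhoods of [A], so [rho] tends to [A] along [F]. As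
   [F] also contains the approximants of the trace of [p], it tends to [extension p] too. *)
have [xs [ls sP]] := extension_near u v cp e2.
have F1 : F [set g | forall l, l \in ls -> forall x, x \in xs -> forall y, y \in xs ->
    proper_level Lambda l ->
    (in_level l (mdist (isom_fun g x) y) <-> trace p l x y)].
  apply: (filter_agree (E := fun g l x y => in_level l (mdist (isom_fun g x) y))).
  by move=> l x y; exact: trace_limit.
have F2 : F [set g | complex.Re `|dot (rho g u) v - dot (A u) v| <= e / 2].
  apply: NsubF.
  exists [set T : weak_op dot | complex.Re `|dot (T u) v - dot (A u) v| <= e / 2].
    have cont : (fun T : weak_op dot => dot (T u) v : (R[i] : numFieldType)) @ nbhs A -->
        (dot (A u) v : (R[i] : numFieldType)) by exact: weak_op_eval_continuous.
    by move/cvg_complexP: cont; apply.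
  by [].
have [g [g1 g2]] := filter_ex (filterI F1 F2); rewrite /mkset in g2.
have h1 : complex.Re `|dot (rho g u) v - dot (extension p u) v| <= e / 2.
  by apply: sP => l x y lls pl xxs yxs; exact: g1.
have := Re_normD (dot (extension p u) v - dot (rho g u) v)
  (dot (rho g u) v - dot (A u) v).
by rewrite subrKA; rewrite Re_normB in h1; lra.
Qed.

End extension.

Theorem theorem7p3 (R : realType) (Lambda : set R) (U : metricType R)
    (H : completeNormedModType R[i]) (dot : {dot H for @Num.conj R[i]})
    (rho : isometries U -> bounded_op H) :
  countable Lambda -> Lambda `<=` [set r | 0 < r] ->
  urysohn Lambda U ->
  hilbert_norm dot -> separable H ->
  unitary_representation dot rho ->
  exists rhobar : partial_bij (tilde_tree Lambda U) -> bounded_op H,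
    [/\ {within Gamma Lambda U, continuous (rhobar : _ -> weak_op dot)},
        forall g, rhobar (isom_pb g) = rho g,
        star_representation dot (Gamma Lambda U) rhobar &
        closure (range rho : set (weak_op dot)) = rhobar @` Gamma Lambda U].
Proof.
move=> _ Lpos uryU hn _ rep; exists (extension dot rho); split.
- exact: extension_continuous.
- exact: extension_isom.
- by split=> [p q Gp Gq|p Gp]; [exact: extension_mul|exact: extension_star].
- exact: extension_closure.
Qed.
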